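(* Suppose $\psi\in\mathcal{C}$ is $C^2$ on $\Delta_n$, $\psi|_{\partial\Delta_n}\equiv0$, and $\widehat{R}(\psi)$ is bounded. Then $$\mathrm{vol}(\widehat{R}(\psi))=\frac1n\int_{D_{n-1}}\psi(q)\det(-D^2\psi(q))\,dq.$$ In particular, let $C$ be a random vector in $\mathbb{R}_+^n$ satisfying the asymptotic homogeneity assumption (stated in the context) with $h(x)\equiv\gamma>0$ constant (so $\alpha=0$), and let $\mu$ be the weak limit on $\mathcal{C}$, as $K\to\infty$, of the distributions of $K^{1/n}\min\{\ell_1,\dots,\ell_K\}$, where $\ell_1,\ell_2,\dots$ are independent copies of $\ell(p)=\langle C,p\rangle$, $p\in\overline{\Delta}_n$. Then $$\mathsf{T}_\mu(\psi)=\exp\Big(-\frac{\gamma}{n}\int_{D_{n-1}}\psi(q)\det(-D^2\psi(q))\,dq\Big),$$ where $\mathsf{T}_\mu(\psi)=\mu\{\omega\in\mathcal{C}:\omega\ge\psi\}$.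
   Context: Let $n\ge2$, $\mathbb{R}_+^n:=(0,\infty)^n$, $\Delta_n:=\{p\in(0,1)^n:p_1+\cdots+p_n=1\}$, $\overline{\Delta}_n$ its closure, $\partial\Delta_n=\overline{\Delta}_n\setminus\Delta_n$, $\langle p,x\rangle=\sum_ip_ix_i$. $\mathcal{C}:=\{\psi:\overline{\Delta}_n\to[0,\infty)\text{ continuous and concave}\}$ carries the (metrizable) topology of uniform convergence on compact subsets of $\Delta_n$ and its Borel $\sigma$-algebra. For $p\in\Delta_n$, $a\ge0$, $R(p,a):=\{x\in\mathbb{R}_+^n:\langle p,x\rangle<a\}$, and $\widehat{R}(\psi):=\bigcup_{p\in\Delta_n}R(p,\psi(p))$; $\mathrm{vol}$ is Lebesgue measure on $\mathbb{R}^n$. $D_{n-1}:=\{(q_1,\dots,q_{n-1})\in(0,1)^{n-1}:\sum_{i=1}^{n-1}q_i<1\}$. A function $\psi\in\mathcal{C}$ is also regarded as a function on $D_{n-1}$ by $\psi(q_1,\dots,q_{n-1})=\psi(q_1,\dots,q_{n-1},1-\sum_{i=1}^{n-1}q_i)$, and $D^2\psi(q)$ is its $(n-1)\times(n-1)$ Hessian matrix in the variable $q$. Asymptotic homogeneity assumption: $C=(C_1,\dots,C_n)$ has a joint density $\rho$ on $\mathbb{R}_+^n$, and there exist $\alpha\in\mathbb{R}$ and a non-negative measurable function $h$ on $\mathbb{R}_+^n$ with $\int_{\mathbb{R}_+^n}h(x)\,dx\in(0,\infty]$ such that $\lim_{\kappa\to0^+}\kappa^{-\alpha}\rho(\kappa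 x)=h(x)$ for $x\in\mathbb{R}_+^n$, uniformly for $x\in\Delta_n$. Under this assumption $\alpha>-n$ and the weak limit on $\mathcal{C}$ of the distributions of $K^{\frac1{n+\alpha}}\min\{\ell_1,\dots,\ell_K\}$ exists. *)

(* Defs.v *)
From HB Require Import structures.
From mathcomp Require Import all_boot all_order all_algebra.
From mathcomp Require Import all_classical all_reals all_analysis.
From mathcomp Require Import ring lra.

Set Implicit Arguments.
Unset Strict Implicit.
Unset Printing Implicit Defensive.

Import Order.TTheory GRing.Theory Num.Theory.
Import numFieldNormedType.Exports.

Local Open Scope classical_set_scope.
Local Open Scope ring_scope.

(* 'rV[R]_n carries the product sigma-algebra generated by the coordinates, as
   the library does for n.-tuple R; for real coordinates it is the Borel
   sigma-algebra of the (sup-)norm topology of 'rV[R]_n. *)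
Definition rV_display : measure_display -> measure_display.
Proof. exact. Qed.

Section measurable_rV.
Context {R : realType} (n : nat).

Let coors (i : 'I_n) (x : 'rV[R]_n) : measurableTypeR R := x ord0 i.

Let rV_set0 : g_sigma_preimage coors set0.
Proof. exact: sigma_algebra0. Qed.

Let rV_setC A : g_sigma_preimage coors A -> g_sigma_preimage coors (~` A).
Proof. exact: sigma_algebraC. Qed.

Let rV_bigcup (F : (set 'rV[R]_n)^nat) :
  (forall i, g_sigma_preimage coors (F i)) ->
  g_sigma_preimage coors (\bigcup_i F i).
Proof. exact: sigma_algebra_bigcup. Qed.

HB.instance Definition _ :=
  @isMeasurable.Build (rV_display default_measure_display)
    'rV[R]_n (g_sigma_preimage coors) rV_set0 rV_setC rV_bigcup.

Lemma measurable_coor (i : 'I_n) :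
  measurable_fun [set: 'rV[R]_n] (fun x : 'rV[R]_n => x ord0 i : R).
Proof.
move=> _ Y mY; rewrite setTI; apply: sub_sigma_algebra => /=.
rewrite -bigcup_seq/=; exists i => /=; first by rewrite mem_index_enum.
by exists Y => //; rewrite setTI.
Qed.

Lemma measurable_fun_rVP d (T : measurableType d) (f : T -> 'rV[R]_n) :
  (forall i, measurable_fun [set: T] (fun t => f t ord0 i : R)) ->
  measurable_fun [set: T] f.
Proof.
move=> mf.
have sub : g_sigma_preimage (fun i => coors i \o f) `<=` measurable.
  apply: smallest_sub; first exact: sigma_algebra_measurable.
  rewrite -bigcup_seq/=; apply: bigcup_sub => i _ _ [A mA <-].
  exact: mf.
move=> _ Y mY; rewrite setTI; apply: sub.
by rewrite g_sigma_preimage_comp; exists Y => //; rewrite setTI.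
Qed.

End measurable_rV.

Section rV_cons.
Context {R : realType} (n : nat).
Implicit Types (z : measurableTypeR R * 'rV[R]_n) (v : 'rV[R]_n.+1).

Definition rV_cons z : 'rV[R]_n.+1 :=
  \row_(i < n.+1) oapp (z.2 ord0) z.1 (unlift ord0 i).

Definition rV_behead v : 'rV[R]_n := \row_(j < n) v ord0 (lift ord0 j).

Lemma rV_cons0 z : rV_cons z ord0 ord0 = z.1.
Proof. by rewrite mxE unlift_none. Qed.

Lemma rV_consK z : rV_behead (rV_cons z) = z.2.
Proof. by apply/rowP => j; rewrite !mxE liftK. Qed.

Lemma measurable_rV_cons : measurable_fun setT rV_cons.
Proof.
apply: measurable_fun_rVP => i; case: (unliftP ord0 i) => [j|] ->.
  have -> : (fun z => rV_cons z ord0 (lift ord0 j)) = (fun z => z.2 ord0 j).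
    by apply/funext => z; rewrite mxE liftK.
  by apply: (measurableT_comp (@measurable_coor R n j)); exact: measurable_snd.
have -> : (fun z => rV_cons z ord0 ord0) = (fun z => z.1).
  by apply/funext => z; rewrite rV_cons0.
exact: measurable_fst.
Qed.

Lemma measurable_rV_behead : measurable_fun setT rV_behead.
Proof.
apply: measurable_fun_rVP => j.
have -> : (fun v => rV_behead v ord0 j) = (fun v => v ord0 (lift ord0 j)).
  by apply/funext => v; rewrite mxE.
exact: measurable_coor.
Qed.

End rV_cons.

Section lebesgue_rV_step.
Context {R : realType} (n : nat).
Variable m : {sigma_finite_measure set 'rV[R]_n -> \bar R}.

Definition lebesgue_rV_step : set 'rV[R]_n.+1 -> \bar R :=
  pushforward (product_measure1 (@lebesgue_measure R) m) (@rV_cons R n).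

Let step0 : lebesgue_rV_step set0 = 0%E.
Proof. by rewrite /lebesgue_rV_step /pushforward preimage_set0 measure0. Qed.

Let step_ge0 A : (0 <= lebesgue_rV_step A)%E.
Proof. by rewrite /lebesgue_rV_step /pushforward; exact: measure_ge0. Qed.

Let step_sigma_additive : semi_sigma_additive lebesgue_rV_step.
Proof.
move=> F mF tF mUF; rewrite /lebesgue_rV_step /pushforward preimage_bigcup.
have mcons B : measurable B -> measurable (@rV_cons R n @^-1` B).
  by move=> mB; rewrite -[X in measurable X]setTI; exact: measurable_rV_cons.
apply: measure_semi_sigma_additive.
- by move=> k; exact: mcons.
- apply/trivIsetP => /= i j _ _ ij; rewrite -preimage_setI.
  by move/trivIsetP : tF => /(_ _ _ _ _ ij) ->//; rewrite preimage_set0.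
- by rewrite -preimage_bigcup; exact: mcons.
Qed.

HB.instance Definition _ := isMeasure.Build _ _ _ lebesgue_rV_step
  step0 step_ge0 step_sigma_additive.

Let step_sigma_finite : sigma_finite setT lebesgue_rV_step.
Proof.
have /sigma_finiteP[/= F [UF ndF mF]] := sigma_finiteT (@lebesgue_measure R).
have /sigma_finiteP[/= G [UG ndG mG]] := sigma_finiteT m.
exists (fun k => [set v : 'rV[R]_n.+1 | F k (v ord0 ord0) /\ G k (rV_behead v)]).
  apply/seteqP; split => // v _.
  have : [set: R] (v ord0 ord0) by [].
  rewrite UF => -[i _ Fi].
  have : [set: 'rV[R]_n] (rV_behead v) by [].
  rewrite UG => -[j _ Gj].
  exists (maxn i j) => //; split.
    by move: Fi; apply/subsetPset/ndF; exact: leq_maxl.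
  by move: Gj; apply/subsetPset/ndG; exact: leq_maxr.
move=> k; have [mFk Fkoo] := mF k; have [mGk Gkoo] := mG k; split.
  rewrite (_ : mkset _ = (fun v : 'rV[R]_n.+1 => v ord0 ord0 : R) @^-1` F k `&`
                         @rV_behead R n @^-1` G k)//.
  apply: measurableI; rewrite -[X in measurable X]setTI.
    exact: measurable_coor.
  exact: measurable_rV_behead.
rewrite /lebesgue_rV_step /pushforward.
rewrite (_ : _ @^-1` _ = F k `*` G k); last first.
  by apply/seteqP; split => z /=; rewrite rV_cons0 rV_consK.
rewrite product_measure1E//; apply: lte_mul_pinfty => //.
by rewrite ge0_fin_numE.
Qed.

HB.instance Definition _ := @Measure_isSigmaFinite.Build _ _ _
  lebesgue_rV_step step_sigma_finite.

End lebesgue_rV_step.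

(* Lebesgue measure on R^n: a point mass for n = 0, and
   Lebesgue(R) \x Lebesgue(R^n) transported to R^(n+1). *)
Fixpoint lebesgue_rV (R : realType) (n : nat) :
    {sigma_finite_measure set 'rV[R]_n -> \bar R} :=
  match n with
  | 0%N => [the {sigma_finite_measure set _ -> \bar R} of dirac (0 : 'rV[R]_0)]
  | m.+1 =>
    [the {sigma_finite_measure set _ -> \bar R} of
      lebesgue_rV_step (lebesgue_rV R m)]
  end.

Lemma lebesgue_rV_box (R : realType) (n : nat) (A : 'I_n -> set R) :
  (forall i, measurable (A i)) ->
  lebesgue_rV R n [set x | forall i, A i (x ord0 i)] =
  (\prod_(i < n) lebesgue_measure (A i))%E.
Proof.
elim: n A => [|n ih] A mA.
  rewrite big_ord0 /= diracE mem_set//= => -[]//.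
rewrite big_ord_recl -ih//= /lebesgue_rV_step /pushforward.
rewrite (_ : _ @^-1` _ = A ord0 `*`
    [set x : 'rV[R]_n | forall i, A (lift ord0 i) (x ord0 i)]); last first.
  apply/seteqP; split => [z /= Az|z /= [A0 Az] i].
    split; first by rewrite -rV_cons0.
    by move=> i; have := Az (lift ord0 i); rewrite mxE liftK.
  by rewrite mxE; case: (unliftP ord0 i) => [j|] ->.
have BE : [set x : 'rV[R]_n | forall i, A (lift ord0 i) (x ord0 i)] =
    \bigcap_(i in [set: 'I_n])
      ((fun x : 'rV[R]_n => x ord0 i : R) @^-1` A (lift ord0 i)).
  by apply/seteqP; split => x /= Ax i => [_|]; exact: Ax.
apply: product_measure1E; first exact: mA.
rewrite [X in measurable X]BE; apply: fin_bigcap_measurable => // i _.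
by rewrite -[X in measurable X]setTI; exact: measurable_coor.
Qed.

Definition orthant (R : realType) (n : nat) : set 'rV[R]_n :=
  [set x | forall i, 0 < x ord0 i].
Arguments orthant : clear implicits.

Definition simplex (R : realType) (n : nat) : set 'rV[R]_n :=
  [set p | (forall i, 0 < p ord0 i < 1) /\ \sum_i p ord0 i = 1].
Arguments simplex : clear implicits.

Definition csimplex (R : realType) (n : nat) : set 'rV[R]_n :=
  closure (simplex R n).
Arguments csimplex : clear implicits.

Definition pairing (R : realType) (n : nat) (p x : 'rV[R]_n) : R :=
  \sum_i p ord0 i * x ord0 i.

Definition concave_on (R : realType) (n : nat) (A : set 'rV[R]_n)
    (f : 'rV[R]_n -> R) : Prop :=
  forall (x y : 'rV[R]_n) (t : R), A x -> A y -> 0 <= t <= 1 ->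
    t * f x + (1 - t) * f y <= f (t *: x + (1 - t) *: y).

Lemma csimplex_ge0 (R : realType) (n : nat) (p : 'rV[R]_n) (i : 'I_n) :
  csimplex R n p -> 0 <= p ord0 i.
Proof.
have cl : closed [set q : 'rV[R]_n | 0 <= q ord0 i].
  apply: (@closed_comp _ _ (fun q : 'rV[R]_n => q ord0 i) [set x | 0 <= x]).
    by move=> ? _; exact: coord_continuous.
  exact: closed_ge.
have sub : simplex R n `<=` [set q : 'rV[R]_n | 0 <= q ord0 i].
  by move=> q [q01 _]; have /andP[/ltW] := q01 i.
by move=> cp; have := closureS sub cp; rewrite -(closure_id _).1.
Qed.

Lemma csimplex_convex (R : realType) (n : nat) (x y : 'rV[R]_n) (t : R) :
  csimplex R n x -> csimplex R n y -> 0 <= t <= 1 ->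
  csimplex R n (t *: x + (1 - t) *: y).
Proof.
move=> cx cy /andP[t0 t1] U nU.
have : (fun z : 'rV[R]_n * 'rV[R]_n => t *: z.1 + (1 - t) *: z.2) @ (x, y)
    --> t *: x + (1 - t) *: y.
  by apply: cvgD; apply: cvgZr; [exact: cvg_fst|exact: cvg_snd].
move=> /(_ U nU)[[A B]/= [nA nB] AB].
have [a [[a01 a1] Aa]] := cx A nA; have [b [[b01 b1] Bb]] := cy B nB.
have pos u v : 0 < u -> 0 < v -> 0 < t * u + (1 - t) * v.
  move=> u0 v0; have [->|tn0] := eqVneq t 0; first by rewrite mul0r add0r subr0 mul1r.
  have tp : 0 < t by rewrite lt_neqAle eq_sym tn0.
  apply: ltr_pwDl; first exact: mulr_gt0.
  by apply: mulr_ge0; [rewrite subr_ge0|exact: ltW].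
exists (t *: a + (1 - t) *: b); split; last exact: (AB (a, b)).
split=> [i|].
  rewrite !mxE; have /andP[a0 a1'] := a01 i; have /andP[b0 b1'] := b01 i.
  rewrite pos//= -subr_gt0.
  rewrite (_ : _ - _ = t * (1 - a ord0 i) + (1 - t) * (1 - b ord0 i)); last by ring.
  by rewrite pos// subr_gt0.
under eq_bigr do rewrite !mxE.
by rewrite big_split/= -!mulr_sumr a1 b1; ring.
Qed.

Definition compacts_of_simplex (R : realType) (n : nat) : set (set 'rV[R]_n) :=
  [set K | compact K /\ K `<=` simplex R n].
Arguments compacts_of_simplex : clear implicits.

(* A function on the closed simplex is represented by its extension by 0 to
   'rV[R]_n, so that equality in Cspace is equality on the closed simplex. *)
Definition Cset (R : realType) (n : nat) :
    set {family compacts_of_simplex R n, 'rV[R]_n -> R} :=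
  [set psi : 'rV[R]_n -> R |
    [/\ {within csimplex R n, continuous psi},
        concave_on (csimplex R n) psi,
        forall p, csimplex R n p -> 0 <= psi p
      & forall p, ~ csimplex R n p -> psi p = 0]].
Arguments Cset : clear implicits.

Definition Cspace (R : realType) (n : nat) : Type := set_type (Cset R n).

(* the topology induced by {family compacts_of_simplex R n, 'rV[R]_n -> R} *)
HB.instance Definition _ (R : realType) (n : nat) :=
  Topological.copy (Cspace R n) (set_type (Cset R n)).

Definition Cfun (R : realType) (n : nat) (psi : Cspace R n) : 'rV[R]_n -> R :=
  set_val psi.
Coercion Cfun : Cspace >-> Funclass.

Section Cspace_operations.
Context {R : realType} {n : nat}.
Implicit Types f g : Cspace R n.

Lemma CfunP f : Cset R n (Cfun f : {family compacts_of_simplex R n, _ -> _}).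
Proof. exact: set_valP. Qed.

Definition Cmk (f : 'rV[R]_n -> R)
    (Cf : Cset R n (f : {family compacts_of_simplex R n, _ -> _})) : Cspace R n :=
  SigSub (mem_set Cf).

Fact Czero_subproof :
  Cset R n ((fun=> 0) : {family compacts_of_simplex R n, 'rV[R]_n -> R}).
Proof.
split => //; first by apply: continuous_subspaceT; exact: cst_continuous.
by move=> x y t _ _ _; rewrite !mulr0 addr0.
Qed.

Definition Czero : Cspace R n := Cmk Czero_subproof.

HB.instance Definition _ := isPointed.Build (Cspace R n) Czero.

Fact Cmin_subproof f g :
  Cset R n ((fun p => Num.min (f p) (g p)) :
    {family compacts_of_simplex R n, 'rV[R]_n -> R}).
Proof.
have [cf vf f0 zf] := CfunP f; have [cg vg g0 zg] := CfunP g.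
split.
- by move=> x; apply: continuous_min; [exact: cf|exact: cg].
- move=> x y t Ax Ay t01; have /andP[t0 t1] := t01.
  rewrite le_min; apply/andP; split.
    apply: le_trans (vf _ _ _ Ax Ay t01); apply: lerD; apply: ler_wpM2l => //;
    by rewrite ?subr_ge0// ge_min lexx.
  apply: le_trans (vg _ _ _ Ax Ay t01); apply: lerD; apply: ler_wpM2l => //;
    by rewrite ?subr_ge0// ge_min lexx orbT.
- by move=> p cp; rewrite le_min f0// g0.
- by move=> p cp; rewrite zf// zg// minxx.
Qed.

Definition Cmin f g : Cspace R n := Cmk (Cmin_subproof f g).

Fact Cscale_subproof (a : R) (a0 : 0 <= a) f :
  Cset R n ((fun p => a * f p) : {family compacts_of_simplex R n, 'rV[R]_n -> R}).
Proof.
have [cf vf f0 zf] := CfunP f; split.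
- by move=> x; apply: cvgMr; exact: cf.
- move=> x y t Ax Ay t01.
  rewrite [leLHS](_ : _ = a * (t * f x + (1 - t) * f y)); last by ring.
  by apply: ler_wpM2l => //; exact: vf.
- by move=> p cp; rewrite mulr_ge0// f0.
- by move=> p cp; rewrite zf// mulr0.
Qed.

Definition Cscale (a : R) (a0 : 0 <= a) f : Cspace R n :=
  Cmk (Cscale_subproof a0 f).

Fact Clinear_subproof (c : 'rV[R]_n) (c0 : orthant R n c) :
  Cset R n ((pairing c \_ (csimplex R n)) :
    {family compacts_of_simplex R n, 'rV[R]_n -> R}).
Proof.
have linE p : csimplex R n p -> (pairing c \_ (csimplex R n)) p = pairing c p.
  by move=> cp; rewrite patchE mem_set.
split.
- apply: (@subspace_eq_continuous _ _ _ (pairing c)).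
    by move=> p /set_mem cp; apply/esym; exact: linE.
  apply: continuous_subspaceT.
  apply: continuous_big => [|i _ x]; first exact: add_continuous.
  by apply: continuousM; [exact: cst_continuous|exact: coord_continuous].
- move=> x y t Ax Ay t01; rewrite !linE//; last exact: csimplex_convex.
  rewrite /pairing !mulr_sumr -big_split/=; apply: ler_sum => i _.
  by rewrite !mxE le_eqVlt; apply/orP; left; apply/eqP; ring.
- move=> p cp; rewrite linE//; apply: sumr_ge0 => i _.
  by rewrite mulr_ge0 ?(csimplex_ge0 i cp)// ltW.
- by move=> p cp; rewrite /patch memNset.
Qed.

(* p |-> <c, p> on the closed simplex *)
Definition Clinear (c : 'rV[R]_n) (c0 : orthant R n c) : Cspace R n :=
  Cmk (Clinear_subproof c0).

End Cspace_operations.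

HB.instance Definition _ (R : realType) (n : nat) :=
  Measurable.copy (Cspace R n) (g_sigma_algebraType (@open (Cspace R n))).

(* [Crunmin l K] is the minimum of the K.+1 functions l 0, ..., l K. *)
Fixpoint Crunmin (R : realType) (n : nat) (l : nat -> Cspace R n) (K : nat) :
    Cspace R n :=
  if K is K'.+1 then Cmin (Crunmin l K') (l K) else l 0%N.

(* [Cscaled_min l K] is K.+1 ^ (1/n) min {l 0, ..., l K}; the index is shifted,
   since the minimum of no function is not defined. *)
Definition Cscaled_min (R : realType) (n : nat) (l : nat -> Cspace R n)
    (K : nat) : Cspace R n :=
  Cscale (powR_ge0 K.+1%:R n%:R^-1) (Crunmin l K).

Definition halfspace (R : realType) (n : nat) (p : 'rV[R]_n) (a : R) :
    set 'rV[R]_n :=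
  [set x | orthant R n x /\ pairing p x < a].

Definition Rhat (R : realType) (n : nat) (psi : Cspace R n) : set 'rV[R]_n :=
  \bigcup_(p in simplex R n) halfspace p (psi p).

Definition chart_domain (R : realType) (n : nat) : set 'rV[R]_n.-1 :=
  [set q | (forall i, 0 < q ord0 i < 1) /\ \sum_i q ord0 i < 1].
Arguments chart_domain : clear implicits.

(* (q_1, ..., q_(n-1)) |-> (q_1, ..., q_(n-1), 1 - \sum_i q_i) *)
Definition chart (R : realType) (n : nat) (q : 'rV[R]_n.-1) : 'rV[R]_n :=
  \row_(i < n) oapp (q ord0) (1 - \sum_j q ord0 j) (insub (i : nat)).

Definition partial (R : realType) (m : nat) (i : 'I_m) (f : 'rV[R]_m -> R) :
    'rV[R]_m -> R :=
  fun q => 'D_(delta_mx ord0 i) f q.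

Definition hessian (R : realType) (m : nat) (f : 'rV[R]_m -> R)
    (q : 'rV[R]_m) : 'M[R]_m :=
  \matrix_(i, j) partial i (partial j f) q.

(* meant for open U *)
Definition C2_on (R : realType) (m : nat) (U : set 'rV[R]_m)
    (f : 'rV[R]_m -> R) : Prop :=
  forall q, U q ->
    [/\ {for q, continuous f},
        forall i, derivable f q (delta_mx ord0 i),
        forall i, {for q, continuous (partial i f)},
        forall i j, derivable (partial j f) q (delta_mx ord0 i)
      & forall i j, {for q, continuous (partial i (partial j f))}].

Section probability.
Context d {T : measurableType d} {R : realType} (P : probability T R).

Definition mutually_independent d' (S : measurableType d') (X : nat -> T -> S) :
    Prop :=
  forall (s : seq nat) (B : nat -> set S), uniq s ->
    (forall k, measurable (B k)) ->
    P (\bigcap_(k in [set` s]) (X k @^-1` B k)) =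
    (\prod_(k <- s) P (X k @^-1` B k))%E.

Definition has_density_on_orthant n (C : T -> 'rV[R]_n) (rho : 'rV[R]_n -> R) :
    Prop :=
  [/\ measurable_fun (orthant R n) rho,
      forall x, orthant R n x -> 0 <= rho x
    & forall A, measurable A -> A `<=` orthant R n ->
        pushforward P C A = (\int[lebesgue_rV R n]_(x in A) (rho x)%:E)%E].

End probability.

Definition asymptotically_homogeneous (R : realType) (n : nat)
    (rho : 'rV[R]_n -> R) (alpha : R) (h : 'rV[R]_n -> R) : Prop :=
  let rho_ (kappa : R) (x : 'rV[R]_n) :=
    kappa `^ (- alpha) * rho (kappa *: x) in
  [/\ measurable_fun (orthant R n) h,
      forall x, orthant R n x -> 0 <= h x,
      (0 < \int[lebesgue_rV R n]_(x in orthant R n) (h x)%:E)%E,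
      forall x, orthant R n x -> rho_ kappa x @[kappa --> 0^'+] --> h x
    & {uniform simplex R n, rho_ @ 0^'+ --> h}].

Definition weak_cvg (R : realType) (n : nat)
    (nu : nat -> set (Cspace R n) -> \bar R)
    (mu : set (Cspace R n) -> \bar R) : Prop :=
  forall F : Cspace R n -> R, continuous F -> (exists M, forall w, `|F w| <= M) ->
    (\int[nu K]_w (F w)%:E)%E @[K --> \oo] --> (\int[mu]_w (F w)%:E)%E.

Definition survival (R : realType) (n : nat)
    (mu : set (Cspace R n) -> \bar R) (psi : Cspace R n) : \bar R :=
  mu [set w | forall p, csimplex R n p -> psi p <= w p].

(* Main.v *)
From HB Require Import structures.
Require Import Defs.
From mathcomp Require Import all_boot all_order all_algebra.
From mathcomp Require finmap.
From mathcomp Require Import all_classical all_reals all_analysis.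
From mathcomp Require Import perm measurable_realfun ring lra.

Set Implicit Arguments.
Unset Strict Implicit.
Unset Printing Implicit Defensive.

Import Order.TTheory GRing.Theory Num.Theory.
Import numFieldNormedType.Exports.

Local Open Scope classical_set_scope.
Local Open Scope ring_scope.

(** Write n = m + 1, let D and K be the open and the closed coordinate region
    of the simplex, in 'rV_m, and phi = psi \o chart.

    The volume formula.  In the coordinates x = (t - y_1, .., t - y_m, t), which
    preserve Lebesgue measure, the pairing of chart q with x is t - <q, y>.  So
    the fibre of Rhat psi over y is the interval from s(y), the maximum of
    <q, y> over K, to phi*(y), the maximum of phi q + <q, y> over K, and
      vol (Rhat psi) = \int (phi* - s) dy
    (lebesgue_Rhat).  Differentiate this identity with psi replaced by c psi,
    c near 1.  The left side is c ^ n vol (Rhat psi), with derivative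
    n vol (Rhat psi) at c = 1.  On the right side the derivative of
    (c phi)*(y) at c = 1 is phi q*(y), for q*(y) the point where phi*(y) is
    attained.  Where q*(y) is interior, y = - grad phi (q*(y)), so the
    substitution y = - grad phi q turns \int phi (q*(y)) dy into
    \int phi q det (- D^2 phi q) dq.  The boundary does not contribute, because
    phi vanishes there.

    Two approximations make this rigorous.  phi need not be strictly concave, so
    eps |q|^2 / 2 is subtracted from it: then the maximizer is unique and
    Lipschitz in y, and the differentiation is replaced by the two-sided bound
    legendre_argmax, whose error is eps m.  And D^2 phi need not be bounded near
    the boundary, so the integrand phi is replaced by max (phi - eta, 0), which
    vanishes near the boundary of D.  For eps, eta > 0 the substitution
    (argmax_change_of_variables) is proved as in the Cauchy-Goursat argument:
    the difference of the two sides, as a function of a cube, is additive and is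
    o(r ^ m) on cubes of side r shrinking to any given point (argmax_density),
    and such a function vanishes (cube_density0).  The limits are taken in
    volume_trunc_bounds and determinant_integral; boundedness of Rhat psi bounds
    grad phi and so confines all the integrals over y to one ball.

    The survival probability.  Since rho is asymptotic to the constant gamma at
    the origin, alpha = 0, and k P(C \in k ^ (-1/n) S) tends to gamma vol S for
    every bounded measurable S in the orthant (rescaled_probability_cvg).  For
    finitely many points p_j of the simplex and levels a_j, independence gives
      P (k ^ (1/n) min (l_1 p_j, .., l_k p_j) >= a_j for all j)
        = (1 - P(C \in k ^ (-1/n) S)) ^ k
    with S the union of the half spaces R(p_j, a_j), and this tends to
    exp (- gamma vol S).  A continuous function of finitely many evaluations
    lies between the indicators of two such events with levels a_j and a_j - e;
    weak convergence applies to it and bounds the measure mu of those events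
    on both sides (survival_lower, survival_upper).  For p_j running through a
    dense sequence, the events decrease to {w >= psi} and the sets S increase to
    Rhat psi, and survival_formula follows by continuity of measures. *)

(** * Norm and Borel sets of row vectors *)

Section rV_norm.
Context {R : realType} {m : nat}.
Implicit Types (v w : 'rV[R]_m) (e : R).

Lemma coord_le_norm v i : `|v ord0 i| <= `|v|.
Proof.
rewrite [leRHS]/Num.norm /= mx_normrE; apply/bigmax_geP; right => /=.
by exists (ord0, i).
Qed.

Lemma norm_le_coord v e : 0 <= e -> (forall i, `|v ord0 i| <= e) -> `|v| <= e.
Proof.
move=> e0 ve; rewrite [leLHS]/Num.norm /= mx_normrE; apply/bigmax_leP; split=> //.
by move=> -[i j] _ /=; rewrite ord1.
Qed.

Lemma norm_lt_coord v e : 0 < e -> (forall i, `|v ord0 i| < e) -> `|v| < e.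
Proof.
move=> e0 ve; rewrite [ltLHS]/Num.norm /= mx_normrE; apply/bigmax_ltP; split=> //.
by move=> -[i j] _ /=; rewrite ord1.
Qed.

End rV_norm.

Section rV_borel.
Context {R : realType} {m : nat}.

Lemma rat_rV_approx (v : 'rV[R]_m) (e : R) : 0 < e ->
  exists a : 'rV[rat]_m, forall i, `|v ord0 i - ratr (a ord0 i)| < e.
Proof.
move=> e0; have /choice[f fP] : forall i : 'I_m, exists q : rat,
    `|v ord0 i - ratr q| < e.
  move=> i; have /rat_in_itvoo[q] : v ord0 i - e < v ord0 i + e by lra.
  by rewrite in_itv/= => /andP[h1 h2]; exists q; rewrite ltr_norml; apply/andP; split; lra.
by exists (\row_i f i) => i; rewrite mxE.
Qed.

Lemma measurable_rV_box (A : 'I_m -> set R) : (forall i, measurable (A i)) ->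
  measurable [set x : 'rV[R]_m | forall i, A i (x ord0 i)].
Proof.
move=> mA; have -> : [set x : 'rV[R]_m | forall i, A i (x ord0 i)] =
    \bigcap_(i in [set: 'I_m]) ((fun x : 'rV[R]_m => x ord0 i : R) @^-1` A i).
  by apply/seteqP; split => x /= Ax i => [_|]; exact: Ax.
apply: fin_bigcap_measurable => // i _.
by rewrite -[X in measurable X]setTI; exact: measurable_coor.
Qed.

(** The sigma-algebra of 'rV_m is generated by boxes, and an open set is the
    union of the countably many rational boxes that it contains. *)
Lemma open_measurable_rV (O : set 'rV[R]_m) : open O -> measurable O.
Proof.
move=> oO.
pose B (z : 'rV[rat]_m * nat) := [set x : 'rV[R]_m | forall i,
  [set y : R | `|y - ratr (z.1 ord0 i)| < z.2.+1%:R^-1] (x ord0 i)].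
have mB z : measurable (B z).
  apply: (@measurable_rV_box
    (fun i => [set y : R | `|y - ratr (z.1 ord0 i)| < z.2.+1%:R^-1])) => i.
  apply: open_measurable.
  rewrite (_ : mkset _ = ball (ratr (z.1 ord0 i) : R) z.2.+1%:R^-1).
    exact: ball_open.
  by apply/seteqP; split=> y /=; rewrite /ball/= distrC.
pose C z := if pselect (B z `<=` O) then B z else set0.
have -> : O = \bigcup_k (if unpickle k is Some z then C z else set0).
  apply/seteqP; split=> [x Ox|x [k _]]; last first.
    by case: (unpickle k) => // z; rewrite /C; case: pselect => // sub; exact: sub.
  have [e /= e0 sub] := (nbhs_ballP _ _).1 (oO x Ox).
  have [k /andP[k0 ke]] : exists k : nat, (0 < k.+1%:R^-1 :> R) && (k.+1%:R^-1 + k.+1%:R^-1 < e).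
    have e2 : 0 < e / 2 by lra.
    have [k] := ltr_add_invr e2; rewrite add0r => ke; exists k.
    by rewrite invr_gt0 ltr0n/= [ltRHS]splitr ltrD.
  have [a xa] := rat_rV_approx x k0.
  exists (pickle (a, k)) => //; rewrite pickleK /C; case: pselect => /= [_|abs]; first exact: xa.
  exfalso; apply: abs => y ya; apply: sub; rewrite mx_norm_ball /=.
  apply: (@norm_lt_coord _ _ (x - y)) => // i; rewrite !mxE.
  have := xa i; have := ya i; rewrite /= => h1 h2.
  rewrite (le_lt_trans _ ke)// (le_trans (ler_distD (ratr (a ord0 i)) _ _))//.
  by rewrite [X in _ + X]distrC lerD// ltW.
apply: bigcupT_measurable => k; case: (unpickle k) => [z|]; last exact: measurable0.
by rewrite /C; case: pselect => /= _; [exact: mB|exact: measurable0].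
Qed.

Lemma closed_measurable_rV (O : set 'rV[R]_m) : closed O -> measurable O.
Proof. by move/closed_openC/open_measurable_rV/measurableC; rewrite setCK. Qed.

Lemma continuous_measurable_rV (f : 'rV[R]_m -> R) :
  continuous f -> measurable_fun [set: 'rV[R]_m] f.
Proof.
move=> /continuousP cf; apply: (measurability (@RGenOpens.G R)) => [|_ [_ [x [y ->]] <-]].
  exact: RGenOpens.measurableE.
rewrite setTI; apply: open_measurable_rV.
by apply: cf; exact: interval_open.
Qed.

Lemma measurable_norm_le (b : R) : measurable [set y : 'rV[R]_m | `|y| <= b].
Proof.
apply: closed_measurable_rV.
apply: (@preimage_closed _ _ (fun y : 'rV[R]_m => `|y|) [set x | x <= b]).
  by move=> ? _; exact: norm_continuous.
exact: closed_le.
Qed.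

End rV_borel.

(** * Linear maps and Lebesgue measure *)

Section lebesgue_line.
Context {R : realType}.
Notation lam := (@lebesgue_measure R).

Lemma measurable_affine (a b : R) :
  measurable_fun setT (fun x : measurableTypeR R => a * x + b : measurableTypeR R).
Proof. by apply: measurable_funD => //; exact: measurable_funM. Qed.

Lemma lebesgue_measure_affine_gt0 (a b : R) (A : set R) : 0 < a ->
  measurable A -> lam A = (a%:E * lam [set x | A (a * x + b)%R])%E.
Proof.
move=> a0 mA.
pose f := fun x : measurableTypeR R => a * x + b : measurableTypeR R.
pose fM := isMeasurableFun.Build _ _ _ _ f (measurable_affine a b).
pose F : {mfun _ >-> _} := HB.pack f fM.
have a0' := ltW a0.
pose k : {nonneg R} := NngNum a0'.
apply: (@lebesgue_measure_unique R (mscale k (pushforward lam F))) => // _ [[c d]] _ <- /=.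
rewrite /mscale/= /pushforward/=.
have -> : F @^-1` [set` `]c, d]] = [set` `](c - b) / a, (d - b) / a]].
  apply/seteqP; split=> x /=; rewrite !in_itv/= /f ltr_pdivrMr// ler_pdivlMr//;
  by move=> /andP[? ?]; apply/andP; split; rewrite mulrC; lra.
rewrite !lebesgue_measure_itv/= !lte_fin ltr_pM2r ?invr_gt0// ltrD2r.
case: ifPn => _; last by rewrite mule0.
rewrite -!EFinB -EFinM; congr EFin; field; exact: lt0r_neq0.
Qed.

Lemma lebesgue_measure_affine (a b : R) (A : set R) : a != 0 ->
  measurable A -> lam A = (`|a|%:E * lam [set x | A (a * x + b)%R])%E.
Proof.
move=> a0 mA; have [a_gt0|] := ltP 0 a.
  by rewrite gtr0_norm//; exact: lebesgue_measure_affine_gt0.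
rewrite le_eqVlt (negbTE a0)/= => a_lt0.
have mN : measurable [set x : R | A (- x)].
  by rewrite -[X in measurable X]setTI; exact: (@oppr_measurable R).
rewrite -lebesgue_measureN// /pushforward.
rewrite (@lebesgue_measure_affine_gt0 (- a) (- b) _ _ mN) ?oppr_gt0// ltr0_norm//.
by congr (_ * lam _)%E; apply/seteqP; split=> x /=; rewrite mulNr -opprD opprK.
Qed.

Lemma ge0_integral_affine (a b : R) (h : R -> \bar R) : a != 0 ->
  measurable_fun setT h -> (forall x, 0 <= h x)%E ->
  (\int[lam]_x h x = `|a|%:E * \int[lam]_x h (a * x + b)%R)%E.
Proof.
move=> a0 mh h0.
pose f := fun x : measurableTypeR R => a * x + b : measurableTypeR R.
pose fM := isMeasurableFun.Build _ _ _ _ f (measurable_affine a b).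
pose F : {mfun _ >-> _} := HB.pack f fM.
pose k : {nonneg R} := NngNum (normr_ge0 a).
rewrite (@eq_measure_integral _ _ _ setT (mscale k (pushforward lam F))); last first.
  by move=> A mA _; rewrite /mscale/= (lebesgue_measure_affine b a0 mA).
rewrite ge0_integral_mscale//.
by rewrite (@ge0_integral_pushforward _ _ _ _ _ F _ lam setT h)//.
Qed.

End lebesgue_line.

Section lebesgue_rV_sections.
Context {R : realType} {m : nat}.
Notation lam := (@lebesgue_measure R).
Implicit Types A : set 'rV[R]_m.+1.

Let preimage_cons A : measurable A ->
  measurable (@rV_cons R m @^-1` A : set (measurableTypeR R * 'rV[R]_m)).
Proof. by move=> mA; rewrite -[X in measurable X]setTI; exact: measurable_rV_cons. Qed.

Let xsec A x : xsection (@rV_cons R m @^-1` A) x = [set w | A (rV_cons (x, w))].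
Proof. by apply/seteqP; split=> w; rewrite /xsection/= in_setE. Qed.

Let ysec A w : ysection (@rV_cons R m @^-1` A) w = [set x | A (rV_cons (x, w))].
Proof. by apply/seteqP; split=> x; rewrite /ysection/= in_setE. Qed.

Lemma measurable_cons_section A (x : R) : measurable A ->
  measurable [set w : 'rV[R]_m | A (rV_cons (x, w))].
Proof. by move=> mA; rewrite -xsec; apply: measurable_xsection; exact: preimage_cons. Qed.

Lemma measurable_cons_section2 A w : measurable A ->
  measurable [set x : R | A (rV_cons (x, w))].
Proof. by move=> mA; rewrite -ysec; apply: measurable_ysection; exact: preimage_cons. Qed.

Lemma measurable_lebesgue_cons_section A : measurable A ->
  measurable_fun setT (fun x : R => lebesgue_rV R m [set w | A (rV_cons (x, w))]).
Proof.
move=> mA; have := @measurable_fun_xsection _ _ _ _ _ (lebesgue_rV R m) _ (preimage_cons mA).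
by apply: eq_measurable_fun => x _ /=; rewrite xsec.
Qed.

(** Slices orthogonal to the first axis; the next lemma slices along it. *)
Lemma lebesgue_rV_cons A : measurable A -> lebesgue_rV R m.+1 A =
  (\int[lam]_x lebesgue_rV R m [set w | A (rV_cons (x, w))])%E.
Proof. by move=> mA; apply: eq_integral => x _ /=; rewrite xsec. Qed.

Lemma lebesgue_rV_cons2 A : measurable A -> lebesgue_rV R m.+1 A =
  (\int[lebesgue_rV R m]_w lam [set x | A (rV_cons (x, w))])%E.
Proof.
move=> mA; transitivity (product_measure2 lam (lebesgue_rV R m) (@rV_cons R m @^-1` A)); last first.
  by apply: eq_integral => w _ /=; rewrite ysec.
rewrite /= /lebesgue_rV_step /pushforward.
apply: product_measure_unique; last exact: preimage_cons.
by move=> B C mB mC; rewrite /= product_measure2E.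
Qed.

End lebesgue_rV_sections.

Section rV_maps.
Context {R : realType}.

Lemma measurable_mulmx p m (M : 'M[R]_(p, m)) (b : 'rV[R]_m) :
  measurable_fun setT (fun v : 'rV[R]_p => v *m M + b).
Proof.
apply: measurable_fun_rVP => i.
have -> : (fun t : 'rV[R]_p => (t *m M + b) ord0 i) =
          (fun t => (\sum_j t ord0 j * M j i) + b ord0 i).
  by apply/funext => t; rewrite !mxE.
apply: measurable_funD => //; apply: measurable_sum => j.
by apply: measurable_funM => //; exact: measurable_coor.
Qed.

Lemma measurable_affine_preimage p m (M : 'M[R]_(p, m)) (b : 'rV[R]_m) (A : set 'rV[R]_m) :
  measurable A -> measurable [set v : 'rV[R]_p | A (v *m M + b)].
Proof. by move=> mA; rewrite -[X in measurable X]setTI; exact: measurable_mulmx. Qed.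

Lemma measurable_mulmx_preimage p m (M : 'M[R]_(p, m)) (A : set 'rV[R]_m) :
  measurable A -> measurable [set v : 'rV[R]_p | A (v *m M)].
Proof.
move=> mA; have := measurable_affine_preimage M 0 mA.
by under eq_set do rewrite addr0.
Qed.

Lemma measurable_translate m (b : 'rV[R]_m) (A : set 'rV[R]_m) :
  measurable A -> measurable [set v | A (v + b)].
Proof.
move=> mA; have := measurable_affine_preimage 1%:M b mA.
by under eq_set do rewrite mulmx1.
Qed.

Lemma rV_cons_behead m (v : 'rV[R]_m.+1) : rV_cons (v ord0 ord0, rV_behead v) = v.
Proof. by apply/rowP => i; rewrite !mxE; case: unliftP => [j|] ->; rewrite /= ?mxE. Qed.

Lemma rV_consD m x y (v w : 'rV[R]_m) :
  rV_cons (x, v) + rV_cons (y, w) = rV_cons (x + y, v + w).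
Proof. by apply/rowP => i; rewrite !mxE; case: unliftP => [j|] _ /=; rewrite ?mxE. Qed.

Lemma rV_cons_row_mx m x (w : 'rV[R]_m) : rV_cons (x, w) = row_mx x%:M w :> 'rV_(1 + m).
Proof.
apply/rowP => i; rewrite !mxE; case: splitP => j ij.
  rewrite !ord1 mxE eqxx mulr1n; case: unliftP => [k|//] ik.
  by move: ij; rewrite ik /= ord1.
case: unliftP => [k ik|i0] /=; last by move: ij; rewrite i0.
by congr (w _ _); apply/val_inj; move: ij; rewrite ik /= /bump /= => -[].
Qed.

End rV_maps.

Section lebesgue_rV_linear.
Context {R : realType}.
Notation lam := (@lebesgue_measure R).

Lemma lebesgue_rV_translate m (b : 'rV[R]_m) (A : set 'rV[R]_m) : measurable A ->
  lebesgue_rV R m [set v | A (v + b)] = lebesgue_rV R m A.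
Proof.
elim: m b A => [|m ih] b A mA.
  by congr (lebesgue_rV R 0 _); apply/seteqP; split=> v /=; rewrite !(thinmx0 (_ + _)) !(thinmx0 v).
rewrite lebesgue_rV_cons; last exact: measurable_translate.
rewrite lebesgue_rV_cons//.
rewrite [RHS](@ge0_integral_affine _ 1 (b ord0 ord0)) ?oner_eq0//; last first.
  exact: measurable_lebesgue_cons_section.
rewrite normr1 mul1e; apply: eq_integral => x _.
rewrite -[RHS](ih (rV_behead b)); last exact: measurable_cons_section.
have E w : rV_cons (x, w) + b = rV_cons (1 * x + b ord0 ord0, w + rV_behead b).
  by rewrite mul1r -rV_consD rV_cons_behead.
by congr (lebesgue_rV R m _); apply/seteqP; split=> w /=; rewrite E.
Qed.

(** Row vectors are acted on from the right, so [set v | A (v *m M)] is the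
    preimage of A. *)
Definition scales_lebesgue m (M : 'M[R]_m) := forall A : set 'rV[R]_m,
  measurable A ->
  lebesgue_rV R m A = (`|\det M|%:E * lebesgue_rV R m [set v | A (v *m M)%R])%E.

Lemma scales_lebesgueM m (M N : 'M[R]_m) :
  scales_lebesgue M -> scales_lebesgue N -> scales_lebesgue (M *m N).
Proof.
move=> sM sN A mA; rewrite (sN A mA) (sM _ (measurable_mulmx_preimage N mA)).
rewrite muleA -EFinM -normrM det_mulmx [in LHS]mulrC.
by congr (_ * lebesgue_rV R m _)%E; apply/seteqP; split=> v /=; rewrite mulmxA.
Qed.

Lemma scales_lebesgue_diag m (a : R) (S : 'M[R]_m) : a != 0 ->
  scales_lebesgue S -> scales_lebesgue (block_mx a%:M 0 0 S : 'M[R]_(1 + m)).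
Proof.
move=> a0 sS A mA.
have mB := @measurable_mulmx_preimage _ _ _ (block_mx a%:M 0 0 S : 'M[R]_(1 + m)) _ mA.
rewrite det_ublock det_scalar1 normrM.
rewrite [LHS]lebesgue_rV_cons// (ge0_integral_affine 0 a0)//; last first.
  exact: (measurable_lebesgue_cons_section mA).
rewrite (lebesgue_rV_cons mB).
rewrite EFinM -muleA; congr (_ * _)%E.
rewrite -ge0_integralZl_EFin//; last first.
  exact: (measurable_lebesgue_cons_section mB).
apply: eq_integral => x _.
rewrite (sS _ (measurable_cons_section _ mA)).
congr (_ * lebesgue_rV R m _)%E; apply/seteqP; split=> w /=;
  by rewrite !rV_cons_row_mx mul_row_block !mulmx0 addr0 add0r -scalar_mxM mulrC addr0.
Qed.

Lemma scales_lebesgue_ushear m (b : 'rV[R]_m) :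
  scales_lebesgue (block_mx 1%:M b 0 1%:M : 'M[R]_(1 + m)).
Proof.
move=> A mA; rewrite det_ublock !det1 mul1r normr1 mul1e.
rewrite !lebesgue_rV_cons//; last exact: measurable_mulmx_preimage.
apply: eq_integral => x _.
rewrite -(lebesgue_rV_translate (x *: b)); last exact: measurable_cons_section.
congr (lebesgue_rV R m _); apply/seteqP; split=> w /=;
  by rewrite !rV_cons_row_mx mul_row_block !mulmx0 !mulmx1 addr0 mul_scalar_mx addrC.
Qed.

Lemma scales_lebesgue_lshear m (c : 'cV[R]_m) :
  scales_lebesgue (block_mx 1%:M 0 c 1%:M : 'M[R]_(1 + m)).
Proof.
move=> A mA; rewrite det_lblock !det1 mul1r normr1 mul1e.
rewrite !lebesgue_rV_cons2//; last exact: measurable_mulmx_preimage.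
apply: eq_integral => w _.
rewrite (@lebesgue_measure_affine _ 1 ((w *m c) ord0 ord0)) ?oner_eq0//; last first.
  exact: measurable_cons_section2.
rewrite normr1 mul1e.
congr (lam _); apply/seteqP; split=> x /=;
  by rewrite !rV_cons_row_mx mul_row_block !mulmx0 !mulmx1 add0r mul1r raddfD /= -mx11_scalar.
Qed.

(** A matrix without isotropic vector has a nonzero corner entry, and its Schur
    complement has again no isotropic vector.  So Gaussian elimination needs no
    pivoting, and M is a product of shears and a diagonal block matrix, for
    which the claim follows by slicing. *)
Lemma scales_lebesgue_definite m (M : 'M[R]_m) :
  (forall v : 'rV[R]_m, v != 0 -> (v *m M *m v^T) ord0 ord0 != 0) ->
  scales_lebesgue M.
Proof.
elim: m M => [|m ih] M defM.
  move=> A mA; rewrite det_mx00 normr1 mul1e; congr (lebesgue_rV R 0 _).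
  by apply/seteqP; split=> v /=; rewrite !(thinmx0 (_ *m _)) !(thinmx0 v).
rewrite -[M](@submxK _ 1 m 1 m).
set a := ulsubmx _; set b := ursubmx _; set c := dlsubmx _; set N := drsubmx _.
have {}defM (v : 'rV[R]_(1 + m)) : v != 0 ->
    (v *m block_mx a b c N *m v^T) ord0 ord0 != 0.
  by rewrite submxK; exact: defM.
pose a0 : R := a ord0 ord0.
have aE : a = a0%:M by rewrite [LHS]mx11_scalar.
have a0_neq0 : a0 != 0.
  have := defM (row_mx 1%:M 0 : 'rV_(1 + m)).
  rewrite mul_row_block !mul0mx !mul1mx !addr0 tr_row_mx mul_row_col trmx0 mulmx0 addr0.
  rewrite trmx1 mulmx1; apply.
  apply/eqP => /rowP /(_ (lshift m ord0)); rewrite row_mxEl !mxE eqxx => /eqP.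
  by rewrite oner_eq0.
pose S := N - a0^-1 *: (c *m b).
have -> : block_mx a b c N = (block_mx 1%:M 0 (a0^-1 *: c) 1%:M *m block_mx a0%:M 0 0 S)
    *m block_mx 1%:M (a0^-1 *: b) 0 1%:M.
  rewrite !mulmx_block !(mulmx0, mul0mx, mul1mx, mulmx1, addr0, add0r).
  rewrite mul_scalar_mx -[(a0^-1 *: c) *m _]scalemxAl mul_mx_scalar !scalerA.
  rewrite mulVf ?mulfV// !scale1r aE; congr block_mx.
  by rewrite -scalemxAr /S addrCA subrr addr0.
apply: scales_lebesgueM; last exact: scales_lebesgue_ushear.
apply: scales_lebesgueM; first exact: scales_lebesgue_lshear.
apply: scales_lebesgue_diag => //.
apply: ih => w w0.
pose z : 'M[R]_1 := - (a0^-1 *: (w *m c)).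
(* the isotropic vector of the Schur complement is completed by the z that
   annihilates the first coordinate of (z, w) *m M *)
have := defM (row_mx z w : 'rV_(1 + m)).
rewrite mul_row_block tr_row_mx mul_row_col.
have -> : z *m a + w *m c = 0.
  by rewrite aE mul_mx_scalar /z scalerN scalerA mulfV// scale1r addNr.
rewrite mul0mx add0r.
have -> : z *m b + w *m N = w *m S.
  by rewrite /S mulmxBr -scalemxAr mulmxA /z mulNmx -scalemxAl addrC.
apply; apply/eqP => /rowP zw0; move/eqP: w0; apply; apply/rowP => i.
by have := zw0 (rshift 1 i); rewrite row_mxEr !mxE.
Qed.

End lebesgue_rV_linear.

(** * Slicing along the diagonal direction *)

Section lebesgue_rV_unique.
Context {R : realType} {m : nat}.
Notation lam := (@lebesgue_measure R).

Let box (A : 'I_m -> set R) := [set x : 'rV[R]_m | forall i, A i (x ord0 i)].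

(** Boxes form a generating pi-system. *)
Lemma lebesgue_rV_unique (mu : {measure set 'rV[R]_m -> \bar R}) :
  (forall A : 'I_m -> set R, (forall i, measurable (A i)) ->
    mu [set x | forall i, A i (x ord0 i)] = (\prod_(i < m) lam (A i))%E) ->
  forall X, measurable X -> lebesgue_rV R m X = mu X.
Proof.
move=> muE X mX.
pose G : set (set 'rV[R]_m) := [set B | exists2 A, (forall i, measurable (A i)) & B = box A].
apply: (measure_unique G (fun k => box (fun=> `[- k%:R, k%:R]%classic))) => //.
- apply/seteqP; split.
    apply: smallest_sub; first exact: smallest_sigma_algebra.
    rewrite -bigcup_seq/=; apply: bigcup_sub => i _ _ [A mA <-].
    apply: sub_sigma_algebra.
    exists (fun j => if j == i then A else setT).
      by move=> j; case: ifP => _ //; exact: measurableT.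
    apply/seteqP; split=> x /=; first by move=> [_ xA] j; case: eqP => [->|].
    by move=> /(_ i); rewrite eqxx.
  apply: smallest_sub; first exact: sigma_algebra_measurable.
  by move=> _ [A mA ->]; exact: measurable_rV_box.
- move=> _ _ [A mA ->] [B mB ->]; exists (fun i => A i `&` B i).
    by move=> i; exact: measurableI.
  by apply/seteqP; split=> x /= => [[xA xB] i|xAB]; [split|split=> i; case: (xAB i)].
- by move=> k; exists (fun=> `[- k%:R, k%:R]%classic).
- apply/seteqP; split=> // x _; exists (Num.truncn `|x|).+1 => //= i.
  rewrite /= in_itv/= -ler_norml (le_trans (coord_le_norm x i))// ltW//.
  exact: truncnS_gt.
- by move=> _ [A mA ->]; rewrite muE// -lebesgue_rV_box.
- move=> k; rewrite [X in (X < _)%E](@lebesgue_rV_box R m (fun=> `[- k%:R, k%:R]%classic))//.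
  rewrite big_const_ord; elim: (X in iter X) => [|j ih] /=; first exact: ltry.
  rewrite lte_mul_pinfty// lebesgue_measure_itv/=; case: ifP => //.
Qed.

End lebesgue_rV_unique.

Section rV_rcons.
Context {R : realType} {m : nat}.
Notation lam := (@lebesgue_measure R).

Definition rV_rcons (y : 'rV[R]_m) (t : R) : 'rV[R]_m.+1 :=
  \row_(i < m.+1) oapp (y ord0) t (insub (i : nat)).

Lemma rV_rcons_widen y t (i : 'I_m) :
  rV_rcons y t ord0 (widen_ord (leqnSn m) i) = y ord0 i.
Proof. by rewrite mxE (_ : insub _ = Some i) //; exact: (valK i). Qed.

Lemma rV_rcons_max y t : rV_rcons y t ord0 ord_max = t.
Proof. by rewrite mxE insubF //= ltnn. Qed.

Lemma forall_rV_rcons (P : 'I_m.+1 -> R -> Prop) y t :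
  (forall i, P i (rV_rcons y t ord0 i)) <->
  (forall i : 'I_m, P (widen_ord (leqnSn m) i) (y ord0 i)) /\ P ord_max t.
Proof.
split=> [Pi|[Py Pt] i].
  by split=> [i|]; [rewrite -(rV_rcons_widen y t)|rewrite -(rV_rcons_max y t)]; exact: Pi.
have [im|] := ltnP i m.
  have -> : i = widen_ord (leqnSn m) (Ordinal im) by exact/val_inj.
  by rewrite rV_rcons_widen.
move=> mi; have -> : i = ord_max by apply/val_inj/eqP; rewrite eqn_leq mi -ltnS ltn_ord.
by rewrite rV_rcons_max.
Qed.

(** Pairing diag_slice (y, t) with a point of the simplex over q gives
    t - <q, y>: fibres in t turn half spaces into half lines. *)
Definition diag_slice (z : 'rV[R]_m * measurableTypeR R) : 'rV[R]_m.+1 :=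
  rV_rcons (const_mx z.2 - z.1) z.2.

Lemma measurable_diag_slice : measurable_fun setT diag_slice.
Proof.
apply: measurable_fun_rVP => i; rewrite /diag_slice.
have [im|mi] := ltnP i m.
  have -> : i = widen_ord (leqnSn m) (Ordinal im) by exact/val_inj.
  under eq_fun do rewrite rV_rcons_widen !mxE.
  apply: measurable_funB; first exact: measurable_snd.
  by apply: (measurableT_comp (@measurable_coor R m _)); exact: measurable_fst.
have -> : i = ord_max by apply/val_inj/eqP; rewrite eqn_leq mi -ltnS ltn_ord.
under eq_fun do rewrite rV_rcons_max.
exact: measurable_snd.
Qed.

(** diag_slice is a reflection y |-> t - y for fixed t; both measures have the
    same value on boxes. *)
Lemma lebesgue_rV_diag_slice (A : set 'rV[R]_m.+1) : measurable A ->
  lebesgue_rV R m.+1 A = (\int[lebesgue_rV R m]_y lam [set t | A (diag_slice (y, t))])%E.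
Proof.
move=> mA.
pose fM := isMeasurableFun.Build _ _ _ _ diag_slice measurable_diag_slice.
pose F : {mfun _ >-> _} := HB.pack diag_slice fM.
pose mu := pushforward (product_measure1 (lebesgue_rV R m) lam) F.
transitivity (mu A); last first.
  apply: eq_integral => y _ /=; congr (lam _).
  by apply/seteqP; split=> t; rewrite /xsection/= in_setE.
apply: (@lebesgue_rV_unique _ _ mu) => // B mB.
have mpre : measurable (F @^-1` [set x | forall i, B i (x ord0 i)]).
  rewrite -[X in measurable X]setTI; apply: measurable_diag_slice => //.
  exact: measurable_rV_box.
transitivity (product_measure2 (lebesgue_rV R m) lam
    (F @^-1` [set x | forall i, B i (x ord0 i)])).
  apply: product_measure_unique => //.
  by move=> C D mC mD; rewrite /= product_measure2E.
rewrite /product_measure2 big_ord_recr/=.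
pose c := (\prod_(i < m) lam (B (widen_ord (leqnSn m) i)))%E.
transitivity (\int[lam]_t (c * (\1_(B ord_max) t)%:E))%E.
  apply: eq_integral => t _ /=.
  have -> : ysection (F @^-1` [set x | forall i, B i (x ord0 i)]) t =
     [set y | (forall i : 'I_m, [set s | B (widen_ord (leqnSn m) i) (-1 * s + t)] (y ord0 i))
         /\ B ord_max t].
    apply/seteqP; split=> y; rewrite /ysection/= in_setE/= /diag_slice/=.
      move=> /forall_rV_rcons[Bi Bt]; split=> // i; have := Bi i.
      by rewrite !mxE mulN1r addrC.
    move=> [Bi Bt]; apply/forall_rV_rcons; split=> // i; have := Bi i.
    by rewrite !mxE mulN1r addrC.
  rewrite indicE; have [Bt|Bt] := boolP (t \in B ord_max); last first.
    rewrite mule0 (_ : mkset _ = set0) ?measure0//.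
    by apply/seteqP; split=> // y [_]; rewrite -in_setE (negbTE Bt).
  rewrite mule1.
  pose D (i : 'I_m) := [set s : R | B (widen_ord (leqnSn m) i) (-1 * s + t)].
  rewrite (_ : mkset _ = [set y | forall i, D i (y ord0 i)]); last first.
    by apply/seteqP; split=> y /= => [[]//|Dy]; split=> //; exact: set_mem Bt.
  rewrite lebesgue_rV_box.
    apply: eq_bigr => i _.
    by rewrite [RHS](@lebesgue_measure_affine _ (-1) t)// ?oppr_eq0 ?oner_eq0// normrN1 mul1e.
  move=> i; rewrite -[X in measurable X]setTI.
  exact: (@measurable_affine R (-1) t measurableT _ (mB _)).
rewrite ge0_integralZl//=.
- rewrite integral_indic//; last exact: mB.
  congr (_ * lam _)%E; exact: setIT.
- by apply/measurable_EFinP; apply: measurable_indic; exact: mB.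
- by rewrite /c; elim/big_ind : _ => // x y; exact: mule_ge0.
Qed.

End rV_rcons.

(** * Functions with continuous partial derivatives *)

Section partial_derivatives.
Context {R : realType} {m : nat}.
Implicit Types (f : 'rV[R]_m -> R) (p q e h : 'rV[R]_m).

Lemma is_derive_line f p e (t : R) : derivable f (p + t *: e) e ->
  is_derive t (1 : R) (fun s : R => f (p + s *: e)) ('D_e f (p + t *: e)).
Proof.
have E : (fun h : R => h^-1 *: (f (p + (h *: 1 + t) *: e) - f (p + t *: e))) =
         (fun h : R => h^-1 *: (f (h *: e + (p + t *: e)) - f (p + t *: e))).
  by apply/funext => h; rewrite [h *: 1]mulr1 scalerDl addrCA.
move=> df; apply: DeriveDef; first by rewrite /derivable /= E.
by rewrite /derive /= E.
Qed.

Lemma MVT_line f p e (h : R) :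
  (forall t, `|t| <= `|h| -> derivable f (p + t *: e) e) ->
  exists2 t, `|t| <= `|h| & f (p + h *: e) - f p = h * 'D_e f (p + t *: e).
Proof.
move=> df; pose g s := f (p + s *: e).
have dg t : `|t| <= `|h| -> is_derive t (1 : R) g ('D_e f (p + t *: e)).
  by move=> th; apply: is_derive_line; exact: df.
have cg t : `|t| <= `|h| -> {for t, continuous g}.
  move=> th; apply: differentiable_continuous; apply/derivable1_diffP.
  by have [] := dg _ th.
have g0 : g 0 = f p by rewrite /g scale0r addr0.
have [h0|h0] := leP 0 h.
  have sub t : t \in `[0, h] -> `|t| <= `|h|.
    by rewrite in_itv/= => /andP[t0 th]; rewrite !ger0_norm.
  have [||t tI] := @MVT_segment _ g (fun t => 'D_e f (p + t *: e)) 0 h h0.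
  - by move=> x xI; apply: dg; apply: sub; exact: subset_itv_oo_cc xI.
  - by apply: continuous_in_subspaceT => x /set_mem xI; apply: cg; exact: sub.
  - by rewrite g0 subr0 mulrC => E; exists t => //; exact: sub.
have sub t : t \in `[h, 0] -> `|t| <= `|h|.
  rewrite in_itv/= => /andP[ht t0]; rewrite !ler0_norm//; last exact: ltW.
  by rewrite lerN2.
have [||t tI] := @MVT_segment _ g (fun t => 'D_e f (p + t *: e)) h 0 (ltW h0).
- by move=> x xI; apply: dg; apply: sub; exact: subset_itv_oo_cc xI.
- by apply: continuous_in_subspaceT => x /set_mem xI; apply: cg; exact: sub.
- rewrite g0 => E; exists t; first exact: sub.
  by rewrite -[LHS]opprB E /=; ring.
Qed.

Lemma continuous_at_dist f q (c : R) : {for q, continuous f} -> 0 < c ->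
  exists2 d, 0 < d & forall x, `|x - q| < d -> `|f x - f q| < c.
Proof.
move=> cf c0; have /cvgrPdist_lt /(_ c c0) := cf.
move=> /nbhs_ballP[d /= d0 dP]; exists d => // x xq.
by rewrite distrC; apply: dP; rewrite mx_norm_ball /= distrC.
Qed.

Lemma dist_continuous_at f q :
  (forall c, 0 < c -> exists2 d, 0 < d & forall x, `|x - q| < d -> `|f x - f q| < c) ->
  {for q, continuous f}.
Proof.
move=> h; apply/(@cvgrPdist_lt R R _ (nbhs q) _ f (f q)) => c c0.
have [d d0 dP] := h c c0.
apply/nbhs_ballP; exists d => //= x.
by rewrite mx_norm_ball /= distrC => xq; rewrite distrC; exact: dP.
Qed.

(** A common radius for finitely many local conditions. *)
Lemma fin_radius (P : 'I_m -> R -> Prop) :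
  (forall i d d', 0 < d' <= d -> P i d -> P i d') ->
  (forall i, exists2 d, 0 < d & P i d) -> exists2 d, 0 < d & forall i, P i d.
Proof.
move=> mono ex.
have /choice[D DP] : forall i, exists d, 0 < d /\ P i d.
  by move=> i; have [d d0 Pd] := ex i; exists d.
exists (\big[Num.min/1]_i D i).
  by apply: lt_bigmin => // i _; have [] := DP i.
move=> i; have [_ Pi] := DP i; apply: mono Pi.
rewrite bigmin_le_cond// andbT; apply: lt_bigmin => // j _.
by have [] := DP j.
Qed.

(** Telescoping over the coordinates reduces the increment to m increments
    along the axes, each of which is evaluated by the mean value theorem. *)
Lemma partials_differentiable f q (r : R) : 0 < r ->
  (forall x, `|x - q| < r -> forall i, derivable f x (delta_mx ord0 i)) ->
  (forall i, {for q, continuous (partial i f)}) ->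
  forall c, 0 < c -> exists2 d, 0 < d & forall h, `|h| < d ->
    `|f (q + h) - f q - \sum_i h ord0 i * partial i f q| <= c * `|h|.
Proof.
move=> r0 df cdf c c0.
have cm : 0 < c / m.+1%:R by rewrite divr_gt0.
have [d d0 dP] : exists2 d, 0 < d & forall i x, `|x - q| < d ->
    `|partial i f x - partial i f q| < c / m.+1%:R.
  apply: (@fin_radius (fun i d => forall x, `|x - q| < d ->
    `|partial i f x - partial i f q| < c / m.+1%:R)).
    move=> i d d' /andP[_ dd] dP x xq; apply: dP; exact: lt_le_trans dd.
  by move=> i; apply: continuous_at_dist.
exists (Num.min r d); first by rewrite lt_min r0.
move=> h; rewrite lt_min => /andP[hr hd].
pose hk k : 'rV[R]_m := \row_i (if (i < k)%N then h ord0 i else 0).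
have hkm : hk m = h by apply/rowP => i; rewrite mxE ltn_ord.
suff : forall k, (k <= m)%N -> `|f (q + hk k) - f q -
    \sum_(i < m | (i < k)%N) h ord0 i * partial i f q| <= k%:R * (c / m.+1%:R) * `|h|.
  move=> /(_ m (leqnn m)); rewrite hkm.
  rewrite (eq_bigl xpredT) => [|i]; last by rewrite ltn_ord.
  move=> /le_trans; apply; rewrite ler_wpM2r// mulrCA -[leRHS]mulr1 (ler_wpM2l (ltW c0))//.
  by rewrite ler_pdivrMr ?ltr0n// mul1r ler_nat.
elim=> [_|k ih km].
  have -> : hk 0%N = 0 by apply/rowP => i; rewrite !mxE.
  by rewrite addr0 subrr big_pred0 // subr0 normr0 !mul0r.
pose i0 := Ordinal km; pose e : 'rV[R]_m := delta_mx ord0 i0.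
have hkS : hk k.+1 = hk k + h ord0 i0 *: e.
  apply/rowP => i; rewrite !mxE eqxx/= ltnS leq_eqVlt -val_eqE /=.
  have [ik|ik] := eqVneq (i : nat) k.
    by rewrite ik ltnn add0r mulr1 /=; congr (h _ _); exact/val_inj.
  by rewrite /= mulr0 addr0.
have near_q t : `|t| <= `|h ord0 i0| -> `|q + hk k + t *: e - q| <= `|h|.
  have -> : q + hk k + t *: e - q = hk k + t *: e.
    by apply/rowP => i; rewrite !mxE; ring.
  move=> th; apply: norm_le_coord => // i; rewrite !mxE eqxx/=.
  have [->|ii0] := eqVneq i i0.
    by rewrite /= ltnn add0r mulr1 (le_trans th)// coord_le_norm.
  by rewrite mulr0 addr0; case: ifP => _; rewrite ?normr0// coord_le_norm.
have [t th E] := @MVT_line f (q + hk k) e (h ord0 i0)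
  (fun t th => df _ (le_lt_trans (near_q t th) hr) i0).
rewrite (bigD1 i0) ?ltnSn//= (eq_bigl (fun i : 'I_m => (i < k)%N)); last first.
  by move=> i; rewrite -val_eqE/= ltnS andbC ltn_neqAle.
have XP : `|'D_e f (q + hk k + t *: e) - partial i0 f q| <= c / m.+1%:R.
  by apply/ltW/dP; rewrite (le_lt_trans (near_q t th)).
have {}E : f (q + hk k + h ord0 i0 *: e) =
    f (q + hk k) + h ord0 i0 * 'D_e f (q + hk k + t *: e).
  by rewrite -E [RHS]addrC subrK.
rewrite hkS addrA E.
move: ('D_e f _) (\sum_(_ < _ | _) _) XP (ih (ltnW km)) => X S XP ihS.
have -> : f (q + hk k) + h ord0 i0 * X - f q - (h ord0 i0 * partial i0 f q + S) =
    (f (q + hk k) - f q - S) + h ord0 i0 * (X - partial i0 f q).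
  by move: (f _) (f _) (partial _ _ _) => *; ring.
rewrite (le_trans (ler_normD _ _))// -natr1 2!mulrDl lerD//.
by rewrite mul1r normrM mulrC ler_pM// coord_le_norm.
Qed.

End partial_derivatives.

(** * Additive set functions of density zero *)

Section cube_bisection.
Context {R : realType} {m : nat}.
Implicit Types (a s : 'rV[R]_m) (r : R).

Definition hbox a s : set 'rV[R]_m :=
  [set x | forall i, a ord0 i <= x ord0 i < a ord0 i + s ord0 i].

Definition cube a r := hbox a (const_mx r).

Lemma measurable_hbox a s : measurable (hbox a s).
Proof.
apply: (@measurable_rV_box _ _ (fun i => [set` `[a ord0 i, a ord0 i + s ord0 i[])) => i.
exact: measurable_itv.
Qed.

Variable L : set 'rV[R]_m -> R.
Hypothesis LU : forall A B, measurable A -> measurable B -> A `&` B = set0 ->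
  L (A `|` B) = L A + L B.

(* side lengths of the box obtained from a cube of side r by halving it in the
   first k directions *)
Let half r k : 'rV[R]_m := \row_i (if (i < k)%N then r / 2 else r).

(** The cube is halved in one direction after the other, each time keeping the
    half on which |L| is larger. *)
Lemma halve_cube a r (c : R) : 0 < r -> c * r ^+ m < `|L (cube a r)| ->
  exists b : 'rV[R]_m, (forall i, a ord0 i <= b ord0 i /\ b ord0 i + r / 2 <= a ord0 i + r) /\
    c * (r / 2) ^+ m < `|L (cube b (r / 2))|.
Proof.
move=> r0 Lc.
suff : forall k, (k <= m)%N -> exists b : 'rV[R]_m, (forall i, a ord0 i <= b ord0 i /\
    b ord0 i + half r k ord0 i <= a ord0 i + r) /\
    c * r ^+ m < `|L (hbox b (half r k))| * 2 ^+ k.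
  move=> /(_ m (leqnn m))[b [ab]].
  have -> : half r m = const_mx (r / 2) by apply/rowP => i; rewrite !mxE ltn_ord.
  move=> Lb; exists b; split; first by move=> i; have := ab i; rewrite mxE ltn_ord.
  by rewrite expr_div_n mulrA ltr_pdivrMr ?exprn_gt0.
elim=> [_|k ih km].
  exists a; rewrite expr0 mulr1.
  have -> : half r 0 = const_mx r by apply/rowP => i; rewrite !mxE.
  by split=> // i; rewrite mxE.
have [b [ab Lb]] := ih (ltnW km).
pose i0 := Ordinal km.
pose b' := b + (r / 2) *: delta_mx ord0 i0.
have bi0 : b' ord0 i0 = b ord0 i0 + r / 2 by rewrite !mxE !eqxx mulr1.
have bi i : i != i0 -> b' ord0 i = b ord0 i.
  by move=> /negbTE ii0; rewrite !mxE ii0 andbF mulr0 addr0.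
have hi0 : half r k ord0 i0 = r by rewrite mxE ltnn.
have hSi0 : half r k.+1 ord0 i0 = r / 2 by rewrite mxE ltnSn.
have hi i : i != i0 -> half r k.+1 ord0 i = half r k ord0 i.
  by move=> ii0; rewrite !mxE ltnS leq_eqVlt; move: ii0; rewrite -val_eqE/= => /negbTE ->.
have E : hbox b (half r k) = hbox b (half r k.+1) `|` hbox b' (half r k.+1).
  apply/seteqP; split=> x /=.
    move=> bx; have [xi0|xi0] := ltP (x ord0 i0) (b ord0 i0 + r / 2).
      left=> i; have := bx i; have [->|ii0] := eqVneq i i0.
        by rewrite hSi0 xi0 andbT => /andP[].
      by rewrite hi.
    right=> i; have := bx i; have [->|ii0] := eqVneq i i0.
      rewrite hi0 hSi0 bi0 xi0 => /andP[_] /=; lra.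
    by rewrite hi// bi.
  case=> bx i; have := bx i; have [->|ii0] := eqVneq i i0.
  - rewrite hi0 hSi0 => /andP[-> h] /=; lra.
  - by rewrite hi.
  - rewrite hi0 hSi0 bi0 => /andP[h1 h2]; apply/andP; split; lra.
  - by rewrite hi// bi.
have D : hbox b (half r k.+1) `&` hbox b' (half r k.+1) = set0.
  apply/seteqP; split=> // x [/(_ i0) + /(_ i0)]; rewrite hSi0 bi0.
  by move=> /andP[_ h1] /andP[h2 _]; lra.
move: Lb; rewrite E LU; [|exact: measurable_hbox|exact: measurable_hbox|exact: D].
set X := L _; set Y := L (hbox b' _) => Lb.
have : c * r ^+ m < `|X| * 2 ^+ k.+1 \/ c * r ^+ m < `|Y| * 2 ^+ k.+1.
  have h : `|X + Y| * 2 ^+ k <= (`|X| + `|Y|) * 2 ^+ k.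
    by rewrite ler_wpM2r ?exprn_ge0// ler_normD.
  have e0 : (0 : R) < 2 ^+ k by rewrite exprn_gt0.
  rewrite exprS; have [XY|/ltW YX] := leP `|X| `|Y|; [right|left];
    apply: lt_le_trans Lb (le_trans h _); rewrite mulrCA mulrA ler_wpM2r ?(ltW e0)//; lra.
case=> Lb'; [exists b|exists b']; split=> // i; have [h1 h2] := ab i;
  have [ii0|ii0] := eqVneq i i0.
- by subst i; rewrite hSi0; move: h2; rewrite hi0; split=> //; lra.
- by rewrite hi.
- by subst i; rewrite hSi0 bi0; move: h2; rewrite hi0; split; lra.
- by rewrite hi// bi.
Qed.

Hypothesis L_density0 : forall (q : 'rV[R]_m) (c : R), 0 < c ->
  exists2 d, 0 < d & forall a r, 0 < r -> r < d ->
    (forall i, a ord0 i <= q ord0 i <= a ord0 i + r) ->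
    `|L (cube a r)| <= c * r ^+ m.

(** If L (cube a r) <> 0, then bisection gives nested cubes on which |L| is at
    least a fixed multiple of the volume; they shrink to a point, where this
    contradicts density zero. *)
Theorem cube_density0 a r : 0 < r -> L (cube a r) = 0.
Proof.
move=> r0; apply/eqP; apply: contrapT => /negP; rewrite -normr_gt0 => La.
pose c := `|L (cube a r)| / (2 * r ^+ m).
have rm0 : 0 < r ^+ m by rewrite exprn_gt0.
have c0 : 0 < c by rewrite divr_gt0// mulr_gt0.
have Lc : c * r ^+ m < `|L (cube a r)|.
  rewrite /c invfM mulrA -mulrA mulVf ?lt0r_neq0// mulr1 ltr_pdivrMr//; lra.
have /choice[F FP] : forall z : 'rV[R]_m * R, exists b : 'rV[R]_m, 0 < z.2 ->
    c * z.2 ^+ m < `|L (cube z.1 z.2)| ->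
    (forall i, z.1 ord0 i <= b ord0 i /\ b ord0 i + z.2 / 2 <= z.1 ord0 i + z.2) /\
    c * (z.2 / 2) ^+ m < `|L (cube b (z.2 / 2))|.
  move=> [b s]; have [[s0 Ls]|nH] := pselect (0 < s /\ c * s ^+ m < `|L (cube b s)|).
    by have [b' b'P] := halve_cube s0 Ls; exists b'.
  by exists b => /= s0 Ls; exfalso; exact: nH.
pose z k := iter k (fun z => (F z, z.2 / 2)) (a, r).
have zr k : (z k).2 = r / 2 ^+ k.
  elim: k => [|k ih]; first by rewrite expr0 divr1.
  by rewrite /= ih exprSr invfM mulrA.
have zr0 k : 0 < (z k).2 by rewrite zr divr_gt0// exprn_gt0.
have Lz k : c * (z k).2 ^+ m < `|L (cube (z k).1 (z k).2)|.
  by elim: k => [//|k ih]; have [_] := FP (z k) (zr0 k) ih.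
have zS k i : (z k).1 ord0 i <= (z k.+1).1 ord0 i /\
    (z k.+1).1 ord0 i + (z k.+1).2 <= (z k).1 ord0 i + (z k).2.
  by have [/(_ i)] := FP (z k) (zr0 k) (Lz k).
have zle k j i : (z k).1 ord0 i <= (z (k + j)%N).1 ord0 i /\
    (z (k + j)%N).1 ord0 i + (z (k + j)%N).2 <= (z k).1 ord0 i + (z k).2.
  elim: j => [|j [ih1 ih2]]; first by rewrite addn0.
  rewrite addnS; have [h1 h2] := zS (k + j)%N i.
  by split; [exact: le_trans h1|exact: le_trans ih2].
have zub k j i : (z j).1 ord0 i <= (z k).1 ord0 i + (z k).2.
  have [jk|/ltnW kj] := leqP j k.
    have [h _] := zle j (k - j)%N i; rewrite subnKC// in h.
    by rewrite (le_trans h)// lerDl ltW.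
  have [_ h] := zle k (j - k)%N i; rewrite subnKC// in h.
  by apply: le_trans h; rewrite lerDl ltW.
pose S i := range (fun k => (z k).1 ord0 i).
pose q : 'rV[R]_m := \row_i sup (S i).
have S0 i : S i !=set0 by exists ((z 0%N).1 ord0 i); exists 0%N.
have qk k i : (z k).1 ord0 i <= q ord0 i <= (z k).1 ord0 i + (z k).2.
  rewrite mxE; apply/andP; split.
    apply: ub_le_sup; last by exists k.
    by exists ((z k).1 ord0 i + (z k).2) => _ [j _ <-]; exact: zub.
  by apply: ge_sup => // _ [j _ <-]; exact: zub.
have [d d0 dP] := L_density0 q c0.
have [k kd] : exists k, (z k).2 < d.
  have : (fun k => r / 2 ^+ k) @ \oo --> (0 : R).
    rewrite -(mulr0 r); apply: cvgMr; under eq_fun do rewrite -exprVn.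
    by apply: cvg_expr; rewrite ger0_norm; lra.
  move=> /cvgrPdist_lt /(_ d d0)[k _ /(_ k (leqnn k))].
  rewrite sub0r normrN ger0_norm; first by exists k; rewrite zr.
  by rewrite divr_ge0 ?exprn_ge0// ltW.
by have := dP _ _ (zr0 k) kd (qk k); rewrite leNgt Lz.
Qed.

End cube_bisection.

(** * The pairing and the coordinate region of the simplex *)

Section pairing_theory.
Context {R : realType} {m : nat}.
Implicit Types p q x y : 'rV[R]_m.

Lemma pairingC p x : pairing p x = pairing x p.
Proof. by apply: eq_bigr => i _; rewrite mulrC. Qed.

Lemma pairingDl p q x : pairing (p + q) x = pairing p x + pairing q x.
Proof. by rewrite -big_split; apply: eq_bigr => i _; rewrite /= mxE mulrDl. Qed.

Lemma pairingZl (a : R) p x : pairing (a *: p) x = a * pairing p x.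
Proof. by rewrite mulr_sumr; apply: eq_bigr => i _; rewrite mxE mulrA. Qed.

Lemma pairingNl p x : pairing (- p) x = - pairing p x.
Proof. by rewrite -scaleN1r pairingZl mulN1r. Qed.

Lemma pairingBl p q x : pairing (p - q) x = pairing p x - pairing q x.
Proof. by rewrite pairingDl pairingNl. Qed.

Lemma pairingDr p x y : pairing p (x + y) = pairing p x + pairing p y.
Proof. by rewrite pairingC pairingDl !(pairingC _ p). Qed.

Lemma pairingZr (a : R) p x : pairing p (a *: x) = a * pairing p x.
Proof. by rewrite pairingC pairingZl (pairingC _ p). Qed.

Lemma pairingNr p x : pairing p (- x) = - pairing p x.
Proof. by rewrite pairingC pairingNl (pairingC _ p). Qed.

Lemma pairingBr p x y : pairing p (x - y) = pairing p x - pairing p y.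
Proof. by rewrite pairingDr pairingNr. Qed.

Lemma pairing0l x : pairing 0 x = 0.
Proof. by rewrite -(scale0r 0) pairingZl mul0r. Qed.

Lemma pairing_ge0 p : 0 <= pairing p p.
Proof. by apply: sumr_ge0 => i _; rewrite -expr2 sqr_ge0. Qed.

Lemma norm_sqr_le_pairing p : `|p| ^+ 2 <= pairing p p.
Proof.
have h i : `|p ord0 i| <= Num.sqrt (pairing p p).
  rewrite -sqrtr_sqr ler_wsqrtr// expr2 /pairing (bigD1 i)//= lerDl.
  by apply: sumr_ge0 => j _; rewrite -expr2 sqr_ge0.
have := norm_le_coord (sqrtr_ge0 _) h; rewrite -(@ler_pXn2r _ 2%N) ?nnegrE//.
  by rewrite sqr_sqrtr ?pairing_ge0.
Qed.

Lemma pairing_gt0 p : p != 0 -> 0 < pairing p p.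
Proof.
by move=> p0; rewrite (lt_le_trans _ (norm_sqr_le_pairing p))// exprn_gt0// normr_gt0.
Qed.

Lemma norm_pairing_le p x : `|pairing p x| <= m%:R * (`|p| * `|x|).
Proof.
rewrite (le_trans (ler_norm_sum _ _ _))//.
have : \sum_i `|p ord0 i * x ord0 i| <= \sum_(i < m) `|p| * `|x|.
  by apply: ler_sum => i _; rewrite normrM ler_pM// coord_le_norm.
by rewrite sumr_const card_ord mulr_natl.
Qed.

Lemma pairing_delta i x : pairing (delta_mx ord0 i) x = x ord0 i.
Proof.
rewrite /pairing (bigD1 i)//= mxE !eqxx mul1r big1 ?addr0// => j ji.
by rewrite mxE (negbTE ji) andbF mul0r.
Qed.

Lemma mulmx_tr_pairing p x : (p *m x^T) ord0 ord0 = pairing p x.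
Proof. by rewrite mxE; apply: eq_bigr => i _; rewrite mxE. Qed.

Lemma continuous_pairingl x : continuous (fun p => pairing p x).
Proof.
apply: continuous_big => [|i _ p]; first exact: add_continuous.
by apply: continuousM; [exact: coord_continuous|exact: cst_continuous].
Qed.

Lemma continuous_pairing_sqr : continuous (fun p : 'rV[R]_m => pairing p p).
Proof.
apply: continuous_big => [|i _ p]; first exact: add_continuous.
by apply: continuousM; exact: coord_continuous.
Qed.

End pairing_theory.

Section chart_region.
Context {R : realType} {m : nat}.

(** The closure of chart_domain; it contains the vertices of the simplex, where
    the bounds on the gradient come from. *)
Definition chart_closure : set 'rV[R]_m :=
  [set q | (forall i, 0 <= q ord0 i) /\ \sum_i q ord0 i <= 1].

Lemma chart_domainP (q : 'rV[R]_m) : (0 < m)%N ->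
  chart_domain R m.+1 q <-> (forall i, 0 < q ord0 i) /\ \sum_i q ord0 i < 1.
Proof.
move=> m0; split=> [[q01 q1]|[q0 q1]]; split=> // i; first by case/andP: (q01 i).
rewrite q0/= (le_lt_trans _ q1)// (bigD1 i)//= lerDl.
by apply: sumr_ge0 => j _; exact/ltW.
Qed.

Lemma continuous_sum_coord : continuous (fun q : 'rV[R]_m => \sum_i q ord0 i).
Proof. apply: continuous_big => [|i _ p]; [exact: add_continuous|exact: coord_continuous]. Qed.

Lemma chart_domain_open : open (chart_domain R m.+1 : set 'rV[R]_m).
Proof.
have -> : (chart_domain R m.+1 : set 'rV[R]_m) =
   (\bigcap_(i in [set: 'I_m]) ((fun q : 'rV[R]_m => q ord0 i) @^-1` `]0, 1[)) `&`
   ((fun q : 'rV[R]_m => \sum_i q ord0 i) @^-1` [set x | x < 1]).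
  apply/seteqP; split=> q /= [h1 h2]; split=> // i; first by move=> _; rewrite /= in_itv/=; exact: h1.
  by have := h1 i I; rewrite /= in_itv.
apply: openI.
  rewrite (_ : \bigcap_(i in _) _ = \big[setI/setT]_(i <- enum 'I_m)
      ((fun q : 'rV[R]_m => q ord0 i) @^-1` `]0, 1[)); last first.
    rewrite -bigcap_seq; congr bigcap; apply/seteqP; split=> i //= _.
    by rewrite mem_enum.
  elim/big_ind : _ => [|? ?|i _]; [exact: openT|exact: openI|].
  apply: open_comp; last exact: interval_open.
  by move=> ? _; exact: coord_continuous.
apply: open_comp; last exact: open_lt.
by move=> ? _; exact: continuous_sum_coord.
Qed.

Lemma chart_domain_sub : (chart_domain R m.+1 : set 'rV[R]_m) `<=` chart_closure.
Proof. by move=> q [q01 /ltW q1]; split=> // i; case/andP: (q01 i) => /ltW. Qed.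

Lemma chart_closure_closed : closed chart_closure.
Proof.
have -> : chart_closure =
   (\bigcap_(i in [set: 'I_m]) ((fun q : 'rV[R]_m => q ord0 i) @^-1` [set x | 0 <= x])) `&`
   ((fun q : 'rV[R]_m => \sum_i q ord0 i) @^-1` [set x | x <= 1]).
  by apply/seteqP; split=> q /= [h1 h2]; split=> // i; [move=> _|]; apply: h1.
apply: closedI.
  apply: closed_bigI => i _; apply: preimage_closed; last exact: closed_ge.
  by move=> ? _; exact: coord_continuous.
apply: preimage_closed; last exact: closed_le.
by move=> ? _; exact: continuous_sum_coord.
Qed.

Lemma chart_closure_norm q : chart_closure q -> `|q| <= 1.
Proof.
move=> [q0 q1]; apply: norm_le_coord => // i; rewrite ger0_norm//.
rewrite (le_trans _ q1)// (bigD1 i)//= lerDl; exact: sumr_ge0.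
Qed.

Lemma chart_closure_compact : compact chart_closure.
Proof.
apply: bounded_closed_compact; last exact: chart_closure_closed.
exists 1; split; first exact: num_real.
by move=> M M1 q /chart_closure_norm /le_trans; apply; exact: ltW.
Qed.

Lemma chart_closure_convex p q (t : R) : chart_closure p -> chart_closure q ->
  0 <= t <= 1 -> chart_closure (t *: p + (1 - t) *: q).
Proof.
move=> [p0 p1] [q0 q1] /andP[t0 t1]; split=> [i|].
  by rewrite !mxE addr_ge0// mulr_ge0// subr_ge0.
under eq_bigr do rewrite !mxE.
rewrite big_split/= -!mulr_sumr.
apply: (@le_trans _ _ (t * 1 + (1 - t) * 1)); last lra.
by apply: lerD; apply: ler_wpM2l => //; rewrite subr_ge0.
Qed.

Lemma chart_closure0 : chart_closure 0.
Proof. by split=> [i|]; rewrite ?mxE// big1 ?ler01// => i _; rewrite mxE. Qed.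

Lemma chart_closure_delta i : chart_closure (delta_mx ord0 i).
Proof.
split=> [j|]; first by rewrite mxE eqxx/=; case: (_ == _).
rewrite (bigD1 i)//= mxE !eqxx big1 ?addr0// => j ji.
by rewrite mxE (negbTE ji) andbF.
Qed.

Lemma chart_closure_bounded_above (f : 'rV[R]_m -> R) : continuous f ->
  exists2 M, 0 <= M & forall q, chart_closure q -> f q <= M.
Proof.
move=> cf; have [c _ cmax] := @EVT_max_rV R m f chart_closure
  (ex_intro _ _ chart_closure0) chart_closure_compact (continuous_subspaceT cf).
exists `|f c| => // q Kq; apply: le_trans (ler_norm _).
by apply: cmax; exact/mem_set.
Qed.

End chart_region.
Arguments chart_closure : clear implicits.

(** * Maximizers of strongly concave potentials *)

Section argmax.
Context {R : realType} {m : nat}.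
Variables (phi : 'rV[R]_m -> R) (eps : R).
Implicit Types y q u v : 'rV[R]_m.
Local Notation K := (chart_closure R m).

(** The quadratic term makes pot y strongly concave, so that its maximizer on K
    depends on y in a Lipschitz way. *)
Definition pot y q := phi q - eps / 2 * pairing q q + pairing q y.

Definition argmax y := get [set q | K q /\ forall u, K u -> pot y u <= pot y q].

Hypothesis phi_cont : continuous phi.
Hypothesis phi_concave : concave_on K phi.

Lemma continuous_pot y : continuous (pot y).
Proof.
move=> q.
apply: (@continuousD _ _ _ (fun q => phi q - eps / 2 * pairing q q)
  (fun q => pairing q y)); last exact: continuous_pairingl.
apply: (@continuousB _ _ _ phi (fun q => eps / 2 * pairing q q)).
  exact: phi_cont.
apply: (@continuousM _ _ (fun=> eps / 2) (fun q => pairing q q)).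
  exact: cst_continuous.
exact: continuous_pairing_sqr.
Qed.

Lemma argmaxP y : K (argmax y) /\ forall u, K u -> pot y u <= pot y (argmax y).
Proof.
have [c /set_mem Kc cmax] := @EVT_max_rV R m (pot y) K (ex_intro _ _ chart_closure0)
  chart_closure_compact (continuous_subspaceT (@continuous_pot y)).
apply: (@getPex _ [set q | K q /\ forall u, K u -> pot y u <= pot y q]).
by exists c; split=> // u Ku; apply: cmax; exact/mem_set.
Qed.

Lemma argmax_in y : K (argmax y). Proof. by have [] := argmaxP y. Qed.

Lemma argmax_max y u : K u -> pot y u <= pot y (argmax y).
Proof. by have [_] := argmaxP y; apply. Qed.

(** Compare the maximum with the value at the midpoint of u and v, where the
    quadratic term gains eps / 8 |u - v|^2 over the average of the two values. *)
Lemma argmax_strong y v u : K v -> (forall u, K u -> pot y u <= pot y v) -> K u ->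
  pot y u + eps / 4 * pairing (u - v) (u - v) <= pot y v.
Proof.
move=> Kv vmax Ku.
have half01 : 0 <= (2^-1 : R) <= 1 by apply/andP; split; lra.
have Kw := chart_closure_convex Ku Kv half01.
have := vmax _ Kw; have := phi_concave Ku Kv half01.
rewrite /pot; set w := (_ *: u + _) => h1.
have -> : pairing w w = 2^-1 * pairing u u + 2^-1 * pairing v v
    - 4^-1 * pairing (u - v) (u - v).
  rewrite /w !(pairingDl, pairingDr, pairingBl, pairingBr, pairingZl, pairingZr).
  rewrite !(pairingNl, pairingNr) (pairingC v u); lra.
have -> : pairing w y = 2^-1 * pairing u y + 2^-1 * pairing v y.
  by rewrite /w pairingDl !pairingZl; lra.
move: h1; move: (phi w) (phi u) (phi v) (pairing u u) (pairing v v).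
by move: (pairing (u - v) _) (pairing u y) (pairing v y) => *; lra.
Qed.

End argmax.

Section argmax_lipschitz.
Context {R : realType} {m : nat}.
Variables (phi : 'rV[R]_m -> R) (eps : R).
Implicit Types y q u v : 'rV[R]_m.
Local Notation K := (chart_closure R m).
Hypothesis phi_cont : continuous phi.
Hypothesis phi_concave : concave_on K phi.
Hypothesis eps_gt0 : 0 < eps.
Local Notation argmax := (argmax phi eps).
Local Notation pot := (pot phi eps).

Let argmaxK y : K (argmax y). Proof. exact: argmax_in. Qed.

Lemma argmax_unique y v : K v -> (forall u, K u -> pot y u <= pot y v) -> argmax y = v.
Proof.
move=> Kv vmax.
have := argmax_strong phi_concave Kv vmax (argmaxK y).
have := argmax_max eps phi_cont y Kv => h1 h2.
apply/eqP; rewrite -subr_eq0; apply/negPn/negP => /pairing_gt0 d0.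
have := mulr_gt0 (divr_gt0 eps_gt0 (ltr0Sn R 3)) d0.
by move: h1 h2; lra.
Qed.

Definition argmax_lip : R := 2 * m%:R / eps.

Lemma argmax_lip_ge0 : 0 <= argmax_lip.
Proof. by rewrite /argmax_lip divr_ge0 ?mulr_ge0// ltW. Qed.

(** Add the two strong concavity inequalities at the maximizers for y and y'. *)
Lemma argmax_lipschitz y y' : `|argmax y - argmax y'| <= argmax_lip * `|y - y'|.
Proof.
set u := argmax y; set v := argmax y'.
have h1 := argmax_strong phi_concave (argmaxK y) (argmax_max eps phi_cont y) (argmaxK y').
have h2 := argmax_strong phi_concave (argmaxK y') (argmax_max eps phi_cont y') (argmaxK y).
rewrite -/u -/v in h1 h2.
have E : pairing (v - u) (v - u) = pairing (u - v) (u - v).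
  by rewrite -opprB pairingNl pairingNr opprK.
have h : eps / 2 * pairing (u - v) (u - v) <= pairing (u - v) (y - y').
  have -> : pairing (u - v) (y - y') =
      pairing u y - pairing v y - (pairing u y' - pairing v y').
    by rewrite pairingBr !pairingBl.
  move: h1 h2; rewrite E /pot.
  by move: (pairing (u - v) _) (phi _) (phi _) => *; lra.
have hn := norm_pairing_le (u - v) (y - y').
have hs := norm_sqr_le_pairing (u - v).
have [->|uv0] := eqVneq u v.
  by rewrite subrr normr0 mulr_ge0// argmax_lip_ge0.
have n0 : 0 < `|u - v| by rewrite normr_gt0 subr_eq0.
have e2 : 0 < eps / 2 by rewrite divr_gt0.
have : eps / 2 * `|u - v| ^+ 2 <= m%:R * (`|u - v| * `|y - y'|).
  by rewrite (le_trans _ hn)// (le_trans _ (ler_norm _))// (le_trans _ h)// ler_pM2l.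
move=> h3; have hh : eps / 2 * `|u - v| <= m%:R * `|y - y'|.
  rewrite -(ler_pM2r n0) -[leLHS]mulrA -expr2 (le_trans h3)//.
  by rewrite [X in _ * X]mulrC mulrA.
rewrite /argmax_lip -(@ler_pM2l _ (eps / 2))//.
apply: (le_trans hh); rewrite le_eqVlt; apply/orP; left; apply/eqP.
by field; exact: lt0r_neq0.
Qed.

Lemma argmax_coord_continuous i : continuous (fun y => argmax y ord0 i).
Proof.
move=> y; apply: dist_continuous_at => e e0.
have L0 : 0 < argmax_lip + 1 by rewrite ltr_wpDl// argmax_lip_ge0.
exists (e / (argmax_lip + 1)); first exact: divr_gt0.
move=> y'; rewrite ltr_pdivlMr// => yy'.
have := coord_le_norm (argmax y' - argmax y) i; rewrite !mxE => /le_lt_trans; apply.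
rewrite (le_lt_trans (argmax_lipschitz _ _))// (le_lt_trans _ yy')// mulrC ler_wpM2l//.
by rewrite lerDl.
Qed.

Lemma measurable_argmax : measurable_fun setT argmax.
Proof.
by apply: measurable_fun_rVP => i; apply: continuous_measurable_rV; exact: argmax_coord_continuous.
Qed.

End argmax_lipschitz.

(** * Positive definite matrices and gradients of concave functions *)

Section ball_radius.
Context {R : realType} {m : nat}.

Lemma open_radius (U : set 'rV[R]_m) q : open U -> U q ->
  exists2 r, 0 < r & forall x, `|x - q| < r -> U x.
Proof.
move=> oU Uq; have /nbhs_ballP[r /= r0 sub] : nbhs q U by exact: open_nbhs_nbhs.
by exists r => // x xq; apply: sub; rewrite mx_norm_ball /= distrC.
Qed.

End ball_radius.

Section posdef.
Context {R : realType} {m : nat}.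

Lemma posdef_det_neq0 (A : 'M[R]_m) :
  (forall v : 'rV[R]_m, v != 0 -> 0 < pairing (v *m A) v) -> \det A != 0.
Proof.
move=> posA; apply/negP => /det0P[v v0 vA].
by have := posA v v0; rewrite vA pairing0l ltxx.
Qed.

Lemma cvg_det (T : Type) (F : set_system T) (FF : Filter F) (M : T -> 'M[R]_m)
    (M0 : 'M[R]_m) :
  (forall i j, M x i j @[x --> F] --> M0 i j) -> \det (M x) @[x --> F] --> \det M0.
Proof.
move=> cM; apply: cvg_big => [|s _]; first exact: add_continuous.
apply: cvgM; first exact: cvg_cst.
by apply: cvg_big => [|i _]; [exact: mul_continuous|exact: cM].
Qed.

Lemma continuous_det_line (A B : 'M[R]_m) :
  continuous (fun t : R => \det (t *: A + B)).
Proof.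
move=> t; apply: cvg_det => i j; rewrite !mxE.
rewrite (_ : (fun t : R => _) = fun t : R => t * A i j + B i j); last first.
  by apply/funext => w; rewrite !mxE.
by apply: cvgD; [apply: cvgM; [exact: cvg_id|exact: cvg_cst]|exact: cvg_cst].
Qed.

(** Along the segment from A to the identity all matrices are positive
    definite, so the determinant does not vanish and keeps the sign of 1. *)
Lemma posdef_det_gt0 (A : 'M[R]_m) :
  (forall v : 'rV[R]_m, v != 0 -> 0 < pairing (v *m A) v) -> 0 < \det A.
Proof.
move=> posA; rewrite lt_neqAle eq_sym posdef_det_neq0//= leNgt; apply/negP => detA.
pose g t : R := \det (t *: (A - 1%:M) + 1%:M).
have g0 : g 0 = 1 by rewrite /g scale0r add0r det1.
have g1 : g 1 = \det A by rewrite /g scale1r subrK.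
have [|t t01 gt] := @IVT R g 0 1 0 ler01
  (continuous_subspaceT (@continuous_det_line (A - 1%:M) 1%:M)).
  by rewrite g0 g1 ge_min le_max ler01 (ltW detA) !orbT.
move/eqP: gt; apply/negP; apply: posdef_det_neq0 => v v0.
move: t01; rewrite in_itv/= => /andP[t0 t1].
have -> : v *m (t *: (A - 1%:M) + 1%:M) = t *: (v *m A) + (1 - t) *: v.
  rewrite mulmxDr -scalemxAr mulmxBr !mulmx1 scalerBr scalerBl scale1r.
  by rewrite -addrA [in LHS](addrC (- _)).
rewrite pairingDl !pairingZl.
have [->|tn0] := eqVneq t 0; first by rewrite mul0r add0r subr0 mul1r pairing_gt0.
apply: ltr_pwDl; first by rewrite mulr_gt0 ?posA// lt_neqAle eq_sym tn0.
by rewrite mulr_ge0 ?pairing_ge0// subr_ge0.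
Qed.

(** The pairing of v *m A and v is at most m |v *m A| |v|.  With v the image of w
    under the inverse of A, this bounds the inverse. *)
Lemma pos_inverse_bound (A : 'M[R]_m) (eps : R) : 0 < eps ->
  (forall v : 'rV[R]_m, eps * pairing v v <= pairing (v *m A) v) ->
  forall v : 'rV[R]_m, `|v| <= m%:R / eps * `|v *m A|.
Proof.
move=> e0 posA v; have [->|v0] := eqVneq v 0.
  by rewrite normr0 mulr_ge0// divr_ge0// ltW.
have n0 : 0 < `|v| by rewrite normr_gt0.
rewrite mulrAC ler_pdivlMr// -(ler_pM2r n0) mulrAC -expr2 mulrC.
rewrite (le_trans (ler_wpM2l (ltW e0) (norm_sqr_le_pairing v)))//.
rewrite (le_trans (posA v))// (le_trans (ler_norm _))// (le_trans (norm_pairing_le _ _))//.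
by rewrite mulrA.
Qed.

End posdef.

Section C2_concave.
Context {R : realType} {m : nat}.
Variables (phi : 'rV[R]_m -> R).
Implicit Types y q u v : 'rV[R]_m.
Local Notation K := (chart_closure R m).
Local Notation D := (chart_domain R m.+1 : set 'rV[R]_m).
Hypothesis phi_cont : continuous phi.
Hypothesis phi_concave : concave_on K phi.
Hypothesis phi_C2 : C2_on D phi.

Definition grad (f : 'rV[R]_m -> R) q : 'rV[R]_m := \row_i partial i f q.

Let DK q : D q -> K q. Proof. exact: chart_domain_sub. Qed.

Lemma grad_approx q : D q -> forall c, 0 < c -> exists2 d, 0 < d & forall h, `|h| < d ->
  `|phi (q + h) - phi q - pairing h (grad phi q)| <= c * `|h|.
Proof.
move=> Dq c c0; have [r r0 rD] := open_radius chart_domain_open Dq.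
have [_ _ cp _ _] := phi_C2 Dq.
have [x xr i|d d0 dP] := @partials_differentiable R m phi q r r0 _ cp c c0.
  by have [_ dx _ _ _] := phi_C2 (rD x xr).
exists d => // h hd; have := dP h hd.
rewrite (_ : \sum_i _ = pairing h (grad phi q))//.
by apply: eq_bigr => i _; rewrite mxE.
Qed.

(** The second index of the Hessian is that of the first derivative, so
    the j-th entry of h *m hessian phi q is the differential of partial j phi. *)
Lemma hessian_approx q : D q -> forall c, 0 < c -> exists2 d, 0 < d & forall h, `|h| < d ->
  `|grad phi (q + h) - grad phi q - h *m hessian phi q| <= c * `|h|.
Proof.
move=> Dq c c0; have [r r0 rD] := open_radius chart_domain_open Dq.
have [_ _ _ _ cp] := phi_C2 Dq.
have [j d d' /andP[d'0 dd'] dP h hd||d d0 dP] := @fin_radius R m (fun j d => forall h, `|h| < d ->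
  `|partial j phi (q + h) - partial j phi q -
    \sum_i h ord0 i * partial i (partial j phi) q| <= c * `|h|).
- by apply: dP; exact: lt_le_trans dd'.
- move=> j; apply: (@partials_differentiable R m (partial j phi) q r r0) => //.
  by move=> x xr i; have [_ _ _ dx _] := phi_C2 (rD x xr).
exists d => // h hd; apply: norm_le_coord; first by rewrite mulr_ge0// ltW.
move=> j; have := dP j h hd; rewrite !mxE.
rewrite (_ : \sum_i h ord0 i * partial i _ q = \sum_i h ord0 i * hessian phi q i j)//.
by apply: eq_bigr => i _; rewrite mxE.
Qed.

Lemma concave_grad_ineq q u : D q -> K u ->
  phi u <= phi q + pairing (u - q) (grad phi q).
Proof.
move=> Dq Ku; apply/ler_addgt0Pr => c c0.
pose n0 := `|u - q| + 1.
have n0_gt0 : 0 < n0 by rewrite ltr_wpDl.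
have [d d0 dP] := grad_approx Dq (divr_gt0 c0 n0_gt0).
pose t := Num.min (d / (2 * n0)) 1.
have t0 : 0 < t by rewrite lt_min ltr01 andbT divr_gt0// mulr_gt0.
have t1 : t <= 1 by rewrite ge_min lexx orbT.
have td : `|t *: (u - q)| < d.
  rewrite normrZ gtr0_norm// (@le_lt_trans _ _ (d / 2))//; last lra.
  rewrite (@le_trans _ _ (d / (2 * n0) * n0))//.
    by apply: ler_pM => //; [exact: ltW|rewrite /t ge_min lexx|rewrite lerDl].
  by rewrite invfM mulrA mulfVK ?lt0r_neq0.
have := dP _ td.
have t01 : 0 <= t <= 1 by rewrite (ltW t0).
have := phi_concave Ku (DK Dq) t01.
have -> : t *: u + (1 - t) *: q = q + t *: (u - q).
  by rewrite scalerBr scalerBl scale1r addrC addrAC addrA.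
rewrite pairingZl normrZ (gtr0_norm t0) ler_norml => h1 /andP[_ h2].
have h3 : c / n0 * (t * `|u - q|) <= t * c.
  rewrite mulrCA ler_pM2l// mulrAC ler_pdivrMr// ler_pM2l//; by rewrite lerDl.
rewrite -(ler_pM2l t0).
by move: h1 h2 h3; move: (phi (q + _)) (phi u) (phi q) (pairing _ _) (c / _ * _) => *; lra.
Qed.

End C2_concave.

(** * Volume of the preimage of a small cube *)

Section affine_volume.
Context {R : realType} {m : nat}.

Lemma lebesgue_rV_cube (a : 'rV[R]_m) (r : R) : 0 < r ->
  lebesgue_rV R m (cube a r) = (r ^+ m)%:E.
Proof.
move=> r0; have -> : cube a r = [set x : 'rV[R]_m | forall i,
    [set` `[a ord0 i, (a ord0 i + r)%R[] (x ord0 i)].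
  by apply/seteqP; split=> x /= ax i; have := ax i; rewrite /= in_itv/= mxE.
rewrite (@lebesgue_rV_box R m (fun i => [set` `[a ord0 i, (a ord0 i + r)%R[])); last first.
  by move=> i; exact: measurable_itv.
rewrite (eq_bigr (fun=> r%:E)) => [|i _].
  rewrite prodEFin; congr EFin; by rewrite prodr_const card_ord.
rewrite lebesgue_measure_itv/= lte_fin ltrDl r0 -EFinD; congr EFin; by rewrite addrAC subrr add0r.
Qed.

Lemma ball_volume_fin (b : R) (S : set 'rV[R]_m) : 0 <= b -> measurable S ->
  (forall x, S x -> `|x| <= b) -> lebesgue_rV R m S \is a fin_num.
Proof.
move=> b0 mS Sb.
have sub : S `<=` cube (const_mx (- b)) (3 * b + 1).
  move=> x /Sb xb i; have := le_trans (coord_le_norm x i) xb.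
  by rewrite !mxE ler_norml => /andP[h1 h2]; apply/andP; split; lra.
rewrite ge0_fin_numE; last exact: measure_ge0.
apply: (@le_lt_trans _ _ (lebesgue_rV R m (cube (const_mx (- b)) (3 * b + 1)))); last first.
  rewrite lebesgue_rV_cube ?ltry//; lra.
exact: (le_measure (lebesgue_rV R m) (mem_set mS) (mem_set (measurable_hbox _ _)) sub).
Qed.

Lemma lebesgue_rV_affine (A : 'M[R]_m) (b q : 'rV[R]_m) (C : set 'rV[R]_m) :
  scales_lebesgue A -> A \in unitmx -> measurable C ->
  lebesgue_rV R m [set y | C ((y - b) *m invmx A + q)] =
  (`|\det A|%:E * lebesgue_rV R m C)%E.
Proof.
move=> sA uA mC; have E y : (y - b) *m invmx A + q = y *m invmx A + (q - b *m invmx A).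
  by rewrite mulmxBl addrAC addrA.
have mF : measurable [set y | C ((y - b) *m invmx A + q)].
  under eq_set do rewrite E; exact: measurable_affine_preimage.
rewrite (sA _ mF) -(lebesgue_rV_translate (q - b *m invmx A) mC).
by congr (_ * lebesgue_rV R m _)%E; apply/seteqP; split=> v /=; rewrite E mulmxK.
Qed.

End affine_volume.

Section argmax_density.
Context {R : realType} {m : nat}.
Variables (phi : 'rV[R]_m -> R) (eps : R).
Implicit Types y q u v : 'rV[R]_m.
Local Notation K := (chart_closure R m).
Local Notation D := (chart_domain R m.+1 : set 'rV[R]_m).
Hypothesis phi_cont : continuous phi.
Hypothesis phi_concave : concave_on K phi.
Hypothesis phi_C2 : C2_on D phi.
Hypothesis eps_gt0 : 0 < eps.
Local Notation argmax := (argmax phi eps).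
Local Notation pot := (pot phi eps).
Local Notation hess q := (eps%:M - hessian phi q).

Let DK q : D q -> K q. Proof. exact: chart_domain_sub. Qed.

(** At an interior point v the gradient of pot vanishes for this y, and a
    critical point of a concave function is its maximizer. *)
Lemma argmax_grad v : D v -> argmax (eps *: v - grad phi v) = v.
Proof.
move=> Dv; apply: argmax_unique => //; first exact: DK.
move=> u Ku; have := concave_grad_ineq phi_concave phi_C2 Dv Ku.
have := pairing_ge0 (u - v); rewrite /pot.
rewrite !(pairingBl, pairingBr, pairingZr) (pairingC v u).
move: (phi u) (phi v) (pairing u u) (pairing u v) (pairing v v) => a b uu uv vv h1.
have := mulr_ge0 (ltW eps_gt0) h1.
by move: (pairing _ _) (pairing _ _) => *; nra.
Qed.

(** The first order condition at an interior maximizer: on D, the map argmax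
    inverts v |-> eps v - grad phi v. *)
Lemma grad_argmax y : D (argmax y) -> y = eps *: argmax y - grad phi (argmax y).
Proof.
set u := argmax y => Du.
apply/eqP; rewrite -subr_eq0; set w := _ - _; apply/negPn/negP => w0.
have wE : pairing w y = pairing w w + eps * pairing w u - pairing w (grad phi u).
  have -> : pairing w w = pairing w y - (eps * pairing w u - pairing w (grad phi u)).
    by rewrite -pairingZr -!pairingBr.
  by ring.
clearbody w.
have n0 : 0 < `|w| by rewrite normr_gt0.
have [r r0 rD] := open_radius chart_domain_open Du.
have [d d0 dP] := grad_approx phi_C2 Du (divr_gt0 n0 (ltr0Sn R 3)).
pose s := Num.min (Num.min r d / (2 * `|w|)) (2 * eps)^-1.
have rd0 : 0 < Num.min r d by rewrite lt_min r0.
have s0 : 0 < s by rewrite lt_min divr_gt0 ?mulr_gt0//= invr_gt0 mulr_gt0.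
have sw : `|s *: w| < Num.min r d.
  rewrite normrZ gtr0_norm// -ltr_pdivlMr// /s gt_min; apply/orP; left.
  by rewrite invfM mulrA ltr_pM2r ?invr_gt0//; lra.
have se : eps * s <= 1 / 2.
  rewrite (@le_trans _ _ (eps * (2 * eps)^-1))//.
    by rewrite ler_pM2l// /s ge_min lexx orbT.
  by rewrite invfM mulrCA mulfV ?lt0r_neq0// mulr1 mul1r.
move: sw; rewrite lt_min => /andP[swr swd].
have Kus : K (u + s *: w) by apply/DK/rD; rewrite addrC addKr.
have := argmax_max eps phi_cont y Kus; rewrite -/u /pot.
have := dP _ swd; rewrite pairingZl ler_norml normrZ (gtr0_norm s0) => /andP[+ _].
rewrite !pairingDl !pairingZl !(pairingDr _ u) !pairingZr (pairingC u w) wE.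
have nw := norm_sqr_le_pairing w.
have h1 : `|w| / 4 * (s * `|w|) <= s * pairing w w / 4.
  have := ler_wpM2l (ltW s0) nw; rewrite expr2.
  by move: (pairing w w) => *; lra.
have h2 : eps / 2 * (s * (s * pairing w w)) <= s * pairing w w / 4.
  have : 0 <= s * pairing w w by rewrite mulr_ge0 ?pairing_ge0// ltW.
  by move: (s * pairing w w) => X X0; nra.
have h3 : 0 < s * pairing w w by rewrite mulr_gt0// pairing_gt0.
move: h1 h2 h3; move: (phi _) (phi _) (pairing w (grad _ _)) => f1 f2 g1.
by move: (pairing w w) (pairing w u) (pairing u u) (pairing u y) (`|w|) => *; lra.
Qed.

(** Adding the tangent inequalities at q and at q + s z shows that the gradient
    is monotone decreasing; divide by s^2 and let s tend to 0. *)
Lemma hessian_le0 q z : D q -> pairing (z *m hessian phi q) z <= 0.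
Proof.
move=> Dq; have [->|z0] := eqVneq z 0; first by rewrite mul0mx pairing0l.
have n0 : 0 < `|z| by rewrite normr_gt0.
apply/ler_addgt0Pr => c c0; rewrite add0r.
have [r r0 rD] := open_radius chart_domain_open Dq.
pose N : R := m%:R + 1.
have N0 : 0 < N by rewrite ltr_wpDl.
have e0 : 0 < c / (N * `|z| ^+ 2) by rewrite divr_gt0// mulr_gt0// exprn_gt0.
have [d d0 dP] := hessian_approx phi_C2 Dq e0.
pose s := Num.min r d / (2 * `|z|).
have rd0 : 0 < Num.min r d by rewrite lt_min r0.
have s0 : 0 < s by rewrite divr_gt0// mulr_gt0.
have sz : `|s *: z| < Num.min r d.
  rewrite normrZ gtr0_norm// -ltr_pdivlMr// /s.
  by rewrite invfM mulrA ltr_pM2r ?invr_gt0//; lra.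
move: sz; rewrite lt_min => /andP[szr szd].
have Dqs : D (q + s *: z) by apply/rD; rewrite addrC addKr.
have := concave_grad_ineq phi_concave phi_C2 Dq (DK Dqs).
have := concave_grad_ineq phi_concave phi_C2 Dqs (DK Dq).
have -> : q - (q + s *: z) = - (s *: z) by rewrite opprD addNKr.
have -> : q + s *: z - q = s *: z by rewrite addrC addKr.
have := dP _ szd; set e := _ - _ *m _ => eP.
have -> : grad phi (q + s *: z) = grad phi q + s *: (z *m hessian phi q) + e.
  by rewrite /e -scalemxAl; apply/rowP => i; rewrite !mxE; ring.
clearbody e; rewrite pairingNl !pairingZl !pairingDr pairingZr (pairingC z (z *m _)).
have := norm_pairing_le z e; rewrite ler_norml => /andP[he _].
have he2 : m%:R * (`|z| * `|e|) <= s * c.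
  rewrite normrZ (gtr0_norm s0) in eP.
  have h1 : `|z| * `|e| <= s * c / N.
    rewrite (le_trans (ler_wpM2l (ltW n0) eP))// le_eqVlt; apply/orP; left; apply/eqP.
    by field; rewrite !lt0r_neq0.
  rewrite (@le_trans _ _ (N * (s * c / N)))//.
    by apply: ler_pM => //; rewrite ?mulr_ge0 ?lerDl.
  by rewrite mulrC divfK ?lt0r_neq0.
move: he he2; move: (phi _) (phi _) (pairing z (grad _ _)) (m%:R * _) (pairing z e) => a b g X Y.
move: (pairing (z *m _) z) => h h1 h2 h3 h4.
have X0 : s * (s * h + Y) <= 0 by lra.
by move: X0; rewrite pmulr_rle0// => X0; rewrite -(ler_pM2l s0); lra.
Qed.

Lemma hess_pos q z : D q -> eps * pairing z z <= pairing (z *m hess q) z.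
Proof.
move=> Dq; rewrite mulmxBr pairingBl mul_mx_scalar pairingZl.
by rewrite lerBrDr gerDl hessian_le0.
Qed.

Lemma hess_posdef q z : D q -> z != 0 -> 0 < pairing (z *m hess q) z.
Proof.
by move=> Dq z0; rewrite (lt_le_trans _ (hess_pos z Dq))// mulr_gt0// pairing_gt0.
Qed.

(** Near q, argmax inverts v |-> eps v - grad phi v, which differs from its
    linearization at q by little compared with r.  So the preimage of the cube
    lies between the preimages, under the affine map lin, of a slightly smaller
    and a slightly larger cube, whose volumes are det (hess q) times those of
    the cubes. *)
Lemma argmax_density q : D q -> forall c, 0 < c -> exists2 d, 0 < d & forall (a : 'rV[R]_m) (r : R),
  0 < r -> r < d -> (forall i, a ord0 i <= q ord0 i <= a ord0 i + r) ->
  (((\det (hess q) - c) * r ^+ m)%:E <= lebesgue_rV R m (argmax @^-1` cube a r)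
    <= ((\det (hess q) + c) * r ^+ m)%:E)%E.
Proof.
move=> Dq c c0; set A := hess q.
have posA : forall v : 'rV[R]_m, v != 0 -> 0 < pairing (v *m A) v.
  by move=> v v0; exact: hess_posdef.
have det0 : 0 < \det A by exact: posdef_det_gt0.
have uA : A \in unitmx by rewrite unitmxE unitfE lt0r_neq0.
have sA : scales_lebesgue A.
  by apply: scales_lebesgue_definite => v v0; rewrite mulmx_tr_pairing lt0r_neq0// posA.
have invA (w : 'rV[R]_m) : `|w *m invmx A| <= @argmax_lip R m eps * `|w|.
  have := pos_inverse_bound eps_gt0 (fun z => hess_pos z Dq) (w *m invmx A).
  rewrite -/A mulmxKV// => /le_trans; apply; rewrite ler_wpM2r// /argmax_lip.
  by rewrite ler_pM2r ?invr_gt0// mulrC mulr_natr mulr2n lerDl.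
pose Lp := @argmax_lip R m eps + 1.
have Lp0 : 0 < Lp by rewrite ltr_wpDl//; exact: (@argmax_lip_ge0 R m eps).
(* t is the relative error allowed for the linearization: the cubes of sides
   (1 - 2 t) r and (1 + 2 t) r have the volumes that are needed *)
have [t t0 [t1 tu tl]] : exists2 t, 0 < t & [/\ t < 1 / 4,
    \det A * (1 + 2 * t) ^+ m <= \det A + c & \det A - c <= \det A * (1 - 2 * t) ^+ m].
  have cont : (fun x : R => \det A * (1 + x) ^+ m) @ (0 : R) --> \det A * (1 + 0) ^+ m.
    apply: cvgM; first exact: cvg_cst.
    apply: (@cvg_comp _ _ _ (fun x : R => 1 + x) (fun x => x ^+ m) _ (nbhs (1 + 0 : R))).
      by apply: cvgD; [exact: cvg_cst|exact: cvg_id].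
    exact: exprn_continuous.
  move: cont; rewrite addr0 expr1n mulr1 => /cvgrPdist_lt /(_ c c0).
  move=> /nbhs_ballP[e /= e0 eP].
  pose t := Num.min (e / 4) (1 / 8); exists t; first by rewrite lt_min; lra.
  have tlt : t <= e / 4 by rewrite ge_min lexx.
  have tlt2 : t <= 1 / 8 by rewrite ge_min lexx orbT.
  have tgt : 0 < t by rewrite lt_min; lra.
  split; first lra.
    have /eP : ball (0 : R) e (2 * t).
      by rewrite /ball/= sub0r normrN gtr0_norm; lra.
    by rewrite /= ltr_norml => /andP[h1 h2]; lra.
  have /eP : ball (0 : R) e (- (2 * t)).
    by rewrite /ball/= sub0r opprK gtr0_norm; lra.
  by rewrite /= ltr_norml => /andP[h1 h2]; lra.
have [r1 r10 r1D] := open_radius chart_domain_open Dq.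
have [d d0 dP] := hessian_approx phi_C2 Dq (divr_gt0 t0 Lp0).
exists (Num.min r1 d); first by rewrite lt_min r10.
move=> a r r0; rewrite lt_min => /andP[rr1 rd] aq.
have near u : cube a r u -> `|u - q| <= r.
  move=> au; apply: norm_le_coord; first exact: ltW.
  move=> i; have := aq i; have := au i; rewrite !mxE ler_norml.
  by move=> /andP[? ?] /andP[? ?]; apply/andP; split; lra.
have cubeD u : cube a r u -> D u by move=> /near h; apply: r1D; exact: le_lt_trans rr1.
pose b := eps *: q - grad phi q.
(* inverse of the linearization of v |-> eps v - grad phi v at q *)
pose lin y := (y - b) *m invmx A + q.
have err u : cube a r u ->
    `|(eps *: u - grad phi u - b) - (u - q) *m A| <= t / Lp * r.
  move=> au; have uq := near _ au.
  have := dP (u - q) (le_lt_trans uq rd); rewrite [q + _]addrC subrK.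
  rewrite -normrN => hh; apply: le_trans (le_trans hh _); last first.
    by rewrite ler_wpM2l// divr_ge0// ltW.
  rewrite le_eqVlt; apply/orP; left; apply/eqP; congr (`|_|).
  rewrite /b /A mulmxBr mul_mx_scalar.
  by move: (_ *m _) => h; apply/rowP => i; rewrite !mxE; ring.
have lint y u : cube a r u ->
    `|y - (eps *: u - grad phi u)| = 0 -> `|lin y - u| <= t * r.
  move=> au /eqP; rewrite normr_eq0 subr_eq0 => /eqP ->.
  have := err u au; set w := _ - _ *m _ => wr.
  have -> : lin (eps *: u - grad phi u) - u = w *m invmx A.
    rewrite /w mulmxBl mulmxK// /lin; move: (_ *m _) => h.
    by apply/rowP => i; rewrite !mxE; ring.
  rewrite (le_trans (invA _))// (le_trans (ler_wpM2l (@argmax_lip_ge0 R m eps eps_gt0) wr))//.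
  rewrite (@le_trans _ _ (Lp * (t / Lp * r)))//.
    by rewrite ler_wpM2r ?lerDl// mulr_ge0 ?divr_ge0// ltW.
  by rewrite le_eqVlt; apply/orP; left; apply/eqP; field; rewrite lt0r_neq0.
have lower : [set y | cube (a + const_mx (t * r)) ((1 - 2 * t) * r) (lin y)] `<=`
    argmax @^-1` cube a r.
  move=> y /= yv.
  have vi i := yv i.
  have av : cube a r (lin y).
    move=> i; have := vi i; rewrite !mxE => /andP[h1 h2].
    have tr0 := mulr_gt0 t0 r0; apply/andP; split; lra.
  have Dv := cubeD _ av.
  have yE : y = b + (lin y - q) *m A by rewrite /lin addrK mulmxKV// addrC subrK.
  have := argmax_lipschitz phi_cont phi_concave eps_gt0 y (eps *: lin y - grad phi (lin y)).
  rewrite argmax_grad// => hL.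
  have hn : `|argmax y - lin y| <= t * r.
    apply: (le_trans hL); rewrite (@le_trans _ _ (Lp * (t / Lp * r)))//; last first.
      by rewrite le_eqVlt; apply/orP; left; apply/eqP; field; rewrite lt0r_neq0.
    apply: ler_pM => //; [exact: (@argmax_lip_ge0 R m eps)|by rewrite lerDl|].
    rewrite -normrN; apply: le_trans (err _ av).
    rewrite le_eqVlt; apply/orP; left; apply/eqP; congr (`|_|).
    rewrite {1}yE; move: (_ *m _) => h; apply/rowP => i; rewrite !mxE; ring.
  move=> i; have := le_trans (coord_le_norm _ i) hn; have := vi i.
  rewrite !mxE ler_norml => /andP[h1 h2] /andP[h3 h4].
  by apply/andP; split; lra.
have upper : argmax @^-1` cube a r `<=`
    [set y | cube (a - const_mx (t * r)) ((1 + 2 * t) * r) (lin y)].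
  move=> y /= au; have Du := cubeD _ au.
  have := lint y _ au; rewrite -grad_argmax// subrr normr0 => /(_ erefl) hn.
  move=> i; have := le_trans (coord_le_norm _ i) hn; have := au i.
  rewrite !mxE ler_norml => /andP[h1 h2] /andP[h3 h4].
  by apply/andP; split; lra.
have mpre : measurable (argmax @^-1` cube a r).
  by rewrite -[X in measurable X]setTI; apply: measurable_argmax => //; exact: measurable_hbox.
have mlin a' r' : measurable [set y | cube a' r' (lin y)].
  have linE y : lin y = y *m invmx A + (q - b *m invmx A).
    by rewrite /lin mulmxBl addrAC addrA.
  under eq_set do rewrite linE.
  by apply: measurable_affine_preimage; exact: measurable_hbox.
have vol a' r' : 0 < r' -> lebesgue_rV R m [set y | cube a' r' (lin y)] =
    (\det A * r' ^+ m)%:E.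
  move=> r'0; rewrite lebesgue_rV_affine//; last exact: measurable_hbox.
  by rewrite lebesgue_rV_cube// gtr0_norm.
apply/andP; split.
  have t1' : 0 < (1 - 2 * t) * r by rewrite mulr_gt0//; lra.
  apply: (@le_trans _ _ (lebesgue_rV R m
      [set y | cube (a + const_mx (t * r)) ((1 - 2 * t) * r) (lin y)])).
    by rewrite vol// lee_fin exprMn mulrA ler_pM2r ?exprn_gt0.
  exact: (le_measure (lebesgue_rV R m) (mem_set (mlin _ _)) (mem_set mpre) lower).
have t1' : 0 < (1 + 2 * t) * r by rewrite mulr_gt0//; lra.
apply: (@le_trans _ _ (lebesgue_rV R m
    [set y | cube (a - const_mx (t * r)) ((1 + 2 * t) * r) (lin y)])); last first.
  by rewrite vol// lee_fin exprMn mulrA ler_pM2r ?exprn_gt0.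
exact: (le_measure (lebesgue_rV R m) (mem_set mpre) (mem_set (mlin _ _)) upper).
Qed.

End argmax_density.

(** * Change of variables along the maximizer *)

Section integral_bounds.
Context d (T : measurableType d) {R : realType} (mu : {measure set T -> \bar R}).

Lemma ge0_integral_le_cst (S : set T) (h : T -> R) (hi : R) :
  measurable S -> measurable_fun S h -> (forall x, S x -> 0 <= h x <= hi) -> 0 <= hi ->
  (\int[mu]_(x in S) (h x)%:E <= hi%:E * mu S)%E.
Proof.
move=> mS mh hb hi0; rewrite -integral_cst//.
apply: ge0_le_integral => //.
- by move=> x Sx; rewrite lee_fin; case/andP: (hb x Sx).
- by apply/measurable_EFinP.
- by move=> x Sx; rewrite lee_fin; case/andP: (hb x Sx).
Qed.

Lemma ge0_integral_ge_cst (S : set T) (h : T -> R) (lo : R) :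
  measurable S -> measurable_fun S h -> (forall x, S x -> 0 <= h x) ->
  (forall x, S x -> lo <= h x) -> 0 <= lo ->
  (lo%:E * mu S <= \int[mu]_(x in S) (h x)%:E)%E.
Proof.
move=> mS mh h0 hb lo0; rewrite -integral_cst//.
apply: ge0_le_integral => //; try by move=> x Sx; rewrite lee_fin ?h0 ?hb.
exact/measurable_EFinP.
Qed.

Lemma fine_integral_near (S : set T) (h : T -> R) (g c V : R) :
  measurable S -> mu S = V%:E -> measurable_fun S h ->
  (forall x, S x -> 0 <= h x) -> (forall x, S x -> `|h x - g| <= c) -> 0 <= g -> 0 <= c ->
  `|fine (\int[mu]_(x in S) (h x)%:E)%E - g * V| <= c * V.
Proof.
move=> mS SV mh h0 hb g0 c0.
have V0 : 0 <= V by rewrite -lee_fin -SV.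
have b x : S x -> 0 <= h x <= g + c.
  by move=> Sx; rewrite h0//=; have := hb x Sx; rewrite ler_norml => /andP[_]; lra.
have up := ge0_integral_le_cst mS mh b (addr_ge0 g0 c0).
have Ige : (0 <= \int[mu]_(x in S) (h x)%:E)%E.
  by apply: integral_ge0 => x Sx; rewrite lee_fin h0.
have Ifin : (\int[mu]_(x in S) (h x)%:E)%E \is a fin_num.
  rewrite ge0_fin_numE//; apply: le_lt_trans up _; by rewrite SV -EFinM ltry.
have lo : (g - c) * V <= fine (\int[mu]_(x in S) (h x)%:E)%E.
  have [gc|gc] := leP (g - c) 0.
    by apply: (@le_trans _ _ 0); [rewrite mulr_le0_ge0|exact: fine_ge0].
  rewrite -lee_fin fineK// EFinM -SV; apply: ge0_integral_ge_cst => //; last exact: ltW.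
  by move=> x Sx; have := hb x Sx; rewrite ler_norml => /andP[+ _]; lra.
move: up; rewrite SV -EFinM -[X in (X <= _)%E]fineK// lee_fin => up.
by rewrite ler_norml; apply/andP; split; lra.
Qed.

End integral_bounds.

Section change_of_variables.
Context {R : realType} {m : nat}.
Variables (phi : 'rV[R]_m -> R) (eps : R).
Implicit Types y q u v : 'rV[R]_m.
Local Notation K := (chart_closure R m).
Local Notation D := (chart_domain R m.+1 : set 'rV[R]_m).
Local Notation vol := (lebesgue_rV R m).
Hypothesis phi_cont : continuous phi.
Hypothesis phi_concave : concave_on K phi.
Hypothesis phi_C2 : C2_on D phi.
Hypothesis eps_gt0 : 0 < eps.
Local Notation argmax := (argmax phi eps).
Local Notation hess q := (eps%:M - hessian phi q).

Variables (g : 'rV[R]_m -> R) (B : R).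
Hypothesis g_cont : continuous g.
Hypothesis g_ge0 : forall q, 0 <= g q.
(* The integrand is cut off near the complement of D, where the Hessian of phi
   is not controlled, and for large y, where the integral over y could
   diverge. *)
Hypothesis g_supp : forall q, ~ D q ->
  exists2 d, 0 < d & forall x, `|x - q| < d -> g x = 0.
Hypothesis g_argmax_supp : forall y, B < `|y| -> g (argmax y) = 0.

Let w q := g q * \det (hess q).

Let g_off q : ~ D q -> g q = 0.
Proof. by move=> /g_supp[d d0]; apply; rewrite subrr normr0. Qed.

Let w_eq0 q : g q = 0 -> w q = 0.
Proof. by move=> gq; rewrite /w gq; exact: mul0r. Qed.

Let w_ge0 q : 0 <= w q.
Proof.
have [Dq|/g_off gq] := pselect (D q); last by rewrite /w gq mul0r.
rewrite mulr_ge0// ltW// posdef_det_gt0// => v v0.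
exact: (hess_posdef phi_concave phi_C2).
Qed.

Lemma continuous_g_det : continuous w.
Proof.
move=> q; have [Dq|/g_supp[d d0 gd]] := pselect (D q); last first.
  apply: dist_continuous_at => c c0; exists d => // x xq.
  have gq : g q = 0 by apply: gd; rewrite subrr normr0.
  by rewrite (w_eq0 (gd x xq)) (w_eq0 gq) subrr normr0.
have ch i j : (fun x => (hess x) i j) @ q --> (hess q) i j.
  have hE x : (hess x) i j = (eps *+ (i == j)) - partial i (partial j phi) x.
    by rewrite /hessian !mxE.
  have [_ _ _ _ c2] := phi_C2 Dq.
  have hc : (fun x => (eps *+ (i == j)) - partial i (partial j phi) x) @ q -->
      (eps *+ (i == j)) - partial i (partial j phi) q.
    exact: (cvgB (cvg_cst _) (c2 i j)).
  have hf : (fun x => (hess x) i j) = (fun x => (eps *+ (i == j)) - partial i (partial j phi) x).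
    by apply/funext => x; exact: hE.
  by rewrite hf (hE q).
have cd := cvg_det (nbhs_filter q) ch.
exact: (cvgM (@g_cont q) cd).
Qed.

Let mg : measurable_fun setT (g \o argmax).
Proof.
apply: (measurableT_comp (continuous_measurable_rV g_cont)).
exact: measurable_argmax.
Qed.

Let mw : measurable_fun setT w.
Proof. exact: (continuous_measurable_rV continuous_g_det). Qed.

Let cubeK : K `<=` cube (const_mx (-1)) 3.
Proof.
move=> x /chart_closure_norm xb i; have := le_trans (coord_le_norm x i) xb.
by rewrite !mxE ler_norml => /andP[h1 h2]; apply/andP; split; lra.
Qed.

Let intN (S : set 'rV[R]_m) := (\int[vol]_(y in argmax @^-1` S) (g (argmax y))%:E)%E.
Let intW (S : set 'rV[R]_m) := (\int[vol]_(q in S) (w q)%:E)%E.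

Let mpre (S : set 'rV[R]_m) : measurable S -> measurable (argmax @^-1` S).
Proof. by move=> mS; rewrite -[X in measurable X]setTI; apply: measurable_argmax. Qed.

Let intN_fin S : measurable S -> intN S \is a fin_num.
Proof.
move=> mS.
have g0 x : (0 <= (g (argmax x))%:E)%E by rewrite lee_fin.
rewrite ge0_fin_numE; last exact: integral_ge0.
have [M M0 gM] := chart_closure_bounded_above g_cont.
pose U := [set y : 'rV[R]_m | `|y| <= `|B| + 1].
have mU : measurable U by exact: measurable_norm_le.
have b0 : 0 < `|B| + 1 by rewrite ltr_wpDl.
have Uoo : (vol U < +oo)%E.
  by rewrite -ge0_fin_numE; [exact: (ball_volume_fin (ltW b0) mU)|exact: measure_ge0].
apply: (@le_lt_trans _ _ (\int[vol]_y (g (argmax y))%:E)%E).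
  by apply: ge0_subset_integral => //; [exact: mpre|exact/measurable_EFinP].
have -> : (\int[vol]_y (g (argmax y))%:E = \int[vol]_(y in U) (g (argmax y))%:E)%E.
  rewrite [RHS]integral_mkcond; apply: eq_integral => y _; rewrite patchE.
  case: ifPn => // /negP yU; congr EFin; apply: g_argmax_supp.
  rewrite ltNge; apply/negP => yB; apply: yU; apply/mem_set; rewrite /U/=.
  by rewrite (le_trans yB)// (le_trans (ler_norm _))// lerDl.
apply: le_lt_trans (ge0_integral_le_cst (hi := M) _ mU _ _ M0) _.
- exact: measurable_funTS.
- by move=> x _; rewrite g_ge0 gM//; exact: argmax_in.
- by rewrite lte_mul_pinfty.
Qed.

Let intW_fin S : measurable S -> intW S \is a fin_num.
Proof.
move=> mS.
have w0 x : (0 <= (w x)%:E)%E by rewrite lee_fin.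
rewrite ge0_fin_numE; last exact: integral_ge0.
have [M M0 wM] := chart_closure_bounded_above continuous_g_det.
have mK : measurable K by apply: closed_measurable_rV; exact: chart_closure_closed.
have Koo : (vol K < +oo)%E.
  rewrite -ge0_fin_numE; last exact: measure_ge0.
  by apply: (ball_volume_fin (b := 1)) => // x; exact: chart_closure_norm.
apply: (@le_lt_trans _ _ (\int[vol]_q (w q)%:E)%E).
  by apply: ge0_subset_integral => //; exact/measurable_EFinP.
have -> : (\int[vol]_q (w q)%:E = \int[vol]_(q in K) (w q)%:E)%E.
  rewrite [RHS]integral_mkcond; apply: eq_integral => y _; rewrite patchE.
  case: ifPn => // /negP yK; congr EFin; apply/w_eq0/g_off => Dy.
  by apply: yK; apply/mem_set; exact: chart_domain_sub.
apply: le_lt_trans (ge0_integral_le_cst (hi := M) _ mK _ _ M0) _.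
- exact: measurable_funTS.
- by move=> x Kx; rewrite w_ge0 wM.
- by rewrite lte_mul_pinfty.
Qed.

(* the two sides of the change of variables, localized to the set S of values
   of the maximizer *)
Let L S := fine (intN S) - fine (intW S).

Let L_additive S S' : measurable S -> measurable S' -> S `&` S' = set0 ->
  L (S `|` S') = L S + L S'.
Proof.
move=> mS mS' SS'; have dis : [disjoint S & S'] by apply/disj_setPS; rewrite SS'.
rewrite /L.
have -> : intN (S `|` S') = (intN S + intN S')%E.
  rewrite /intN preimage_setU ge0_integral_setU//; try exact: mpre.
  - by apply/measurable_EFinP; exact: measurable_funTS.
  - by move=> x _; rewrite lee_fin.
  - by apply/disj_setPS; rewrite -preimage_setI SS' preimage_set0.
have -> : intW (S `|` S') = (intW S + intW S')%E.
  rewrite /intW ge0_integral_setU//.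
  - by apply/measurable_EFinP; exact: measurable_funTS.
  - by move=> x _; rewrite lee_fin.
have hN := fineD (intN_fin mS) (intN_fin mS').
have hW := fineD (intW_fin mS) (intW_fin mS').
rewrite hN hW.
by move: (fine _) (fine _) (fine _) (fine _) => *; ring.
Qed.

(* Off D both integrands vanish near q.  On D both integrals are close to
   g q * det (hess q) * r ^ m: the first by argmax_density, the second by
   continuity of the integrand. *)
Let L_density q (c : R) : 0 < c -> exists2 d, 0 < d & forall (a : 'rV[R]_m) r, 0 < r -> r < d ->
    (forall i, a ord0 i <= q ord0 i <= a ord0 i + r) -> `|L (cube a r)| <= c * r ^+ m.
Proof.
move=> c0.
have near (a : 'rV[R]_m) r u : 0 < r -> (forall i, a ord0 i <= q ord0 i <= a ord0 i + r) ->
    cube a r u -> `|u - q| <= r.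
  move=> r0 aq au; apply: norm_le_coord; first exact: ltW.
  move=> i; have := aq i; have := au i; rewrite !mxE ler_norml.
  by move=> /andP[? ?] /andP[? ?]; apply/andP; split; lra.
have [Dq|/g_supp[d d0 gd]] := pselect (D q); last first.
  exists d => // a r r0 rd aq.
  have g0 u : cube a r u -> g u = 0.
    by move=> au; apply: gd; apply: le_lt_trans rd; exact: near au.
  rewrite /L /intN /intW !integral0_eq; first by rewrite subrr normr0 mulr_ge0 ?exprn_ge0// ltW.
    by move=> x /g0 wx; rewrite w_eq0.
  by move=> x /g0 ->.
pose e1 := c / 4; have e10 : 0 < e1 by rewrite divr_gt0.
pose dt := \det (hess q).
have dt0 : 0 < dt.
  by apply: posdef_det_gt0 => v v0; exact: (hess_posdef phi_concave phi_C2).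
pose e2 := c / (4 * (dt + 1)); have e20 : 0 < e2 by rewrite divr_gt0// mulr_gt0// ltr_wpDr.
pose e3 := Num.min 1 (c / (4 * (g q + 1))).
have g10 : 0 < g q + 1 by rewrite ltr_wpDl.
have e30 : 0 < e3 by rewrite lt_min ltr01/= divr_gt0// mulr_gt0.
have [d1 d10 d1P] := continuous_at_dist (@continuous_g_det q) e10.
have [d2 d20 d2P] := continuous_at_dist (@g_cont q) e20.
have [d3 d30 d3P] := argmax_density phi_cont phi_concave phi_C2 eps_gt0 Dq e30.
exists (Num.min d1 (Num.min d2 d3)); first by rewrite !lt_min d10 d20.
move=> a r r0; rewrite !lt_min => /and3P[rd1 rd2 rd3] aq.
have := d3P a r r0 rd3 aq; set V := vol _ => /andP[V1 V2].
have Vfin : V \is a fin_num.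
  rewrite ge0_fin_numE; last exact: measure_ge0.
  exact: le_lt_trans V2 (ltry _).
have VE : V = (fine V)%:E by rewrite fineK.
have rm0 : 0 < r ^+ m by rewrite exprn_gt0.
have V0 : 0 <= fine V by apply: fine_ge0; exact: measure_ge0.
move: V1 V2; rewrite VE !lee_fin => V1 V2.
have mc : measurable (cube a r) by exact: measurable_hbox.
have N1 : `|fine (intN (cube a r)) - g q * fine V| <= e2 * fine V.
  apply: fine_integral_near => //; [exact: mpre|exact: measurable_funTS| |exact: ltW].
  by move=> y /= ay; apply/ltW/d2P; apply: le_lt_trans rd2; exact: near ay.
have W1 : `|fine (intW (cube a r)) - w q * r ^+ m| <= e1 * r ^+ m.
  apply: fine_integral_near => //; [exact: lebesgue_rV_cube|exact: measurable_funTS| |exact: ltW].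
  by move=> y /= ay; apply/ltW/d1P; apply: le_lt_trans rd1; exact: near ay.
have e2V : e2 * fine V <= c / 4 * r ^+ m.
  have : e2 * fine V <= e2 * ((dt + 1) * r ^+ m).
    rewrite ler_pM2l// (le_trans V2)// ler_pM2r// lerD2l.
    by rewrite /e3 ge_min lexx.
  move=> /le_trans; apply; rewrite le_eqVlt; apply/orP; left; apply/eqP.
  by rewrite /e2; field; rewrite lt0r_neq0// ltr_wpDr.
have gV : `|g q * fine V - w q * r ^+ m| <= c / 4 * r ^+ m.
  rewrite /w -/dt -mulrA -mulrBr normrM ger0_norm//.
  have hV : `|fine V - dt * r ^+ m| <= e3 * r ^+ m.
    by rewrite ler_norml -/dt in V1 V2 *; apply/andP; split; lra.
  rewrite (le_trans (ler_wpM2l (g_ge0 q) hV))// mulrA ler_pM2r//.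
  rewrite (@le_trans _ _ ((g q + 1) * (c / (4 * (g q + 1)))))//.
    by apply: ler_pM => //; [exact: ltW|rewrite lerDl|rewrite /e3 ge_min lexx orbT].
  by rewrite le_eqVlt; apply/orP; left; apply/eqP; field; rewrite lt0r_neq0.
rewrite /L; move: N1 W1 gV; rewrite !ler_norml /e1.
have c4 : 0 < c * r ^+ m by rewrite mulr_gt0.
move: (fine _) (fine _) (fine V) e2V => n' w' v e2V /andP[? ?] /andP[? ?] /andP[? ?].
by apply/andP; split; lra.
Qed.

Theorem argmax_change_of_variables :
  (\int[vol]_y (g (argmax y))%:E = \int[vol]_q (g q * \det (hess q))%:E)%E.
Proof.
have N_all : (\int[vol]_y (g (argmax y))%:E)%E = intN (cube (const_mx (-1)) 3).
  rewrite /intN; congr (integral _ _ _); apply/seteqP; split=> // y _ /=.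
  by apply: cubeK; exact: argmax_in.
have W_all : (\int[vol]_q (g q * \det (hess q))%:E)%E = intW (cube (const_mx (-1)) 3).
  rewrite /intW [RHS]integral_mkcond; apply: eq_integral => q _; rewrite patchE.
  case: ifPn => // /negP qC; congr EFin; rewrite g_off ?mul0r// => Dq.
  by apply: qC; apply/mem_set; apply: cubeK; exact: chart_domain_sub.
have mc : measurable (cube (const_mx (-1) : 'rV[R]_m) 3) by exact: measurable_hbox.
have /eqP := @cube_density0 R m L L_additive L_density (const_mx (-1)) 3 (ltr0Sn R 2).
rewrite /L subr_eq0 => /eqP LE.
by rewrite N_all W_all -[LHS]fineK ?intN_fin// LE fineK// intW_fin.
Qed.

End change_of_variables.

(** * The Legendre transform and the chart *)

Section legendre.
Context {R : realType} {m : nat}.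
Local Notation K := (chart_closure R m).
Implicit Types (f : 'rV[R]_m -> R) (y q : 'rV[R]_m).

(** The maximum of f q + <q, y> over the closed region, that is the conjugate
    of the convex function - f + indicator of K. *)
Definition legendre f y := pot f 0 y (argmax f 0 y).

Lemma pot0 f y q : pot f 0 y q = f q + pairing q y.
Proof. by rewrite /pot mul0r mul0r subr0. Qed.

Lemma legendre_ge f y q : continuous f -> K q -> f q + pairing q y <= legendre f y.
Proof. by move=> cf Kq; rewrite -pot0; exact: argmax_max. Qed.

Lemma legendre_attained f y : continuous f ->
  exists2 q, K q & legendre f y = f q + pairing q y.
Proof. by move=> cf; exists (argmax f 0 y); [exact: argmax_in|rewrite /legendre pot0]. Qed.

(** A maximum of functions of y that are Lipschitz with constant m. *)
Lemma legendre_lipschitz f y y' : continuous f -> legendre f y <= legendre f y' + m%:R * `|y - y'|.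
Proof.
move=> cf; have [q Kq ->] := legendre_attained y cf.
have := legendre_ge y' cf Kq.
have := norm_pairing_le q (y - y'); rewrite ler_norml pairingBr => /andP[_ h].
have : m%:R * (`|q| * `|y - y'|) <= m%:R * `|y - y'|.
  by rewrite ler_wpM2l// ler_piMl// chart_closure_norm.
lra.
Qed.

Lemma continuous_legendre f : continuous f -> continuous (legendre f).
Proof.
move=> cf y; apply: dist_continuous_at => c c0.
have m0 : (0 : R) < m%:R + 1 by rewrite ltr_wpDl.
exists (c / (m%:R + 1)); first exact: divr_gt0.
move=> x; rewrite ltr_pdivlMr// => xc.
have xc' : m%:R * `|x - y| < c.
  by apply: le_lt_trans xc; rewrite mulrC ler_wpM2l// lerDl.
have h1 := legendre_lipschitz x y cf; have h2 := legendre_lipschitz y x cf.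
by move: h2; rewrite distrC ltr_norml => h2; apply/andP; split; lra.
Qed.

Lemma legendre_le f f' y : continuous f -> continuous f' -> (forall q, K q -> f q <= f' q) ->
  legendre f y <= legendre f' y.
Proof.
move=> cf cf' ff'; have [q Kq ->] := legendre_attained y cf.
by apply: le_trans (legendre_ge y cf' Kq); rewrite lerD2r ff'.
Qed.

End legendre.

Section chart_theory.
Context {R : realType} {m : nat}.
Hypothesis m_gt0 : (0 < m)%N.
Implicit Types (q y u : 'rV[R]_m) (p x : 'rV[R]_m.+1).
Local Notation K := (chart_closure R m).
Local Notation D := (chart_domain R m.+1 : set 'rV[R]_m).
Local Notation chart := (@chart R m.+1).

Lemma chartE q : chart q = rV_rcons q (1 - \sum_j q ord0 j).
Proof. by apply/rowP => i; rewrite !mxE. Qed.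

Lemma pairing_rcons q s y t :
  pairing (rV_rcons q s) (rV_rcons y t) = pairing q y + s * t.
Proof.
rewrite /pairing big_ord_recr /= !rV_rcons_max; congr (_ + _).
by apply: eq_bigr => i _; rewrite !rV_rcons_widen.
Qed.

Lemma pairing_chart_slice q y t :
  pairing (chart q) (diag_slice (y, t)) = t - pairing q y.
Proof.
rewrite chartE /diag_slice pairing_rcons /= pairingBr.
have -> : pairing q (const_mx t) = (\sum_j q ord0 j) * t.
  by rewrite mulr_suml; apply: eq_bigr => i _; rewrite mxE.
by ring.
Qed.

Lemma simplex_chart q : simplex R m.+1 (chart q) <-> D q.
Proof.
rewrite chart_domainP// chartE; split.
  move=> [+ _] => /(@forall_rV_rcons R m (fun _ z => is_true (0 < z < 1)))[h1 /andP[h2 _]].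
  by split; [move=> i; case/andP: (h1 i)|lra].
move=> [q0 q1]; split; last first.
  rewrite big_ord_recr /= rV_rcons_max (eq_bigr (fun i => q ord0 i)) => [|i _].
    by rewrite subrKC.
  by rewrite rV_rcons_widen.
have s0 : 0 < \sum_j q ord0 j.
  rewrite (bigD1 (Ordinal m_gt0))//= ltr_wpDr//; apply: sumr_ge0 => i _; exact: ltW.
apply/(@forall_rV_rcons R m (fun _ z => is_true (0 < z < 1))); split=> [i|]; last first.
  by apply/andP; split; lra.
rewrite q0/= (le_lt_trans _ q1)// (bigD1 i)//= lerDl.
by apply: sumr_ge0 => j _; exact/ltW.
Qed.

Definition chart_coords p : 'rV[R]_m := \row_j p ord0 (widen_ord (leqnSn m) j).

Lemma chart_coordsK p : \sum_i p ord0 i = 1 -> chart (chart_coords p) = p.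
Proof.
move=> p1; have sE : 1 - \sum_j chart_coords p ord0 j = p ord0 ord_max.
  rewrite -p1 big_ord_recr /= addrAC (eq_bigr (fun j => chart_coords p ord0 j)) ?subrr ?add0r//.
  by move=> j _; rewrite [RHS]mxE.
rewrite chartE sE; apply/rowP => i.
have [im|mi] := ltnP i m.
  have -> : i = widen_ord (leqnSn m) (Ordinal im) by exact/val_inj.
  by rewrite rV_rcons_widen [LHS]mxE.
have -> : i = ord_max by apply/val_inj/eqP; rewrite eqn_leq mi -ltnS ltn_ord.
by rewrite rV_rcons_max.
Qed.

Lemma simplexP p : simplex R m.+1 p -> exists2 q, D q & p = chart q.
Proof.
move=> sp; have [_ p1] := sp; exists (chart_coords p); last by rewrite chart_coordsK.
by apply/simplex_chart; rewrite chart_coordsK.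
Qed.

Lemma continuous_rV n k (F : 'rV[R]_n -> 'rV[R]_k) (q : 'rV[R]_n) :
  (forall i, {for q, continuous (fun x : 'rV[R]_n => F x ord0 i)}) ->
  forall c, 0 < c -> exists2 d, 0 < d &
    forall x : 'rV[R]_n, `|x - q| < d -> `|F x - F q| < c.
Proof.
move=> cF c c0; have [i d d' /andP[d'0 dd'] dP x xq|i|d d0 dP] :=
    @fin_radius R k (fun i d => forall x : 'rV[R]_n, `|x - q| < d -> `|F x ord0 i - F q ord0 i| < c).
- by apply: dP; exact: lt_le_trans dd'.
- exact: continuous_at_dist.
exists d => // x xq; apply: norm_lt_coord => // i; rewrite !mxE; exact: dP.
Qed.

Lemma continuous_chart_coord i : continuous (fun q => chart q ord0 i).
Proof.
have [im|mi] := ltnP i m.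
  have -> : i = widen_ord (leqnSn m) (Ordinal im) by exact/val_inj.
  under eq_fun do rewrite chartE rV_rcons_widen.
  exact: coord_continuous.
have -> : i = ord_max by apply/val_inj/eqP; rewrite eqn_leq mi -ltnS ltn_ord.
have -> : (fun q => chart q ord0 ord_max) = (fun=> 1) \- (fun q => \sum_j q ord0 j).
  by apply/funext => q; rewrite chartE rV_rcons_max.
by move=> q; apply: continuousB; [exact: cst_continuous|exact: continuous_sum_coord].
Qed.

Lemma continuous_chart q : forall c, 0 < c ->
  exists2 d, 0 < d & forall u, `|u - q| < d -> `|chart u - chart q| < c.
Proof.
by apply: (@continuous_rV _ _ chart q) => i; exact: (@continuous_chart_coord i q).
Qed.

(** Points of K are approximated from D by moving towards the barycentre. *)
Lemma csimplex_chart q : K q -> csimplex R m.+1 (chart q).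
Proof.
move=> [q0 q1] U /nbhs_ballP[e /= e0 eU].
have [d d0 dP] := continuous_chart q e0.
pose n1 : R := m.+1%:R; have n10 : 0 < n1 by rewrite ltr0n.
pose b : 'rV[R]_m := const_mx n1^-1.
pose t := Num.min (d / 4) (1 / 2).
have t0 : 0 < t by rewrite lt_min; apply/andP; split; lra.
have t12 : t <= 1 / 2 by rewrite ge_min lexx orbT.
have td : t <= d / 4 by rewrite ge_min lexx.
pose x := t *: b + (1 - t) *: q.
have bn : `|b| <= 1.
  apply: norm_le_coord => // i; rewrite mxE ger0_norm ?invr_ge0 ?(ltW n10)//.
  by rewrite invf_le1// ler1n.
have Dx : D x.
  apply/chart_domainP => //; split=> [i|].
    rewrite !mxE ltr_pwDl// ?mulr_gt0 ?invr_gt0// mulr_ge0//; lra.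
  under eq_bigr do rewrite !mxE.
  rewrite big_split/= -!mulr_sumr sumr_const card_ord.
  have b1 : n1^-1 *+ m < 1.
    by rewrite -mulr_natr mulrC ltr_pdivrMr// mul1r ltr_nat.
  have h1 : t * (n1^-1 *+ m) < t by rewrite -[ltRHS]mulr1 ltr_pM2l.
  have h2 : (1 - t) * (\sum_i q ord0 i) <= 1 - t.
    rewrite -[leRHS]mulr1 ler_wpM2l//; lra.
  by apply: (@lt_le_trans _ _ (t + (1 - t))); [exact: ltr_leD|lra].
exists (chart x); split; first exact/simplex_chart.
apply: eU; rewrite mx_norm_ball /= distrC; apply: dP.
have -> : x - q = t *: (b - q).
  by rewrite /x; apply/rowP => i; rewrite !mxE; ring.
rewrite normrZ gtr0_norm//.
have qn : `|q| <= 1 by exact: chart_closure_norm.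
have bq : `|b - q| <= 2 by rewrite (le_trans (ler_normB _ _))//; lra.
apply: (@le_lt_trans _ _ (d / 4 * 2)); last lra.
by apply: ler_pM => //; exact: ltW.
Qed.

Lemma csimplex_sum1 p : (forall i, 0 <= p ord0 i) -> \sum_i p ord0 i = 1 ->
  csimplex R m.+1 p.
Proof.
move=> p0 p1; rewrite -(chart_coordsK p1); apply: csimplex_chart.
split=> [i|]; first by rewrite mxE.
rewrite -p1 big_ord_recr /= -[leLHS]addr0 lerD// le_eqVlt; apply/orP; left.
by apply/eqP; apply: eq_bigr => j _; rewrite mxE.
Qed.

End chart_theory.

(** * Slices of the survival region *)

Section survival_region.
Context {R : realType} {m : nat}.
Hypothesis m_gt0 : (0 < m)%N.
Variable psi : Cspace R m.+1.
Hypothesis psi_bd : forall p, (csimplex R m.+1 `\` simplex R m.+1) p -> psi p = 0.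
Implicit Types (q y u : 'rV[R]_m) (p x : 'rV[R]_m.+1).
Local Notation K := (chart_closure R m).
Local Notation D := (chart_domain R m.+1 : set 'rV[R]_m).
Local Notation chart := (@chart R m.+1).
Local Notation lam := (@lebesgue_measure R).
Local Notation phi := (psi \o chart).

Lemma Cspace_ge0 p : 0 <= psi p.
Proof.
have [_ _ psi0 psiz] := CfunP psi.
by have [/psi0//|/psiz ->] := pselect (csimplex R m.+1 p).
Qed.

Lemma Cspace_continuous_at p : csimplex R m.+1 p -> forall c, 0 < c ->
  exists2 d, 0 < d & forall x, csimplex R m.+1 x -> `|x - p| < d -> `|psi x - psi p| < c.
Proof.
move=> cp c c0; have [/subspace_continuousP/(_ p cp)/cvgrPdist_lt/(_ c c0) + _ _ _] := CfunP psi.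
move=> /nbhs_ballP[d /= d0 dP]; exists d => // x cx xp.
by rewrite distrC; apply: dP => //; rewrite mx_norm_ball /= distrC.
Qed.

Lemma phi_ge0 q : 0 <= phi q. Proof. exact: Cspace_ge0. Qed.

(** Off the closed simplex this holds by the convention on Cspace, and on its
    relative boundary by the boundary condition. *)
Lemma phi_off q : ~ D q -> phi q = 0.
Proof.
move=> nDq; have [_ _ _ psiz] := CfunP psi.
have [cq|/psiz//] := pselect (csimplex R m.+1 (chart q)).
by apply: psi_bd; split=> // /(simplex_chart m_gt0).
Qed.

Lemma phi_continuous : continuous phi.
Proof.
move=> q; apply: dist_continuous_at => c c0.
have [Kq|nKq] := pselect (K q); last first.
  have [d d0 dP] := open_radius (closed_openC chart_closure_closed) nKq.
  exists d => // x xq; rewrite !phi_off ?subrr ?normr0//.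
    by move/chart_domain_sub.
  by move=> Dx; apply: (dP x xq); exact: chart_domain_sub.
have [e e0 eP] := Cspace_continuous_at (csimplex_chart m_gt0 Kq) c0.
have [d d0 dP] := continuous_chart q e0.
have near (x : 'rV[R]_m) : K x -> `|x - q| < d -> `|phi x - phi q| < c.
  by move=> Kx xq; apply: eP; [exact: csimplex_chart|exact: dP].
have [Dq|nDq] := pselect (D q).
  have [r r0 rD] := open_radius chart_domain_open Dq.
  exists (Num.min d r); first by rewrite lt_min d0.
  by move=> x; rewrite lt_min => /andP[xd xr]; apply: near => //; exact/chart_domain_sub/rD.
exists d => // x xd; have [Kx|nKx] := pselect (K x); first exact: near.
rewrite !phi_off ?subrr ?normr0// => Dx.
by apply: nKx; exact: chart_domain_sub.
Qed.

Lemma phi_concave : concave_on K phi.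
Proof.
move=> q u t Kq Ku t01; have [_ conc _ _] := CfunP psi.
have := conc _ _ _ (csimplex_chart m_gt0 Kq) (csimplex_chart m_gt0 Ku) t01.
have -> : t *: chart q + (1 - t) *: chart u = chart (t *: q + (1 - t) *: u).
  apply/rowP => i; rewrite !mxE.
  case: (insub (i : nat)) => [j|] /=; first by rewrite !mxE.
  under [in RHS]eq_bigr do rewrite !mxE.
  by rewrite big_split/= -!mulr_sumr; ring.
by [].
Qed.

Lemma RhatE x : Rhat psi x <->
  orthant R m.+1 x /\ exists2 q, D q & pairing (chart q) x < phi q.
Proof.
split=> [[p /(simplexP m_gt0)[q Dq ->]] [ox px]|[ox [q Dq qx]]].
  by split=> //; exists q.
by exists (chart q); [exact/simplex_chart|split].
Qed.

Lemma Rhat_open : open (Rhat psi).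
Proof.
apply: bigcup_open => p _; rewrite /halfspace.
have -> : [set x | orthant R m.+1 x /\ pairing p x < psi p] =
    orthant R m.+1 `&` (pairing p @^-1` [set t | t < psi p]) by [].
apply: openI; last first.
  apply: open_comp; last exact: open_lt.
  have -> : pairing p = (fun z : 'rV[R]_m.+1 => pairing z p).
    by apply/funext => z; exact: pairingC.
  by move=> x _; exact: continuous_pairingl.
have -> : orthant R m.+1 = \big[setI/setT]_(i <- enum 'I_m.+1)
    ((fun x : 'rV[R]_m.+1 => x ord0 i) @^-1` [set t | 0 < t]).
  rewrite -bigcap_seq; apply/seteqP; split=> x /= ox i; first by move=> _; exact: ox.
  by apply: ox => /=; rewrite mem_enum.
elim/big_ind : _ => [|? ?|i _]; [exact: openT|exact: openI|].
apply: open_comp; last exact: open_gt.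
by move=> ? _; exact: coord_continuous.
Qed.

(** The support function of K; the fibre of the orthant over y is the half line
    above its value. *)
Definition support_fun y : R := legendre (fun=> 0) y.

(** K has the vertices 0 and the unit vectors. *)
Lemma support_fun_lt y (t : R) : support_fun y < t <-> 0 < t /\ forall i, y ord0 i < t.
Proof.
have c0 : continuous (fun _ : 'rV[R]_m => 0 : R) by exact: cst_continuous.
split=> [st|[t0 yt]].
  split=> [|i].
    apply: le_lt_trans st; have := legendre_ge y c0 chart_closure0.
    by rewrite pairing0l addr0.
  apply: le_lt_trans st.
  by have := legendre_ge y c0 (chart_closure_delta i); rewrite add0r pairing_delta.
rewrite /support_fun; have [q [q0 q1] ->] := legendre_attained y c0; rewrite add0r.
have : 0 < \sum_i q ord0 i * (t - y ord0 i) + (1 - \sum_i q ord0 i) * t.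
  have s0 : 0 <= \sum_i q ord0 i * (t - y ord0 i).
    by apply: sumr_ge0 => i _; rewrite mulr_ge0// subr_ge0 ltW.
  move: q1; rewrite le_eqVlt => /predU1P[q1|q1]; last first.
    by rewrite ltr_wpDl// mulr_gt0// subr_gt0.
  rewrite q1 subrr mul0r addr0 lt_neqAle s0 andbT eq_sym psumr_neq0; last first.
    by move=> i _; rewrite mulr_ge0// subr_ge0 ltW.
  have [i qi] : exists i, 0 < q ord0 i.
    apply: contrapT => nq; move: q1; rewrite big1 => [/eqP|i _].
      by rewrite eq_sym oner_eq0.
    apply/eqP; rewrite eq_le q0 andbT leNgt; apply/negP => qi; apply: nq; by exists i.
  by apply/hasP; exists i; rewrite ?mem_index_enum//= mulr_gt0// subr_gt0.
under eq_bigr do rewrite mulrBr.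
rewrite sumrB -mulr_suml -/(pairing q y); lra.
Qed.

(** The fibre is cut out by max_i (y_i, 0) < t and t < phi q + <q, y> for some q
    in D.  A maximizer of phi q + <q, y> outside D would have phi q = 0, which
    makes the interval empty. *)
Lemma Rhat_slice y : [set t | Rhat psi (diag_slice (y, t))] = `]support_fun y, legendre phi y[%classic.
Proof.
apply/seteqP; split=> t /=; rewrite in_itv/=.
  move=> /RhatE[ox [q Dq]]; rewrite pairing_chart_slice ltrBlDr => tq.
  apply/andP; split.
    apply/support_fun_lt; move: ox => /(@forall_rV_rcons R m (fun _ z => is_true (0 < z)))[/= h1 h2].
    by split=> // i; have := h1 i; rewrite !mxE subr_gt0.
  apply: lt_le_trans tq _; apply: legendre_ge; first exact: phi_continuous.
  exact: chart_domain_sub.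
move=> /andP[st tc]; have /support_fun_lt[t0 yt] := st.
apply/RhatE; split.
  apply/(@forall_rV_rcons R m (fun _ z => is_true (0 < z))); split=> //= i.
  by rewrite !mxE subr_gt0.
have [q Kq qE] := legendre_attained y phi_continuous.
exists q; last by rewrite pairing_chart_slice ltrBlDr -qE.
apply: contrapT => nDq; move: tc; rewrite qE phi_off// => tq.
have := legendre_ge y (@cst_continuous _ _ (0 : R)) Kq.
by move: st; rewrite /support_fun => h1 h2; have := lt_trans (le_lt_trans h2 h1) tq; rewrite ltxx.
Qed.

Lemma support_fun_le_legendre y : support_fun y <= legendre phi y.
Proof.
apply: legendre_le => [||q _]; [exact: cst_continuous|exact: phi_continuous|exact: phi_ge0].
Qed.

Lemma lebesgue_Rhat : lebesgue_rV R m.+1 (Rhat psi) =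
  (\int[lebesgue_rV R m]_y (legendre phi y - support_fun y)%:E)%E.
Proof.
rewrite lebesgue_rV_diag_slice; last by apply: open_measurable_rV; exact: Rhat_open.
apply: eq_integral => y _; rewrite Rhat_slice lebesgue_measure_itv/= lte_fin.
case: ifPn => [_|]; first by rewrite EFinB.
rewrite -leNgt => h; congr EFin; apply/esym/eqP; rewrite subr_eq0 eq_le h.
exact: support_fun_le_legendre.
Qed.

End survival_region.

Section scaling.
Context {R : realType} {n : nat}.

Lemma lebesgue_rV_scale (s : R) (A : set 'rV[R]_n) : 0 < s -> measurable A ->
  lebesgue_rV R n A = ((s ^+ n)%:E * lebesgue_rV R n [set v | A (s *: v)])%E.
Proof.
move=> s0 mA; have sM : scales_lebesgue (s%:M : 'M[R]_n).
  apply: scales_lebesgue_definite => v v0.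
  by rewrite mulmx_tr_pairing mul_mx_scalar pairingZl mulf_neq0 ?lt0r_neq0// pairing_gt0.
rewrite (sM A mA) det_scalar ger0_norm ?exprn_ge0 ?ltW//.
by under eq_set do rewrite mul_mx_scalar.
Qed.

(** Rhat is homogeneous of degree one in psi. *)
Lemma Rhat_scale (psi : Cspace R n) (s : R) (s0 : 0 < s) x :
  Rhat (Cscale (ltW s0) psi) (s *: x) <-> Rhat psi x.
Proof.
split=> -[p sp [ox px]]; exists p => //; split.
- by move=> i; have := ox i; rewrite mxE pmulr_rgt0.
- by move: px; rewrite pairingZr ltr_pM2l.
- by move=> i; rewrite mxE mulr_gt0.
- by rewrite pairingZr ltr_pM2l.
Qed.

End scaling.

(** * From the change of variables to the determinant integral *)

Section det_bound.
Context {R : realType} {m : nat}.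

Lemma det_bounded (M : R) : exists2 C, 0 <= C &
  forall A : 'M[R]_m, (forall i j, `|A i j| <= M) -> `|\det A| <= C.
Proof.
pose C : R := \sum_(s : 'S_m) `|M| ^+ m.
exists C; first by apply: sumr_ge0 => s _; rewrite exprn_ge0.
move=> A AM; rewrite (le_trans (ler_norm_sum _ _ _))//; apply: ler_sum => s _.
rewrite normrM normrX normrN1 expr1n mul1r normr_prod.
rewrite -[X in _ <= _ ^+ X](card_ord m) -prodr_const; apply: ler_prod => i _.
by rewrite normr_ge0/= (le_trans (AM _ _))// ler_norm.
Qed.

End det_bound.

Lemma ler_cvg_oo {R : realType} (f g : nat -> R) (l l' : R) :
  f @ \oo --> l -> g @ \oo --> l' -> (forall k, f k <= g k) -> l <= l'.
Proof.
move=> fl gl fg; rewrite -subr_ge0; apply: (cvgr_to_ge (cvgB gl fl)).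
by apply: nearW => k /=; rewrite subr_ge0.
Qed.

(** In this section V stands for the volume of Rhat psi and n for the dimension
    m + 1.  legendre_scale_integral is the homogeneity of the volume, written as
    an integral over a ball of radius B that suits all c psi with c <= 2. *)
Section volume_limit.
Context {R : realType} {m : nat}.
Variable (phi : 'rV[R]_m -> R).
Implicit Types (y q u : 'rV[R]_m).
Local Notation K := (chart_closure R m).
Local Notation D := (chart_domain R m.+1 : set 'rV[R]_m).
Local Notation vol := (lebesgue_rV R m).
Hypothesis phi_cont : continuous phi.
Hypothesis phi_conc : concave_on K phi.
Hypothesis phi_ge0 : forall q, 0 <= phi q.
Hypothesis phi_off : forall q, ~ D q -> phi q = 0.
Hypothesis phi_C2 : C2_on D phi.

Variables (n : nat) (B V : R).
Hypothesis B_ge0 : 0 <= B.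
Local Notation Y := [set y : 'rV[R]_m | `|y| <= B].
Hypothesis legendre_scale_integral : forall s, 0 < s <= 2 ->
  (\int[vol]_(y in Y) (legendre (fun q => s * phi q) y - support_fun y)%:E = (s ^+ n * V)%:E)%E.
Hypothesis argmax_far : forall eps, 0 < eps <= 1 -> forall y, B < `|y| ->
  phi (argmax phi eps y) = 0.

Let w eps q := \det (eps%:M - hessian phi q).

Let det_gt0 eps q : 0 < eps -> D q -> 0 < w eps q.
Proof.
by move=> e0 Dq; apply: posdef_det_gt0 => v v0; exact: (hess_posdef phi_conc phi_C2).
Qed.

Let cvg_det_eps q : w k.+1%:R^-1 q @[k --> \oo] --> w 0 q.
Proof.
apply: (@cvg_det R m nat \oo _ (fun k => (k.+1%:R^-1)%:M - hessian phi q)) => i j.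
have hE (e : R) : (e%:M - hessian phi q) i j = e *+ (i == j) - hessian phi q i j.
  by rewrite 3!mxE.
rewrite hE (_ : (fun k : nat => _) = fun k => (k.+1%:R^-1 : R) *+ (i == j) - hessian phi q i j).
  apply: cvgB; last exact: cvg_cst.
  by case: (i == j); [rewrite !mulr1n; exact: cvg_harmonic|rewrite !mulr0n; exact: cvg_cst].
by apply/funext => k; rewrite hE.
Qed.

Lemma det_hessian_ge0 q : D q -> 0 <= w 0 q.
Proof.
move=> Dq; have c := @cvg_det_eps q.
rewrite -(cvg_lim _ c)//; apply: limr_ge; first by apply/cvg_ex; exists (w 0 q).
by apply: nearW => k; apply/ltW/det_gt0.
Qed.

(** Vanishes near the boundary of D, so it may serve as the integrand of the
    change of variables. *)
Definition trunc (eta : R) q : R := Num.max (phi q - eta) 0.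

Section fixed_eta.
Variable eta : R.
Hypothesis eta_gt0 : 0 < eta.
Local Notation g := (trunc eta).

Let g_cont : continuous g.
Proof.
move=> q; apply: (@continuous_max _ _ (fun q => phi q - eta) (fun=> 0)).
  by apply: continuousB; [exact: phi_cont|exact: cst_continuous].
exact: cst_continuous.
Qed.

Let g_ge0 q : 0 <= g q. Proof. by rewrite /trunc le_max lexx orbT. Qed.

Let g_eq0 q : phi q <= eta -> g q = 0.
Proof. by move=> h; rewrite /trunc max_r// subr_le0. Qed.

Let g_le q : g q <= phi q.
Proof. by rewrite /trunc ge_max phi_ge0 andbT lerBlDr lerDl ltW. Qed.

Let g_ge q : phi q - eta <= g q.
Proof. by rewrite /trunc le_max lexx. Qed.

Let g_supp q : ~ D q -> exists2 d, 0 < d & forall x, `|x - q| < d -> g x = 0.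
Proof.
move=> nDq; have [d d0 dP] := continuous_at_dist (@phi_cont q) eta_gt0.
exists d => // x xq; apply: g_eq0; have := dP x xq.
by rewrite (phi_off nDq) subr0 ger0_norm// => /ltW.
Qed.

Let g_far eps : 0 < eps <= 1 -> forall y, B < `|y| -> g (argmax phi eps y) = 0.
Proof. by move=> e01 y /(argmax_far e01) h; apply: g_eq0; rewrite h ltW. Qed.

Let mY : measurable (Y : set 'rV[R]_m).
Proof. exact: measurable_norm_le. Qed.

Let vY := fine (vol Y).
Let vYE : vol Y = vY%:E.
Proof. by rewrite /vY fineK//; apply: (ball_volume_fin B_ge0 mY). Qed.
Let I eps := (\int[vol]_q (g q * w eps q)%:E)%E.

Let IE eps : 0 < eps <= 1 -> I eps = (\int[vol]_(y in Y) (g (argmax phi eps y))%:E)%E.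
Proof.
move=> e01; have /andP[e0 _] := e01.
rewrite /I -(argmax_change_of_variables phi_cont phi_conc phi_C2 e0 g_cont g_ge0 g_supp (g_far e01)).
rewrite [RHS]integral_mkcond; apply: eq_integral => y _; rewrite patchE.
case: ifPn => // /negP yY; congr EFin; apply: (g_far e01).
by rewrite ltNge; apply/negP => yB; apply: yY; exact/mem_set.
Qed.

Let m_argmax eps : 0 < eps -> measurable_fun Y (fun y => g (argmax phi eps y)).
Proof.
move=> e0; apply: measurable_funTS.
apply: (measurableT_comp (continuous_measurable_rV g_cont)).
exact: measurable_argmax.
Qed.

Let I_fin eps : 0 < eps <= 1 -> I eps \is a fin_num.
Proof.
move=> e01; have /andP[e0 _] := e01; rewrite IE//.
have [M M0 gM] := chart_closure_bounded_above g_cont.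
rewrite ge0_fin_numE; last by apply: integral_ge0 => y _; rewrite lee_fin.
apply: le_lt_trans (ge0_integral_le_cst (hi := M) vol mY (m_argmax e0) _ M0) _.
  by move=> y _; rewrite g_ge0 gM//; exact: argmax_in.
have Yoo : (vol Y < +oo)%E by rewrite vYE ltry.
by rewrite lte_mul_pinfty.
Qed.

Let sphi_cont s : continuous (fun q => s * phi q).
Proof.
by move=> q; apply: (@continuousM _ _ (fun=> s)); [exact: cst_continuous|exact: phi_cont].
Qed.

(* Evaluate s phi + <., y> at the maximizer u of the perturbed potential; the
   perturbation costs at most eps / 2 |q|^2 <= eps m on K.  For s > 1 and s < 1
   this bounds the same increment from the two sides. *)
Let legendre_argmax eps s y : 0 < eps -> 0 < s ->
  legendre phi y + (s - 1) * phi (argmax phi eps y) <=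
  legendre (fun q => s * phi q) y + eps * m%:R.
Proof.
move=> e0 s0; set u := argmax phi eps y.
have Ku : K u by exact: argmax_in.
have h1 := legendre_ge y (@sphi_cont s) Ku.
have [v Kv ->] := legendre_attained y phi_cont.
have h2 := argmax_max eps phi_cont y Kv.
have h3 : pairing v v <= m%:R.
  have := norm_pairing_le v v; rewrite ger0_norm ?pairing_ge0// => /le_trans; apply.
  rewrite -[leRHS]mulr1 ler_wpM2l// -[leRHS]mulr1.
  by apply: ler_pM => //; exact: chart_closure_norm.
have h4 : eps / 2 * pairing v v <= eps * m%:R.
  rewrite (@le_trans _ _ (eps / 2 * m%:R))//; first by rewrite ler_wpM2l// ltW ?divr_gt0.
  by rewrite ler_wpM2r//; lra.
have h5 : 0 <= eps / 2 * pairing u u by rewrite mulr_ge0 ?pairing_ge0// ltW ?divr_gt0.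
by move: h2; rewrite /pot -/u; lra.
Qed.

Let m_legendre s : measurable_fun Y (fun y => legendre (fun q => s * phi q) y - support_fun y).
Proof.
apply: measurable_funTS; apply: measurable_funB; apply: continuous_measurable_rV.
  exact: (continuous_legendre (@sphi_cont s)).
by apply: continuous_legendre; exact: cst_continuous.
Qed.

Let legendre_support_ge0 s y : 0 < s -> 0 <= legendre (fun q => s * phi q) y - support_fun y.
Proof.
move=> s0; rewrite subr_ge0; apply: legendre_le => [||q _]; [exact: cst_continuous|exact: sphi_cont|].
by rewrite mulr_ge0// ltW.
Qed.

Let legendre1 y : legendre (fun q => 1 * phi q) y = legendre phi y.
Proof. by congr (legendre _ y); apply/funext => q; rewrite mul1r. Qed.

Let int_cst (c : R) : (\int[vol]_(y in Y) c%:E = (c * vY)%:E)%E.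
Proof.
transitivity (c%:E * vol Y)%E; last by rewrite vYE EFinM.
exact: integral_cst.
Qed.

(** The integral of legendre_argmax over the ball, with phi >= trunc eta. *)
Lemma volume_ge eps s : 0 < eps <= 1 -> 1 <= s <= 2 ->
  V + (s - 1) * fine (I eps) <= s ^+ n * V + eps * m%:R * vY.
Proof.
move=> e01 /andP[s1 s2]; have /andP[e0 _] := e01.
have s0 : 0 < s by lra.
have s10 : 0 <= s - 1 by lra.
have := @legendre_scale_integral 1; rewrite ltr01 ler1n expr1n mul1r => /(_ isT) V1.
have Vs := @legendre_scale_integral s; rewrite s0 s2 in Vs.
have em0 : 0 <= eps * m%:R by rewrite mulr_ge0// ltW.
have mA := m_argmax e0.
rewrite -lee_fin !EFinD EFinM (fineK (I_fin e01)) IE// -V1 -Vs// -int_cst.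
rewrite -ge0_integralZl_EFin//; last exact/measurable_EFinP.
rewrite -!ge0_integralD//; try (by move=> y _; rewrite lee_fin legendre_support_ge0).
- apply: ge0_le_integral => //.
  + move=> y _; rewrite -EFinM -EFinD lee_fin addr_ge0//; first exact: legendre_support_ge0.
    by rewrite mulr_ge0.
  + apply: emeasurable_funD; first by apply/measurable_EFinP; exact: m_legendre.
    by apply/measurable_EFinP; exact: measurable_funM.
  + apply: emeasurable_funD; last exact: measurable_cst.
    by apply/measurable_EFinP; exact: m_legendre.
  + move=> y _; rewrite -EFinM -!EFinD lee_fin legendre1.
    have := legendre_argmax y e0 s0.
    have := ler_wpM2l s10 (g_le (argmax phi eps y)); lra.
- by apply/measurable_EFinP; exact: m_legendre.
- by apply/measurable_EFinP; exact: m_legendre.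
- by move=> y _; rewrite -EFinM lee_fin mulr_ge0.
- by apply/measurable_EFinP; exact: measurable_funM.
- by move=> y _; rewrite lee_fin.
Qed.

(** The same with s <= 1 and phi <= trunc eta + eta. *)
Lemma volume_le eps s : 0 < eps <= 1 -> 0 < s <= 1 ->
  V <= s ^+ n * V + (eps * m%:R + (1 - s) * eta) * vY + (1 - s) * fine (I eps).
Proof.
move=> e01 /andP[s0 s1]; have /andP[e0 _] := e01.
have s10 : 0 <= 1 - s by lra.
have := @legendre_scale_integral 1; rewrite ltr01 ler1n expr1n mul1r => /(_ isT) V1.
have Vs := @legendre_scale_integral s; rewrite s0 (le_trans s1) ?ler1n// in Vs.
have em0 : 0 <= eps * m%:R + (1 - s) * eta.
  by rewrite addr_ge0// mulr_ge0// ltW.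
have mA := m_argmax e0.
rewrite -lee_fin !EFinD (EFinM (1 - s)) (fineK (I_fin e01)) IE// -V1 -Vs// -int_cst.
rewrite -ge0_integralZl_EFin//; last exact/measurable_EFinP.
rewrite -ge0_integralD//; last first.
- by apply/measurable_EFinP; exact: m_legendre.
- by move=> y _; rewrite lee_fin legendre_support_ge0.
rewrite -ge0_integralD//; last first.
- by apply/measurable_EFinP; exact: measurable_funM.
- by move=> y _; rewrite -EFinM lee_fin mulr_ge0.
- apply: emeasurable_funD; last exact: measurable_cst.
  by apply/measurable_EFinP; exact: m_legendre.
- by move=> y _; rewrite -EFinD lee_fin addr_ge0// legendre_support_ge0.
apply: ge0_le_integral => //.
- by move=> y _; rewrite lee_fin legendre_support_ge0.
- by apply/measurable_EFinP; exact: m_legendre.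
- apply: emeasurable_funD; last by apply/measurable_EFinP; exact: measurable_funM.
  apply: emeasurable_funD; last exact: measurable_cst.
  by apply/measurable_EFinP; exact: m_legendre.
- move=> y _; rewrite -EFinM -!EFinD lee_fin legendre1.
  have := legendre_argmax y e0 s0.
  have := ler_wpM2l s10 (g_ge (argmax phi eps y)); lra.
- by move=> y _; rewrite lee_fin.
Qed.

(* The set where phi >= eta is compact and contained in D. *)
Let hessian_bounded : exists M, forall q, eta <= phi q -> forall i j, `|hessian phi q i j| <= M.
Proof.
pose S := [set q | eta <= phi q].
have SD q : S q -> D q.
  by move=> Sq; apply: contrapT => /phi_off h; move: Sq; rewrite /S/= h leNgt eta_gt0.
have cS : compact S.
  apply: bounded_closed_compact.
    exists 1; split; first exact: num_real.
    move=> M M1 q /SD /chart_domain_sub /chart_closure_norm /le_trans; apply; exact: ltW.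
  apply: (@preimage_closed _ _ phi [set x | eta <= x]); last exact: closed_ge.
  by move=> ? _; exact: phi_cont.
have [S0|S0] := pselect (S !=set0); last first.
  by exists 0 => q Sq; exfalso; apply: S0; exists q.
have /choice[M MP] : forall ij : 'I_m * 'I_m, exists M, forall q, S q ->
    `|partial ij.1 (partial ij.2 phi) q| <= M.
  move=> [i j] /=.
  have cf : {within S, continuous (fun q => `|partial i (partial j phi) q|)}.
    apply: continuous_in_subspaceT => q /set_mem /SD Dq.
    have [_ _ _ _ c2] := phi_C2 Dq.
    exact: (cvg_norm (c2 i j)).
  have [c _ cmax] := @EVT_max_rV R m _ S S0 cS cf.
  exists `|partial i (partial j phi) c| => q Sq; apply: cmax; exact/mem_set.
exists (\sum_ij `|M ij|) => q Sq i j; rewrite mxE.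
rewrite (le_trans (MP (i, j) q Sq))// (le_trans (ler_norm _))// (bigD1 (i, j))//= lerDl.
by apply: sumr_ge0.
Qed.

Let I_dominated : exists2 C, 0 <= C &
  forall eps q, 0 <= eps <= 1 -> `|g q * w eps q| <= C.
Proof.
have [M MP] := hessian_bounded.
have [C C0 CP] := @det_bounded R m (M + 1).
have [G G0 GP] := chart_closure_bounded_above g_cont.
exists (G * C); first exact: mulr_ge0.
move=> eps q /andP[e0 e1]; have [pq|pq] := leP (phi q) eta.
  by rewrite (g_eq0 pq) mul0r normr0 mulr_ge0.
have Dq : D q.
  by apply: contrapT => /phi_off h; move: pq; rewrite h ltNge ltW.
rewrite normrM ler_pM//.
  by rewrite ger0_norm// GP//; exact: chart_domain_sub.
apply: CP => i j.
have -> : (eps%:M - hessian phi q) i j = eps *+ (i == j) - hessian phi q i j.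
  by rewrite 3!mxE.
rewrite (le_trans (ler_normB _ _))// addrC lerD//; first exact: MP (ltW pq) _ _.
by case: (i == j); rewrite ?mulr1n ?mulr0n ?normr0// ger0_norm.
Qed.

Let mK : measurable (K : set 'rV[R]_m).
Proof. by apply: closed_measurable_rV; exact: chart_closure_closed. Qed.

Let I_K eps : I eps = (\int[vol]_(q in K) (g q * w eps q)%:E)%E.
Proof.
rewrite /I [RHS]integral_mkcond; apply: eq_integral => q _; rewrite patchE.
case: ifPn => // /negP qK; congr EFin.
have -> : g q = 0; last exact: mul0r.
apply: g_eq0; rewrite phi_off ?ltW// => Dq.
by apply: qK; apply/mem_set; exact: chart_domain_sub.
Qed.

Lemma measurable_trunc_det eps : measurable_fun setT (fun q => g q * w eps q).
Proof.
exact: (continuous_measurable_rV (continuous_g_det phi_C2 g_cont g_supp)).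
Qed.

Let I_cvg : I k.+1%:R^-1 @[k --> \oo] --> I 0 /\ I 0 \is a fin_num.
Proof.
have [C C0 CP] := I_dominated.
have Kfin : vol K \is a fin_num.
  by apply: (ball_volume_fin (b := 1)) => // x; exact: chart_closure_norm.
have iC : vol.-integrable K (EFin \o cst C).
  apply/integrableP; split; first by apply/measurable_EFinP; exact: measurable_cst.
  under eq_integral do rewrite /= ger0_norm//.
  have Koo : (vol K < +oo)%E by rewrite -ge0_fin_numE//; exact: measure_ge0.
  by rewrite integral_cst//; exact: lte_mul_pinfty.
have k01 (k : nat) : 0 <= (k.+1%:R^-1 : R) <= 1.
  by rewrite invr_ge0 ler0n/= invf_le1// ler1n.
have [] := @dominated_convergence _ _ R vol K mK
  (fun k q => (g q * w k.+1%:R^-1 q)%:E) (fun q => (g q * w 0 q)%:E) (EFin \o cst C).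
- by move=> k; apply/measurable_EFinP; apply: measurable_funTS; exact: measurable_trunc_det.
- by apply/measurable_EFinP; apply: measurable_funTS; exact: measurable_trunc_det.
- apply: aeW => q _; apply: cvg_EFin; first by apply: nearW.
  by apply: cvgM; [exact: cvg_cst|exact: cvg_det_eps].
- exact: iC.
- by apply: aeW => q k _; rewrite /= lee_fin; exact: CP.
move=> i0 _ cv; split; first by under eq_fun do rewrite I_K; rewrite I_K.
by rewrite I_K; exact: integrable_fin_num.
Qed.

Let fine_I_cvg : fine (I k.+1%:R^-1) @[k --> \oo] --> fine (I 0).
Proof. by have [c f] := I_cvg; apply: fine_cvg; rewrite fineK. Qed.

Let eps01 (k : nat) : 0 < (k.+1%:R^-1 : R) <= 1.
Proof. by rewrite invr_gt0 ltr0n/= invf_le1// ler1n. Qed.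

Lemma volume_ge0 s : 1 <= s <= 2 -> V + (s - 1) * fine (I 0) <= s ^+ n * V.
Proof.
move=> s12.
have c1 : V + (s - 1) * fine (I k.+1%:R^-1) @[k --> \oo] --> V + (s - 1) * fine (I 0).
  by apply: cvgD; [exact: cvg_cst|apply: cvgM; [exact: cvg_cst|exact: fine_I_cvg]].
have c2 : s ^+ n * V + k.+1%:R^-1 * m%:R * vY @[k --> \oo] --> s ^+ n * V + 0 * m%:R * vY.
  apply: cvgD; first exact: cvg_cst.
  by do 2 (apply: cvgM; last exact: cvg_cst); exact: cvg_harmonic.
rewrite !mul0r addr0 in c2.
by apply: (ler_cvg_oo c1 c2) => k; exact: volume_ge.
Qed.

Lemma volume_le0 s : 0 < s <= 1 ->
  V <= s ^+ n * V + (1 - s) * eta * vY + (1 - s) * fine (I 0).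
Proof.
move=> s01.
have c : s ^+ n * V + (k.+1%:R^-1 * m%:R + (1 - s) * eta) * vY + (1 - s) * fine (I k.+1%:R^-1)
    @[k --> \oo] --> s ^+ n * V + (0 * m%:R + (1 - s) * eta) * vY + (1 - s) * fine (I 0).
  apply: cvgD; last by apply: cvgM; [exact: cvg_cst|exact: fine_I_cvg].
  apply: cvgD; first exact: cvg_cst.
  apply: cvgM; last exact: cvg_cst; apply: cvgD; last exact: cvg_cst.
  by apply: cvgM; last exact: cvg_cst; exact: cvg_harmonic.
move: c; rewrite mul0r add0r => c.
apply: (ler_cvg_oo (@cvg_cst _ V _ _ _) c) => k.
exact: volume_le.
Qed.

(** Divide the two bounds by s - 1 and let s tend to 1 from above and from below:
    (s ^ n - 1) / (s - 1) is the geometric sum P s, which tends to n. *)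
Lemma volume_trunc_bounds :
  I 0 \is a fin_num /\ fine (I 0) <= n%:R * V <= fine (I 0) + eta * vY.
Proof.
split; first by have [] := I_cvg.
pose P (s : R) := \sum_(i < n) s ^+ i.
have P1 : P 1 = n%:R.
  rewrite /P; under eq_bigr do rewrite expr1n.
  by rewrite sumr_const card_ord.
have cP : continuous P.
  by apply: continuous_big => [|i _ ?]; [exact: add_continuous|exact: exprn_continuous].
have PE s : s ^+ n - 1 = (s - 1) * P s by exact: subrX1.
pose h (k : nat) : R := k.+1%:R^-1.
have ch : h k @[k --> \oo] --> (0 : R) by exact: cvg_harmonic.
have cu : (fun k => 1 + h k) @ \oo --> (1 + 0 : R).
  by apply: cvgD; [exact: cvg_cst|exact: ch].
have cd : (fun k => 1 - h k / 2) @ \oo --> (1 - 0 / 2 : R).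
  by apply: cvgB; [exact: cvg_cst|apply: cvgM; [exact: ch|exact: cvg_cst]].
rewrite addr0 in cu; rewrite mul0r subr0 in cd.
have cPu : P (1 + h k) @[k --> \oo] --> P 1 by apply: (cvg_comp _ _ cu); exact: cP.
have cPd : P (1 - h k / 2) @[k --> \oo] --> P 1 by apply: (cvg_comp _ _ cd); exact: cP.
rewrite -P1; apply/andP; split.
  have c : P (1 + h k) * V @[k --> \oo] --> P 1 * V by apply: cvgM; [|exact: cvg_cst].
  apply: (ler_cvg_oo (@cvg_cst _ (fine (I 0)) _ _ _) c) => k.
  have /andP[h0 h1] := eps01 k; rewrite -/(h k) in h0 h1.
  have s12 : 1 <= 1 + h k <= 2 by apply/andP; split; lra.
  have := volume_ge0 s12; have := PE (1 + h k).
  rewrite [1 + h k - 1]addrC addKr => E h2.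
  rewrite -(ler_pM2l h0) mulrA -E mulrBl mul1r; lra.
have c : P (1 - h k / 2) * V @[k --> \oo] --> P 1 * V by apply: cvgM; [|exact: cvg_cst].
apply: (ler_cvg_oo c (@cvg_cst _ _ _ _ _)) => k.
have /andP[h0 h1] := eps01 k; rewrite -/(h k) in h0 h1.
(* half the step, so that 1 - h k / 2 > 0 also for k = 0 *)
have s12 : 0 < 1 - h k / 2 <= 1 by apply/andP; split; lra.
have := volume_le0 s12; have := PE (1 - h k / 2).
have h20 : 0 < h k / 2 by lra.
rewrite subKr [1 - h k / 2 - 1]addrC addKr => E h2.
rewrite -(ler_pM2l h20) mulrA.
have -> : h k / 2 * P (1 - h k / 2) = 1 - (1 - h k / 2) ^+ n by lra.
rewrite mulrBl mul1r; lra.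
Qed.

End fixed_eta.
(** Let eta tend to 0: monotone convergence, the determinants being
    nonnegative. *)
Lemma determinant_integral :
  (\int[vol]_(q in D) (phi q * \det (- hessian phi q))%:E = (n%:R * V)%:E)%E.
Proof.
pose eta (k : nat) : R := k.+1%:R^-1.
have eta0 k : 0 < eta k by rewrite invr_gt0 ltr0n.
have ceta : eta k @[k --> \oo] --> (0 : R) by exact: cvg_harmonic.
pose J k := (\int[vol]_q (trunc (eta k) q * w 0 q)%:E)%E.
have Jb k := volume_trunc_bounds (eta0 k).
have Jfin k : J k \is a fin_num by have [] := Jb k.
have cJ : fine (J k) @[k --> \oo] --> n%:R * V.
  have cl : (fun k => n%:R * V - eta k * fine (vol Y)) @ \oo --> n%:R * V - 0 * fine (vol Y).
    by apply: cvgB; [exact: cvg_cst|apply: cvgM; [exact: ceta|exact: cvg_cst]].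
  rewrite mul0r subr0 in cl.
  apply: (squeeze_cvgr _ cl (@cvg_cst _ (n%:R * V) _ _ _)).
  by apply: nearW => k; have [_ /andP[h1 h2]] := Jb k; rewrite lerBlDr h1 h2.
have cJe : J k @[k --> \oo] --> (n%:R * V)%:E.
  have -> : J = (fun k => (fine (J k))%:E) by apply/funext => k; rewrite fineK.
  by apply: cvg_EFin; [apply: nearW|exact: cJ].
have w0 q : D q -> 0 <= w 0 q by exact: det_hessian_ge0.
have t0 k q : 0 <= trunc (eta k) q by rewrite /trunc le_max lexx orbT.
have toff k q : ~ D q -> trunc (eta k) q = 0.
  by move=> /phi_off h; rewrite /trunc h sub0r max_r// oppr_le0 ltW.
have tw0 k q : 0 <= trunc (eta k) q * w 0 q.
  by have [Dq|/toff ->] := pselect (D q); [rewrite mulr_ge0// w0|rewrite mul0r].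
have ct q : trunc (eta k) q @[k --> \oo] --> phi q.
  have -> : phi q = Num.max (phi q - 0) 0 by rewrite subr0 max_l.
  have c0 : (fun k => phi q - eta k) @ \oo --> phi q - 0.
    by apply: cvgB; [exact: cvg_cst|exact: ceta].
  apply: (@cvg_comp _ _ _ (fun k => phi q - eta k) (fun x : R => Num.max x 0) _ _ _ c0).
  by apply: (@continuous_max _ _ (fun x : R => x) (fun=> 0)); [exact: cvg_id|exact: cvg_cst].
have cm := @cvg_monotone_convergence _ _ R vol setT measurableT
  (fun k q => (trunc (eta k) q * w 0 q)%:E)
  (fun k => (measurable_EFinP _ _).2 (measurable_trunc_det (eta0 k) 0)).
have {}cm : J k @[k --> \oo] --> (\int[vol]_q (phi q * w 0 q)%:E)%E.
  have -> : (\int[vol]_q (phi q * w 0 q)%:E = \int[vol]_q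
      limn (fun k => (trunc (eta k) q * w 0 q)%:E))%E.
    apply: eq_integral => q _; apply/esym/cvg_lim => //.
    by apply: cvg_EFin; [apply: nearW|apply: cvgM; [exact: ct|exact: cvg_cst]].
  apply: cm; first by move=> k q _; rewrite lee_fin.
  move=> q _ k l kl; rewrite lee_fin.
  have [Dq|/toff h] := pselect (D q); last by rewrite !h !mul0r.
  rewrite ler_wpM2r// ?w0// /trunc.
  have ekl : eta l <= eta k by rewrite /eta lef_pV2 ?posrE ?ltr0n// ler_nat ltnS.
  by rewrite ge_max !le_max lexx orbT andbT lerD2l lerN2 ekl.
transitivity (\int[vol]_q (phi q * w 0 q)%:E)%E; last exact: (cvg_unique _ cm cJe).
rewrite integral_mkcond; apply: eq_integral => q _; rewrite patchE.
case: ifPn => [_|/negP qD].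
  congr (_ * \det _)%:E; rewrite raddf0 sub0r //.
congr EFin; rewrite phi_off ?mul0r// => Dq; apply: qD; exact/mem_set.
Qed.

End volume_limit.

(** * The volume formula *)

Section Rhat_volume.
Context {R : realType} {m : nat}.
Hypothesis m_gt0 : (0 < m)%N.
Variable psi : Cspace R m.+1.
Hypothesis psi_bd : forall p, (csimplex R m.+1 `\` simplex R m.+1) p -> psi p = 0.
Implicit Types (q y u : 'rV[R]_m).
Local Notation K := (chart_closure R m).
Local Notation D := (chart_domain R m.+1 : set 'rV[R]_m).
Local Notation chart := (@chart R m.+1).
Local Notation phi := (psi \o chart).
Hypothesis phi_C2 : C2_on D phi.
Variable b : R.
Hypothesis b_gt0 : 0 < b.
Hypothesis Rhat_le : forall x, Rhat psi x -> `|x| <= b.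

Let phi_cont : continuous phi. Proof. exact: phi_continuous. Qed.
Let phi_conc : concave_on K phi. Proof. exact: phi_concave. Qed.

Lemma diag_slice_widen y (t : R) (i : 'I_m) :
  diag_slice (y, t) ord0 (widen_ord (leqnSn m) i) = t - y ord0 i.
Proof. by rewrite /diag_slice rV_rcons_widen !mxE. Qed.

Lemma diag_slice_max y (t : R) : diag_slice (y, t) ord0 ord_max = t.
Proof. by rewrite /diag_slice rV_rcons_max. Qed.

(** The tangent plane to phi at u lies above phi >= 0 at the unit vectors. *)
Lemma vertex_ineq u i : D u ->
  0 <= phi u - pairing u (grad phi u) + grad phi u ord0 i.
Proof.
move=> Du; have := concave_grad_ineq phi_conc phi_C2 Du (chart_closure_delta i).
rewrite pairingBl pairing_delta.
have := phi_ge0 psi (delta_mx ord0 i).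
by move: (phi _) (phi _) (pairing _ _) (grad _ _ _ _) => *; lra.
Qed.

(** The point x of the orthant whose pairing with chart q is half the value at q
    of the affine function tangent to phi at u (plus a small constant, which
    makes its coordinates positive) satisfies <chart u, x> < phi u.  So it lies
    in Rhat psi and is bounded by b, and its coordinates bound the gradient. *)
Lemma grad_bounded u : D u -> 0 < phi u -> `|grad phi u| <= 2 * b.
Proof.
move=> Du pu; pose t := phi u - pairing u (grad phi u).
have t0 : 0 <= t.
  have := concave_grad_ineq phi_conc phi_C2 Du chart_closure0.
  have := phi_ge0 psi 0; rewrite pairingBl pairing0l sub0r /t.
  by move: (phi _) (phi _) => *; lra.
pose c := phi u / 4; have c0 : 0 < c by rewrite divr_gt0.
pose x := diag_slice (- (2^-1 *: grad phi u), 2^-1 * t + c).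
have xw i : x ord0 (widen_ord (leqnSn m) i) = 2^-1 * (t + grad phi u ord0 i) + c.
  by rewrite diag_slice_widen !mxE; lra.
have xm : x ord0 ord_max = 2^-1 * t + c by exact: diag_slice_max.
have xR : Rhat psi x.
  apply/(RhatE m_gt0); split.
    have h (i : 'I_m.+1) : 0 < x ord0 i.
      have [im|mi] := ltnP i m.
        have -> : i = widen_ord (leqnSn m) (Ordinal im) by exact/val_inj.
        rewrite xw; have := vertex_ineq (Ordinal im) Du; rewrite -/t.
        by move: (grad _ _ _ _) => *; lra.
      have -> : i = ord_max by apply/val_inj/eqP; rewrite eqn_leq mi -ltnS ltn_ord.
      by rewrite xm; lra.
    exact: h.
  exists u => //; rewrite pairing_chart_slice pairingNr pairingZr opprK.
  by move: pu; rewrite /t /c; move: (phi u) (pairing _ _) => *; lra.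
have xb := Rhat_le xR.
have tb : t <= 2 * b.
  have := le_trans (coord_le_norm x ord_max) xb; rewrite xm ger0_norm; last by lra.
  by move=> ?; lra.
apply: norm_le_coord; first by have := b_gt0; lra.
move=> i; have h0 := vertex_ineq i Du; rewrite -/t in h0.
have := le_trans (coord_le_norm x (widen_ord (leqnSn m) i)) xb.
rewrite xw ger0_norm; last by move: (grad _ _ _ _) h0 => *; lra.
move: (grad _ _ _ _) h0 => z h0 h1; rewrite ler_norml; apply/andP; split; lra.
Qed.

(* The last coordinate t of a point of Rhat (s psi), s <= 2, is at most 2 b, and
   so is each t - y_i; hence |y| <= 4 b for the fibres that are not empty. *)
Let B := 4 * b + 1.

(** By the first order condition |y| <= eps + |grad phi| at an interior
    maximizer. *)
Lemma argmax_bounded eps : 0 < eps <= 1 -> forall y, B < `|y| ->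
  phi (argmax phi eps y) = 0.
Proof.
move=> /andP[e0 e1] y yB; apply/eqP; rewrite eq_le phi_ge0 andbT leNgt; apply/negP => pu.
have Du : D (argmax phi eps y).
  by apply: contrapT => /(phi_off m_gt0 psi_bd) h; move: pu; rewrite h ltxx.
have yE := grad_argmax phi_cont phi_C2 e0 Du.
have gb := grad_bounded Du pu.
have ub : `|argmax phi eps y| <= 1 by apply: chart_closure_norm; exact: chart_domain_sub.
have h : `|y| <= eps * 1 + 2 * b.
  rewrite {1}yE (le_trans (ler_normB _ _))// lerD// normrZ gtr0_norm//.
  by rewrite ler_wpM2l// ltW.
by have := lt_le_trans yB h; have := b_gt0; rewrite /B; lra.
Qed.

Let s_bd (s : R) (s0 : 0 < s) p :
  (csimplex R m.+1 `\` simplex R m.+1) p -> Cscale (ltW s0) psi p = 0.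
Proof. by move=> /psi_bd h; rewrite /Cscale /Cfun/= /Cmk/= [LHS](_ : _ = s * psi p)// h mulr0. Qed.

Lemma Rhat_volume_fin : lebesgue_rV R m.+1 (Rhat psi) \is a fin_num.
Proof.
apply: (@ball_volume_fin _ _ b); [exact: ltW|by apply: open_measurable_rV; exact: Rhat_open|exact: Rhat_le].
Qed.

Let V := fine (lebesgue_rV R m.+1 (Rhat psi)).

Lemma legendre_scale_volume s : 0 < s <= 2 ->
  (\int[lebesgue_rV R m]_(y in [set y : 'rV[R]_m | (`|y| <= B)%R])
    (legendre (fun q => s * phi q) y - support_fun y)%:E = (s ^+ m.+1 * V)%:E)%E.
Proof.
move=> /andP[s0 s2].
have volS := lebesgue_Rhat m_gt0 (s_bd s0).
have sE : (Cscale (ltW s0) psi \o chart) = (fun q => s * phi q) by [].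
rewrite sE in volS.
have E : lebesgue_rV R m.+1 (Rhat (Cscale (ltW s0) psi)) = (s ^+ m.+1 * V)%:E.
  rewrite (lebesgue_rV_scale s0); last by apply: open_measurable_rV; exact: Rhat_open.
  rewrite EFinM /V fineK; last exact: Rhat_volume_fin.
  congr (_ * lebesgue_rV R m.+1 _)%E; apply/seteqP; split=> x /=.
    by move/Rhat_scale.
  by move=> h; apply/Rhat_scale.
rewrite -E volS integral_mkcond; apply: eq_integral => y _; rewrite patchE.
case: ifPn => // /negP yB; congr EFin; apply/esym/eqP; rewrite subr_eq0 eq_le.
have := support_fun_le_legendre m_gt0 (s_bd s0) y; rewrite sE => ->; rewrite andbT.
rewrite leNgt; apply/negP => sc; apply: yB; apply/mem_set => /=.
pose t := (support_fun y + legendre (fun q => s * phi q) y) / 2.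
have ht : [set t | Rhat (Cscale (ltW s0) psi) (diag_slice (y, t))] t.
  rewrite (Rhat_slice m_gt0 (s_bd s0)) sE /= in_itv/= /t.
  by apply/andP; split; lra.
pose z := s^-1 *: diag_slice (y, t).
have zR : Rhat psi z.
  by apply/(Rhat_scale _ s0); rewrite /z scalerA mulfV ?lt0r_neq0// scale1r.
have zb : `|diag_slice (y, t)| <= 2 * b.
  have -> : diag_slice (y, t) = s *: z by rewrite /z scalerA mulfV ?lt0r_neq0// scale1r.
  rewrite normrZ gtr0_norm//; apply: ler_pM => //; [exact: ltW|exact: Rhat_le].
have tb : `|t| <= 2 * b.
  by have := le_trans (coord_le_norm _ ord_max) zb; rewrite diag_slice_max.
apply: norm_le_coord; first by have := b_gt0; rewrite /B; lra.
move=> i; have := le_trans (coord_le_norm _ (widen_ord (leqnSn m) i)) zb.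
rewrite diag_slice_widen; move: tb; rewrite !ler_norml /B => /andP[? ?] /andP[? ?].
by have b0 := b_gt0; apply/andP; split; lra.
Qed.

Theorem Rhat_volume : lebesgue_rV R m.+1 (Rhat psi) =
  ((m.+1%:R^-1)%:E * \int[lebesgue_rV R m]_(q in D)
    (phi q * \det (- hessian phi q))%:E)%E.
Proof.
have B0 : 0 <= B by have := b_gt0; rewrite /B; lra.
rewrite (determinant_integral phi_cont phi_conc (phi_ge0 psi) (phi_off m_gt0 psi_bd)
  phi_C2 B0 legendre_scale_volume argmax_bounded).
rewrite -EFinM mulrA mulVf ?mul1r; first by rewrite fineK//; exact: Rhat_volume_fin.
by rewrite pnatr_eq0.
Qed.

End Rhat_volume.

(** * Borel sets of the function space *)

Section dense_points.
Context {R : realType} {m : nat}.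
Hypothesis m_gt0 : (0 < m)%N.
Implicit Types (p x : 'rV[R]_m.+1) (q : 'rV[R]_m).
Local Notation D := (chart_domain R m.+1 : set 'rV[R]_m).
Local Notation chart := (@chart R m.+1).

Let center : 'rV[R]_m := const_mx m.+1%:R^-1.

Let center_in : D center.
Proof.
apply/(chart_domainP _ m_gt0); split=> [i|]; first by rewrite mxE invr_gt0 ltr0n.
under eq_bigr do rewrite mxE.
rewrite sumr_const card_ord.
have : 0 < m.+1%:R :> R by rewrite ltr0n.
have : m%:R < m.+1%:R :> R by rewrite ltr_nat.
by move: (m.+1%:R) => c mc c0; rewrite -mulr_natr mulrC ltr_pdivrMr// mul1r.
Qed.

(** The charts of the rational points of D, enumerated; numbers that do not code
    such a point are sent to the barycentre. *)
Definition dense_point (j : nat) : 'rV[R]_m.+1 :=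
  if unpickle j is Some a then
    let q : 'rV[R]_m := map_mx ratr (a : 'rV[rat]_m) in
    if pselect (D q) then chart q else chart center
  else chart center.

Lemma dense_point_in j : simplex R m.+1 (dense_point j).
Proof.
rewrite /dense_point; case: unpickle => [a|]; last exact/(simplex_chart m_gt0).
by case: pselect => /= [Dq|_]; apply/(simplex_chart m_gt0).
Qed.

Lemma dense_point_approx p : simplex R m.+1 p -> forall e, 0 < e ->
  exists j, `|dense_point j - p| < e.
Proof.
move=> /(simplexP m_gt0)[q Dq ->] e e0.
have [d d0 dP] := continuous_chart q e0.
have [r r0 rP] := open_radius chart_domain_open Dq.
have dr0 : 0 < Num.min d r by rewrite lt_min d0.
have [a aP] := rat_rV_approx q dr0.
have aq : `|map_mx ratr a - q| < Num.min d r.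
  by apply: norm_lt_coord => // i; rewrite !mxE distrC; exact: aP.
move: aq; rewrite lt_min => /andP[ad ar].
exists (pickle a); rewrite /dense_point pickleK.
case: pselect => /= [Da|nDa]; first exact: dP.
by exfalso; apply: nDa; exact: rP.
Qed.

End dense_points.

Section Cspace_topology.
Context {R : realType} {m : nat}.
Hypothesis m_gt0 : (0 < m)%N.
Implicit Types (p x : 'rV[R]_m.+1) (w : Cspace R m.+1).
Local Notation point := (@dense_point R m).

Lemma continuous_eval p : simplex R m.+1 p ->
  continuous (fun w : Cspace R m.+1 => w p : R).
Proof.
move=> sp w; apply/(@cvgrPdist_lt _ _ _ (nbhs w)) => e e0.
pose W := [set g : {family compacts_of_simplex R m.+1, 'rV[R]_m.+1 -> R} |
  forall y, [set p] y -> [set uv : R * R | `|uv.1 - uv.2| < e] (Cfun w y, g y)].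
have nW : nbhs (Cfun w : {family compacts_of_simplex R m.+1, 'rV[R]_m.+1 -> R}) W.
  apply: fam_nbhs.
    by rewrite -entourage_ballE; exists e.
  by split; [exact: compact_set1|move=> y ->].
have nV : nbhs w [set v : Cspace R m.+1 | W (Cfun v)].
  exact: (@initial_continuous (Cspace R m.+1) _ set_val w W nW).
by apply: filterS nV => v Wv; exact: (Wv p erefl).
Qed.

(** Write p as a convex combination of x, with weight 1 - t, and another point
    of the closed simplex; a nonnegative concave function is then at least its
    share at x. *)
Lemma Cspace_scale_le w p x (t : R) : simplex R m.+1 p -> simplex R m.+1 x ->
  0 < t <= 1 -> (forall i, (1 - t) * x ord0 i <= p ord0 i) -> (1 - t) * w x <= w p.
Proof.
move=> sp sx /andP[t0 t1] xp; have [_ conc _ _] := CfunP w.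
pose z := t^-1 *: (p - (1 - t) *: x).
have z0 i : 0 <= z ord0 i.
  by rewrite !mxE mulr_ge0 ?invr_ge0 ?(ltW t0)// subr_ge0.
have z1 : \sum_i z ord0 i = 1.
  have [_ p1] := sp; have [_ x1] := sx.
  under eq_bigr do rewrite !mxE.
  by rewrite -mulr_sumr sumrB -mulr_sumr p1 x1; field; rewrite lt0r_neq0.
have cz : csimplex R m.+1 z by exact: csimplex_sum1.
have t01 : 0 <= t <= 1 by rewrite (ltW t0).
have cx : csimplex R m.+1 x by exact: subset_closure.
have := conc _ _ _ cz cx t01.
have -> : t *: z + (1 - t) *: x = p.
  by rewrite /z scalerA mulfV ?lt0r_neq0// scale1r subrK.
by apply: le_trans; rewrite lerDr mulr_ge0 ?Cspace_ge0// ltW.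
Qed.

(* Multiplicative closeness of the coordinates, the relation for which concave
   nonnegative functions obey a Harnack inequality. *)
Let close (t : R) p x := forall i,
  (1 - t) * x ord0 i < p ord0 i /\ (1 - t) * p ord0 i < x ord0 i.

Let close_eval w p x (t M : R) : simplex R m.+1 p -> simplex R m.+1 x -> 0 < t <= 1 ->
  close t p x -> w p <= M -> w x <= M -> `|w p - w x| <= t * M.
Proof.
move=> sp sx t01 c wp wx; have /andP[t0 t1] := t01.
have h1 := Cspace_scale_le w sp sx t01 (fun i => ltW (c i).1).
have h2 := Cspace_scale_le w sx sp t01 (fun i => ltW (c i).2).
have h3 := ler_wpM2l (ltW t0) wp.
have h4 := ler_wpM2l (ltW t0) wx.
by rewrite ler_norml; apply/andP; split; lra.
Qed.

Let close_open (t : R) j : open [set p | close t p (point j)].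
Proof.
have -> : [set p | close t p (point j)] = \big[setI/setT]_(i <- enum 'I_m.+1)
   (((fun p => p ord0 i) @^-1` [set a | (1 - t) * point j ord0 i < a]) `&`
   ((fun p => (1 - t) * p ord0 i) @^-1` [set a | a < point j ord0 i])).
  rewrite -bigcap_seq; apply/seteqP; split=> x /= cx i.
    by move=> _; have [] := cx i.
  have ie : i \in enum 'I_m.+1 by rewrite mem_enum.
  exact: (cx i ie).
elim/big_ind : _ => [|? ?|i _]; [exact: openT|exact: openI|].
apply: openI; apply: open_comp.
- by move=> ? _; exact: coord_continuous.
- exact: open_gt.
- move=> y _; apply: (@continuousM _ _ (fun=> 1 - t) (fun p => p ord0 i)).
    exact: cst_continuous.
  exact: coord_continuous.
- exact: open_lt.
Qed.

Let close_dense (t : R) p : 0 < t < 1 -> simplex R m.+1 p ->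
  exists j, close t p (point j).
Proof.
move=> /andP[t0 t1] sp; have [p01 _] := sp.
have [e e0 eP] : exists2 e, 0 < e & forall i : 'I_m.+1, e < t * p ord0 i.
  apply: (@fin_radius R m.+1 (fun i e => e < t * p ord0 i)).
    by move=> i d d' /andP[_ dd] dP; exact: le_lt_trans dP.
  move=> i; exists (t * p ord0 i / 2).
    by rewrite divr_gt0// mulr_gt0//; case/andP: (p01 i).
  have : 0 < t * p ord0 i by rewrite mulr_gt0//; case/andP: (p01 i).
  by move=> ?; lra.
have [j jp] := dense_point_approx m_gt0 sp e0; exists j => i.
have := le_lt_trans (coord_le_norm _ i) jp; rewrite !mxE ltr_norml => /andP[h1 h2].
have ei := eP i; have /andP[pi0 _] := p01 i.
move: (point j ord0 i) h1 h2 => a h1 h2; split; last by lra.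
have : (1 - t) * (a - p ord0 i) < t * p ord0 i.
  have [h|h] := leP 0 (a - p ord0 i).
    by rewrite (le_lt_trans _ (lt_trans h2 ei))// -[leRHS]mul1r ler_wpM2r//; lra.
  have : (1 - t) * (a - p ord0 i) < 0 by rewrite pmulr_rlt0// subr_gt0.
  by have := mulr_gt0 t0 pi0; lra.
lra.
Qed.

(** Concave nonnegative functions that are bounded at one interior point are
    equicontinuous on compact subsets of the simplex, so closeness at finitely
    many of the dense points gives uniform closeness on Kc. *)
Lemma Cspace_equicontinuous w0 (Kc : set 'rV[R]_m.+1) (e : R) :
  compact Kc -> Kc `<=` simplex R m.+1 -> 0 < e ->
  exists N, exists2 d, 0 < d & forall w,
    (forall j, (j < N)%N -> `|w (point j) - w0 (point j)| < d) ->
    forall p, Kc p -> `|w p - w0 p| < e.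
Proof.
move=> cK sK e0.
have s0 := @dense_point_in R m m_gt0 0%N; have [p001 _] := s0.
have [c c0 cP] : exists2 c, 0 < c & forall i : 'I_m.+1, c <= point 0%N ord0 i.
  apply: (@fin_radius R m.+1 (fun i e => e <= point 0%N ord0 i)).
    by move=> i d d' /andP[_ dd] dP; exact: le_trans dP.
  by move=> i; exists (point 0%N ord0 i) => //; case/andP: (p001 i).
pose c' := Num.min c (1 / 2).
have c'0 : 0 < c' by rewrite lt_min c0; lra.
have c'1 : c' <= 1 / 2 by rewrite ge_min lexx orbT.
have c'c : c' <= c by rewrite ge_min lexx.
pose M := (w0 (point 0%N) + 1) / c'.
have M0 : 0 < M by rewrite divr_gt0// ltr_wpDl ?Cspace_ge0.
have Mub w : `|w (point 0%N) - w0 (point 0%N)| < 1 -> forall p, simplex R m.+1 p -> w p <= M.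
  move=> w1 p sp; rewrite ler_pdivlMr// mulrC.
  have := @Cspace_scale_le w (point 0%N) p (1 - c') s0 sp.
  rewrite subKr => h; apply: (le_trans (h _ _)).
  - by apply/andP; split; lra.
  - move=> i; have [p01 _] := sp; have /andP[pi0 pi1] := p01 i.
    apply: le_trans (cP i); rewrite -[leRHS]mulr1; apply: ler_pM => //; exact: ltW.
  - by move: w1; rewrite ltr_norml => /andP[_]; lra.
pose t := Num.min (1 / 2) (e / (4 * M)).
have t0 : 0 < t by rewrite lt_min; apply/andP; split; [lra|rewrite divr_gt0// mulr_gt0].
have t1 : t <= 1 / 2 by rewrite ge_min lexx.
have tM : t * M <= e / 4.
  rewrite (@le_trans _ _ (e / (4 * M) * M))//.
    by rewrite ler_pM2r// ge_min lexx orbT.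
  by rewrite le_eqVlt; apply/orP; left; apply/eqP; field; rewrite lt0r_neq0.
have t01 : 0 < t < 1 by rewrite t0; lra.
have t01' : 0 < t <= 1 by rewrite t0; lra.
move: cK; rewrite compact_cover => /(_ nat setT (fun j => [set p | close t p (point j)])).
case=> [j _|p Kp|J _ KJ]; first exact: close_open.
  by have [j jp] := close_dense t01 (sK p Kp); exists j.
exists (\max_(j <- finmap.enum_fset J) j).+1; exists (Num.min 1 (e / 4)).
  by rewrite lt_min ltr01/= divr_gt0.
move=> w wN p Kp; have [j Jj cj] := KJ p Kp.
have jN : (j < (\max_(j <- finmap.enum_fset J) j).+1)%N by rewrite ltnS; exact: leq_bigmax_seq.
have w01 : `|w (point 0%N) - w0 (point 0%N)| < 1.
  by have := wN 0%N (ltn0Sn _); rewrite lt_min => /andP[].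
have w001 : `|w0 (point 0%N) - w0 (point 0%N)| < 1 by rewrite subrr normr0.
have sp := sK p Kp; have sj := @dense_point_in R m m_gt0 j.
have b1 := close_eval sp sj t01' cj (Mub w w01 p sp) (Mub w w01 _ sj).
have b2 := close_eval sp sj t01' cj (Mub w0 w001 p sp) (Mub w0 w001 _ sj).
have := wN j jN; rewrite lt_min => /andP[_].
move: b1 b2; rewrite !ler_norml !ltr_norml => /andP[? ?] /andP[? ?] /andP[? ?].
by apply/andP; split; lra.
Qed.

(** The topology of locally uniform convergence agrees on Cspace with that of
    pointwise convergence on the dense sequence. *)
Lemma Cspace_nbhs w0 (O : set (Cspace R m.+1)) : nbhs w0 O ->
  exists N, exists2 d, 0 < d & forall w,
    (forall j, (j < N)%N -> `|w (point j) - w0 (point j)| < d) -> O w.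
Proof.
pose FT : Type := {family compacts_of_simplex R m.+1, 'rV[R]_m.+1 -> R}.
move=> [_ [[W oW <-] /= Ww0 WO]].
pose F : set_system FT := filter_from [set Nd : nat * R | 0 < Nd.2]
  (fun Nd => [set f | exists w, f = Cfun w /\
     forall j, (j < Nd.1)%N -> `|w (point j) - w0 (point j)| < Nd.2]).
have FF : Filter F.
  apply: filter_from_filter; first by exists (0%N, 1) => /=.
  move=> [N d] [N' d'] /= d0 d'0; exists (maxn N N', Num.min d d') => /=.
    by rewrite lt_min d0.
  move=> f [w [-> wP]]; split; exists w; split=> // j jN.
    by have := wP j; rewrite leq_max jN => /(_ isT); rewrite lt_min => /andP[].
  by have := wP j; rewrite leq_max jN orbT => /(_ isT); rewrite lt_min => /andP[].
have cF : {family compacts_of_simplex R m.+1, F --> Cfun w0}.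
  apply/fam_cvgP => A [cA sA] U /uniform_nbhs[E [entE EU]].
  have [e /= e0 eE] : exists2 e : R, 0 < e & [set xy : R * R | ball xy.1 e xy.2] `<=` E.
    by move: entE; rewrite -entourage_ballE => -[e /= e0 eE]; exists e.
  have [N [d d0 dP]] := Cspace_equicontinuous w0 cA sA e0.
  exists (N, d) => // f [w [-> wP]]; apply: EU => p Ap; apply: eE => /=.
  by rewrite /ball/= distrC; exact: dP.
have : nbhs (Cfun w0 : FT) W by exact: open_nbhs_nbhs.
move=> /cF[[N d] /= d0 NdW]; exists N, d => // w wP; apply: WO; apply: NdW.
by exists w.
Qed.

(** Each open set is a countable union of cylinders with rational data over the
    dense sequence; hence the evaluations there generate the Borel sets. *)
Lemma measurable_fun_Cspace d (T : measurableType d) (X : T -> Cspace R m.+1) :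
  (forall j, measurable_fun setT (fun t => X t (point j) : R)) ->
  measurable_fun setT X.
Proof.
move=> mX.
pose cyl (z : nat * nat * seq rat) : set (Cspace R m.+1) :=
  [set w | forall j, (j < z.1.1)%N -> `|w (point j) - ratr (nth 0 z.2 j)| < z.1.2.+1%:R^-1].
have mcyl z : measurable (X @^-1` cyl z).
  have -> : X @^-1` cyl z = \bigcap_(j in `I_z.1.1)
      ((fun t => X t (point j) : R) @^-1` ball (ratr (nth 0 z.2 j) : R) z.1.2.+1%:R^-1).
    apply/seteqP; split=> t /= h j; have := h j; rewrite /ball/= distrC; exact.
  apply: fin_bigcap_measurable => [|j _]; first exact: finite_II.
  rewrite -[X in measurable X]setTI; apply: mX => //.
  by apply: open_measurable; exact: ball_open.
apply: (measurability (@open (Cspace R m.+1))) => [|_ [U oU <-]]; first by [].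
move: U oU => O oO; rewrite setTI.
pose C z := if pselect (cyl z `<=` O) then cyl z else set0.
have -> : O = \bigcup_k (if unpickle k is Some z then C z else set0).
  apply/seteqP; split=> [w0 Ow0|w [k _]]; last first.
    by case: unpickle => // z; rewrite /C; case: pselect => //= h /h.
  have [N [e e0 eP]] := Cspace_nbhs (open_nbhs_nbhs (conj oO Ow0)).
  have e2 : 0 < e / 2 by rewrite divr_gt0.
  have [k] := ltr_add_invr e2; rewrite add0r => ke.
  have k0 : 0 < k.+1%:R^-1 :> R by rewrite invr_gt0 ltr0n.
  have /choice[f fP] : forall j, exists q : rat, `|Cfun w0 (point j) - ratr q| < k.+1%:R^-1.
    move=> j; have /rat_in_itvoo[q] : Cfun w0 (point j) - k.+1%:R^-1 < Cfun w0 (point j) + k.+1%:R^-1.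
      by move: k0; move: (_^-1) => ? ?; lra.
    rewrite in_itv/= => /andP[h1 h2]; exists q; rewrite ltr_norml.
    by move: h1 h2; move: (_^-1) => ? ? ?; apply/andP; split; lra.
  exists (pickle (N, k, mkseq f N)) => //; rewrite pickleK /C.
  case: pselect => /= [_|abs].
    by move=> j jN /=; rewrite nth_mkseq.
  exfalso; apply: abs => w wc; apply: eP => j jN.
  have := wc j jN; rewrite /= nth_mkseq// => h1; have h2 := fP j.
  rewrite (le_lt_trans (ler_distD (ratr (f j)) _ _))//.
  rewrite [X in _ + X]distrC (lt_trans (ltrD h1 h2))//.
  by rewrite [ltRHS]splitr ltrD.
rewrite preimage_bigcup; apply: bigcupT_measurable => k.
case: unpickle => [z|]; last by rewrite preimage_set0.
by rewrite /C; case: pselect => /= _; [exact: mcyl|rewrite preimage_set0].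
Qed.

Lemma continuous_measurable_Cspace (F : Cspace R m.+1 -> R) :
  continuous F -> measurable_fun setT F.
Proof.
move=> cF; apply: (measurability (@RGenOpens.G R)) => [|_ [_ [x [y ->]] <-]].
  exact: RGenOpens.measurableE.
rewrite setTI; apply: sub_sigma_algebra.
by move/continuousP : cF; apply; exact: interval_open.
Qed.

Lemma measurable_eval p : simplex R m.+1 p ->
  measurable_fun setT (fun w : Cspace R m.+1 => w p : R).
Proof. by move=> sp; apply: continuous_measurable_Cspace; exact: continuous_eval. Qed.

End Cspace_topology.

(** * Probability of small sets under an asymptotically constant density *)

Section density.
Context {R : realType} {n : nat}.
Hypothesis n_ge2 : (2 <= n)%N.
Variables (rho : 'rV[R]_n -> R) (alpha gamma : R).
Hypothesis gamma_gt0 : 0 < gamma.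
Hypothesis rho_h : asymptotically_homogeneous rho alpha (cst gamma).

Let at_right0 (Q : R -> Prop) : (\forall k \near 0^'+, Q k) ->
  exists2 d, 0 < d & forall k, 0 < k < d -> Q k.
Proof.
move=> /nbhs_ballP[d /= d0 dQ]; exists d => // k /andP[k0 kd].
by apply: dQ => //; rewrite /ball/= sub0r normrN gtr0_norm.
Qed.

(** Compare the limit along kappa x and along 2 kappa x: the homogeneity of the
    constant function gives 2 ^ (- alpha) = 1. *)
Lemma homogeneity_degree0 : alpha = 0.
Proof.
have [_ _ _ rho_cvg _] := rho_h.
have g0 := gamma_gt0.
pose x : 'rV[R]_n := const_mx 1.
have ox : orthant R n x by move=> i; rewrite mxE.
pose c : R := 2 `^ (- alpha).
have c0 : 0 < c by rewrite powR_gt0.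
suff /(congr1 (@ln R)) : c = 1.
  rewrite ln1 /c ln_powR => /eqP; rewrite mulf_eq0 oppr_eq0 => /orP[/eqP//|].
  by rewrite gt_eqF// ln_gt0// ltr1n.
suff c1 e : 0 < e -> `|c - 1| * gamma <= (1 + c) * e.
  apply/eqP; rewrite -subr_eq0 -normr_eq0; apply/negP => /negP N.
  have N0 : 0 < `|c - 1| by rewrite lt_neqAle eq_sym N normr_ge0.
  pose e := `|c - 1| * gamma / (2 * (1 + c)).
  have e0 : 0 < e by rewrite divr_gt0// mulr_gt0//; lra.
  have := c1 e e0; rewrite (_ : (1 + c) * e = `|c - 1| * gamma / 2).
    by have := mulr_gt0 N0 g0; lra.
  by rewrite /e; field; rewrite lt0r_neq0//; lra.
move=> e0.
have /cvgrPdist_lt/(_ e e0)/at_right0[d d0 dP] := rho_cvg x ox.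
have o2 : orthant R n (2 *: x) by move=> i; rewrite !mxE mulr1.
have /cvgrPdist_lt/(_ e e0)/at_right0[d' d'0 d'P] := rho_cvg _ o2.
pose k := Num.min d d' / 4.
have dd0 : 0 < Num.min d d' by rewrite lt_min d0.
have k0 : 0 < k by rewrite divr_gt0.
have kd : k * 2 < d.
  by have : Num.min d d' <= d by [rewrite ge_min lexx]; rewrite /k; lra.
have kd' : k < d'.
  by have : Num.min d d' <= d' by [rewrite ge_min lexx orbT]; rewrite /k; lra.
have h1 := dP (k * 2); have h2 := d'P k.
move: h1 h2; rewrite kd kd' k0 mulr_gt0//= => /(_ isT) h1 /(_ isT) h2.
move: h1 h2; rewrite /cst scalerA powRM ?(ltW k0)// -/c.
rewrite [k `^ _ * c]mulrC -mulrA; move: (k `^ _ * _) => Y h1 h2.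
rewrite -{1}[gamma]gtr0_norm// -normrM.
rewrite (_ : (c - 1) * gamma = c * (gamma - Y) - (gamma - c * Y)); last by ring.
rewrite (le_trans (ler_normB _ _))// normrM gtr0_norm// addrC mulrDl mul1r.
by rewrite lerD ?(ltW h1)// ler_pM2l// ltW.
Qed.

(** Every small z in the orthant is s *: p with p in the simplex and s small, so
    the uniform limit on the simplex applies. *)
Lemma density_near0 (e : R) : 0 < e -> exists2 d, 0 < d &
  forall z, orthant R n z -> \sum_i z ord0 i < d -> `|rho z - gamma| <= e.
Proof.
move=> e0; have [_ _ _ _ rho_u] := rho_h.
have entE : entourage [set xy : R * R | `|xy.1 - xy.2| < e].
  by rewrite -entourage_ballE; exists e.
have /rho_u : nbhs (cst gamma : {uniform` simplex R n -> R})
    [set h | forall p, simplex R n p -> `|gamma - h p| < e].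
  by apply/uniform_nbhs; eexists; split; first exact: entE.
move=> /at_right0[d d0 dP]; exists d => // z oz zd.
pose s := \sum_i z ord0 i.
have zs i : z ord0 i < s.
  rewrite /s (bigD1 i)//= ltrDl.
  pose j : 'I_n := if i == Ordinal (ltnW n_ge2) then Ordinal n_ge2 else Ordinal (ltnW n_ge2).
  have ji : j != i.
    by rewrite /j; case: (i =P Ordinal (ltnW n_ge2)) => [->|/eqP]; rewrite // eq_sym.
  rewrite (bigD1 j)//=; apply: ltr_pwDl; first exact: oz.
  by apply: sumr_ge0 => k _; exact/ltW/oz.
have s0 : 0 < s by apply: lt_trans (zs (Ordinal n_ge2)); exact: oz.
have sp : simplex R n (s^-1 *: z).
  split=> [i|].
    by rewrite mxE mulr_gt0 ?invr_gt0 ?oz//= mulrC ltr_pdivrMr// mul1r zs.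
  by under eq_bigr do rewrite mxE; rewrite -mulr_sumr mulVf// lt0r_neq0.
have := dP s; rewrite s0 zd => /(_ isT) /= /(_ _ sp).
rewrite homogeneity_degree0 oppr0 powRr0 mul1r scalerA mulfV ?lt0r_neq0// scale1r.
by rewrite distrC => /ltW.
Qed.

End density.

(** From exp (- u / (1 - u)) <= 1 - u <= exp (- u). *)
Lemma cvg_pow_expR {R : realType} (u : nat -> R) (L : R) :
  (forall k, 0 <= u k <= 1) -> (fun k => k.+1%:R * u k) @ \oo --> L ->
  (fun k => (1 - u k) ^+ k.+1) @ \oo --> expR (- L).
Proof.
move=> u01 uL.
have u_cvg0 : u @ \oo --> (0 : R).
  rewrite -[X in _ --> X](mul0r L).
  have -> : u = (fun k => harmonic k * (k.+1%:R * u k)).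
    by apply/funext => k; rewrite mulKf ?pnatr_eq0.
  by apply: cvgM => //; exact: cvg_harmonic.
have upper k : (1 - u k) ^+ k.+1 <= expR (- (k.+1%:R * u k)).
  rewrite -mulrN expRM_natl; apply: lerXn2r; rewrite ?nnegrE ?expR_ge0//.
    by rewrite subr_ge0; case/andP: (u01 k).
  exact: expR_ge1Dx.
have lower : \forall k \near \oo,
    expR (- (k.+1%:R * u k) * (1 - u k)^-1) <= (1 - u k) ^+ k.+1.
  have : \forall k \near \oo, u k < 1 by apply: (cvgr_lt 0 u_cvg0).
  apply: filterS => k uk1; have v0 : 0 < 1 - u k by rewrite subr_gt0.
  have -> : - (k.+1%:R * u k) * (1 - u k)^-1 = k.+1%:R * - (u k / (1 - u k)).
    by rewrite mulNr mulrN mulrA.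
  rewrite expRM_natl; apply: lerXn2r; rewrite ?nnegrE ?expR_ge0//; first exact: ltW.
  rewrite expRN -[leRHS]invrK lef_pV2 ?posrE ?invr_gt0// ?expR_gt0//.
  apply: le_trans (expR_ge1Dx _).
  by rewrite le_eqVlt; apply/orP; left; apply/eqP; field; rewrite lt0r_neq0.
have cvg_upper : (fun k => expR (- (k.+1%:R * u k))) @ \oo --> expR (- L).
  apply: (@continuous_cvg _ _ _ _ _ (fun k => - (k.+1%:R * u k)) (@expR R)).
    exact: continuous_expR.
  exact: cvgN.
apply: squeeze_cvgr cvg_upper.
  by apply: filterS lower => k h; apply/andP; split; [exact: h|exact: upper].
apply: (@continuous_cvg _ _ _ _ _ (fun k => - (k.+1%:R * u k) * (1 - u k)^-1) (@expR R)).
  exact: continuous_expR.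
have v1 : (fun k => 1 - u k) @ \oo --> (1 : R).
  have h := cvgB (@cvg_cst _ (1 : R) nat \oo _) u_cvg0.
  by rewrite subr0 in h; exact: h.
have h := cvgM (cvgN uL) (cvgV (@oner_neq0 R) v1).
by rewrite invr1 mulr1 in h; exact: h.
Qed.

Section rescaled_probability.
Context {R : realType} {m : nat}.
Hypothesis m_gt0 : (0 < m)%N.
Context d (T : measurableType d) (P : probability T R) (C : {RV P >-> 'rV[R]_m.+1}).
Variables (rho : 'rV[R]_m.+1 -> R) (alpha gamma : R).
Hypothesis rhoC : has_density_on_orthant P C rho.
Hypothesis gamma_gt0 : 0 < gamma.
Hypothesis rho_h : asymptotically_homogeneous rho alpha (cst gamma).
Local Notation vol := (lebesgue_rV R m.+1).

(** The factor K ^ (1 / n) of Cscaled_min, with the same shift of the index. *)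
Definition root_scale (K : nat) : R := K.+1%:R `^ m.+1%:R^-1.

Lemma root_scale_gt0 K : 0 < root_scale K.
Proof. by rewrite powR_gt0// ltr0n. Qed.

Lemma root_scaleX K : root_scale K ^+ m.+1 = K.+1%:R.
Proof.
rewrite -powR_mulrn; last exact/ltW/root_scale_gt0.
by rewrite /root_scale -powRrM mulVf ?pnatr_eq0// powRr1.
Qed.

Lemma root_scale_near (M : R) : \forall K \near \oo, M < root_scale K.
Proof.
have [M0|M0] := ltP M 0.
  by apply: nearW => K; exact: lt_trans (root_scale_gt0 K).
have : \forall K \near \oo, M ^+ m.+1 <= K%:R by exact: nbhs_infty_ger.
apply: filterS => K MK; rewrite -(@ltr_pXn2r _ m.+1)// ?nnegrE ?(ltW (root_scale_gt0 K))//.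
by rewrite root_scaleX (le_lt_trans MK)// ltr_nat.
Qed.

Lemma measurable_orthant : measurable (orthant R m.+1).
Proof.
have := @measurable_rV_box R m.+1 (fun=> [set` `]0, +oo[]) (fun=> measurable_itv _).
congr measurable; apply/seteqP; split=> x h i; have := h i; rewrite /= in_itv/= ?andbT//.
Qed.

Lemma measurable_scale_preimage (s : R) (S : set 'rV[R]_m.+1) : measurable S ->
  measurable [set z | S (s *: z)].
Proof.
move=> mS; have := measurable_mulmx_preimage s%:M mS.
by under eq_set do rewrite mul_mx_scalar.
Qed.

(** The rescaled set has volume vol S / (K + 1) and lies near the origin, where
    the density is uniformly close to gamma. *)
Lemma rescaled_probability_cvg (S : set 'rV[R]_m.+1) (b : R) :
  measurable S -> S `<=` orthant R m.+1 -> (forall x, S x -> `|x| <= b) ->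
  (fun K => K.+1%:R * fine (P (C @^-1` [set z | S (root_scale K *: z)]))) @ \oo -->
    gamma * fine (vol S).
Proof.
move=> mS So Sb; have [mrho rho0 rhoE] := rhoC.
have [b0|b0] := leP 0 b; last first.
  have S0 : S = set0 by rewrite -subset0 => x /Sb; have := normr_ge0 x; lra.
  have -> : vol S = 0%E by rewrite S0 measure0.
  rewrite mulr0; apply: (@cvg_trans _ ((fun=> 0 : R) @ \oo)).
    by apply: near_eq_cvg; apply: nearW => K; rewrite S0 (_ : C @^-1` _ = set0) ?measure0 ?mulr0.
  exact: cvg_cst.
have Sfin : vol S \is a fin_num by exact: ball_volume_fin b0 mS Sb.
have [V VE] : exists V, vol S = V%:E by exists (fine (vol S)); rewrite fineK.
have V0 : 0 <= V by rewrite -lee_fin -VE measure_ge0.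
rewrite VE /=; apply/cvgrPdist_le => e e0.
pose e' := e / (V + 1).
have e'0 : 0 < e' by rewrite divr_gt0//; lra.
have [r r0 rP] := density_near0 (m_gt0 : (2 <= m.+1)%N) gamma_gt0 rho_h e'0.
have := root_scale_near (m.+1%:R * b / r); apply: filterS => K sK.
set s := root_scale K in sK *.
have s0 : 0 < s by exact: root_scale_gt0.
set A := [set z | S (s *: z)].
have mA : measurable A by exact: measurable_scale_preimage.
have Ao : A `<=` orthant R m.+1.
  by move=> z /So oz i; have := oz i; rewrite mxE pmulr_rgt0.
have AV : vol A = (V / K.+1%:R)%:E.
  have := lebesgue_rV_scale s0 mS; rewrite VE -/A root_scaleX => VA.
  have Afin : vol A \is a fin_num.
    apply: (@ball_volume_fin _ _ (b / s)); rewrite ?divr_ge0 ?(ltW s0)// => x Ax.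
    by rewrite ler_pdivlMr//; have := Sb _ Ax; rewrite normrZ gtr0_norm// mulrC.
  move: VA; rewrite -(fineK Afin) => -[->]; congr (_%:E).
  by rewrite mulrAC mulfV ?mul1r// pnatr_eq0.
have PA : fine (P (C @^-1` A)) = fine (\int[vol]_(x in A) (rho x)%:E)%E.
  by rewrite -(rhoE A mA Ao).
have near x : A x -> `|rho x - gamma| <= e'.
  move=> Ax; apply: rP; first exact: Ao.
  have xb := Sb _ Ax; rewrite normrZ gtr0_norm// in xb.
  apply: (@le_lt_trans _ _ (m.+1%:R * `|x|)).
    apply: (@le_trans _ _ (\sum_(i < m.+1) `|x|)); last first.
      by rewrite sumr_const card_ord mulr_natl.
    by apply: ler_sum => i _; exact: le_trans (ler_norm _) (coord_le_norm x i).
  move: sK; rewrite ltr_pdivrMr// => sK.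
  rewrite -(ltr_pM2l s0) (le_lt_trans _ sK)// mulrCA ler_pM2l// ltr0n.
have := @fine_integral_near _ _ R vol A rho gamma e' (V / K.+1%:R) mA AV
  (measurable_funS measurable_orthant Ao mrho) (fun x Ax => rho0 x (Ao x Ax)) near
  (ltW gamma_gt0) (ltW e'0).
rewrite PA; move: (fine _) => I; have K0 : 0 < K.+1%:R :> R by rewrite ltr0n.
move: (K.+1%:R) K0 => k k0 h.
rewrite -(ler_pM2l k0) in h.
have -> : gamma * V - k * I = - (k * (I - gamma * (V / k))).
  by field; rewrite lt0r_neq0.
rewrite normrN normrM gtr0_norm// (le_trans h)//.
rewrite (_ : k * (e' * (V / k)) = e * (V / (V + 1))).
  by rewrite ler_piMr ?(ltW e0)// ler_pdivrMr ?mul1r; lra.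
have VN : V + 1 != 0 by rewrite lt0r_neq0//; lra.
by rewrite /e'; field; rewrite VN lt0r_neq0.
Qed.

End rescaled_probability.

(** * Evaluation events and their continuous relaxations *)

Section evaluation_events.
Context {R : realType} {m : nat}.
Hypothesis m_gt0 : (0 < m)%N.
Implicit Types (p x : 'rV[R]_m.+1) (w : Cspace R m.+1) (a : nat -> R).
Local Notation point := (@dense_point R m).

Definition dominates (N : nat) a : set (Cspace R m.+1) :=
  [set w | forall j, (j < N)%N -> a j <= w (point j)].

Lemma measurable_dominates N a : measurable (dominates N a).
Proof.
have -> : dominates N a = \bigcap_(j in `I_N) ((fun w => w (point j) : R) @^-1` [set` `[a j, +oo[]).
  by apply/seteqP; split=> w h j jN; have := h j jN; rewrite /= in_itv/= andbT.
apply: fin_bigcap_measurable => [|j _]; first exact: finite_II.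
rewrite -[X in measurable X]setTI; apply: measurable_eval => //.
exact: dense_point_in.
Qed.

Let clamp (t : R) : R := Num.max 0 (Num.min 1 t).

Let clamp_ge0 t : 0 <= clamp t.
Proof. by rewrite le_max lexx. Qed.

Let clamp_le1 t : clamp t <= 1.
Proof. by rewrite ge_max ler01 ge_min lexx. Qed.

Let clamp_continuous : continuous clamp.
Proof.
move=> t; apply: (@continuous_max R R (fun=> 0) (fun t => Num.min 1 t)).
  exact: cst_continuous.
apply: (@continuous_min R R (fun=> 1) id); first exact: cst_continuous.
by move=> ?; exact.
Qed.

(** A continuous function between the indicators of dominates N a and of
    dominates N (a - e). *)
Definition soft_dominates (N : nat) a (e : R) (w : Cspace R m.+1) : R :=
  \prod_(j < N) clamp ((w (point j) - a j) / e + 1).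

Lemma continuous_soft_dominates N a e : continuous (soft_dominates N a e).
Proof.
rewrite (_ : soft_dominates N a e = fun w : Cspace R m.+1 =>
  \prod_(j < N) clamp ((w (point j) - a j) / e + 1))//.
apply: continuous_big => [|j _ w]; first exact: mul_continuous.
apply: (@continuous_comp _ _ _ (fun w : Cspace R m.+1 => (w (point j) - a j) / e + 1) clamp); last exact: clamp_continuous.
apply: (@continuousD _ _ _ (fun w : Cspace R m.+1 => (w (point j) - a j) / e) (fun=> 1)); last exact: cst_continuous.
apply: (@continuousM _ _ (fun w : Cspace R m.+1 => w (point j) - a j) (fun=> e^-1)); last exact: cst_continuous.
apply: (@continuousB _ _ _ (fun w : Cspace R m.+1 => w (point j) : R) (fun=> a j)); last exact: cst_continuous.
by apply: continuous_eval; exact: dense_point_in.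
Qed.

Lemma soft_dominates_ge0 N a e w : 0 <= soft_dominates N a e w.
Proof. by apply: prodr_ge0. Qed.

Lemma soft_dominates_le1 N a e w : soft_dominates N a e w <= 1.
Proof.
by apply: prodr_ile1 => j _; rewrite clamp_ge0 clamp_le1.
Qed.

Lemma soft_dominates_eq1 N a e w : 0 < e -> dominates N a w -> soft_dominates N a e w = 1.
Proof.
move=> e0 aw; apply: big1 => j _; rewrite /clamp min_l ?max_r//.
by rewrite lerDr divr_ge0 ?(ltW e0)// subr_ge0 aw.
Qed.

Lemma soft_dominates_eq0 N a e w : 0 < e ->
  ~ dominates N (fun j => a j - e) w -> soft_dominates N a e w = 0.
Proof.
move=> e0 /existsNP[j /not_implyP[jN /negP]]; rewrite -ltNge => aw.
rewrite /soft_dominates (bigD1 (Ordinal jN))//= (_ : clamp _ = 0) ?mul0r//.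
rewrite /clamp max_l// ge_min; apply/orP; right.
by rewrite -lerBrDr sub0r ler_pdivrMr// mulN1r; lra.
Qed.

Lemma soft_dominates_integral (nu : {measure set (Cspace R m.+1) -> \bar R}) N a e : 0 < e ->
  (nu (dominates N a) <= \int[nu]_w (soft_dominates N a e w)%:E)%E /\
  (\int[nu]_w (soft_dominates N a e w)%:E <= nu (dominates N (fun j => a j - e)%R))%E.
Proof.
move=> e0.
have mF : measurable_fun setT (fun w => (soft_dominates N a e w)%:E).
  by apply/measurable_EFinP; apply: continuous_measurable_Cspace; exact: continuous_soft_dominates.
have ind b : nu (dominates N b) = (\int[nu]_w (\1_(dominates N b) w)%:E)%E.
  by rewrite integral_indic ?setIT//; exact: measurable_dominates.
have mI b : measurable_fun setT (fun w : Cspace R m.+1 => (\1_(dominates N b) w)%:E : \bar R).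
  by apply/measurable_EFinP; apply: measurable_indic; exact: measurable_dominates.
split; rewrite ind; apply: ge0_le_integral => // w _; rewrite lee_fin ?soft_dominates_ge0//.
- rewrite indicE; case: (pselect (dominates N a w)) => h.
    by rewrite mem_set// soft_dominates_eq1.
  by rewrite memNset// soft_dominates_ge0.
- rewrite indicE; case: (pselect (dominates N (fun j => a j - e) w)) => h.
    by rewrite mem_set// soft_dominates_le1.
  by rewrite memNset// soft_dominates_eq0.
Qed.

End evaluation_events.

(** * Scaled minima of independent copies *)

Section scaled_minimum.
Context {R : realType} {m : nat}.
Implicit Types (p x : 'rV[R]_m.+1) (w : Cspace R m.+1) (a : nat -> R).
Local Notation point := (@dense_point R m).

Lemma Crunmin_ge (l : nat -> Cspace R m.+1) K p (c : R) :
  (c <= Crunmin l K p) <-> (forall k, (k <= K)%N -> c <= l k p).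
Proof.
elim: K => [|K ih].
  by split=> [h k|]; [rewrite leqn0 => /eqP ->|exact].
have -> : Crunmin l K.+1 p = Num.min (Crunmin l K p) (l K.+1 p) by [].
rewrite le_min; split=> [/andP[/ih h1 h2] k|h].
  by rewrite leq_eqVlt ltnS => /predU1P[->|/h1].
by apply/andP; split; [apply/ih => k kK; apply: h; exact: leqW|exact: h].
Qed.

Lemma scaled_min_dominates (l : nat -> Cspace R m.+1) K N a :
  dominates N a (Cscaled_min l K) <->
  forall k, (k <= K)%N -> dominates N (fun j => a j / @root_scale R m K) (l k).
Proof.
have E p (c : R) : (c <= Cscaled_min l K p) = (c / @root_scale R m K <= Crunmin l K p).
  by rewrite ler_pdivrMr ?root_scale_gt0// mulrC.
split=> [h k kK j jN|h j jN]; first by move: (h j jN); rewrite E => /Crunmin_ge; exact.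
by rewrite E; apply/Crunmin_ge => k kK; exact: h.
Qed.

Hypothesis m_gt0 : (0 < m)%N.

Lemma measurable_scaled_min d (T : measurableType d) (l : nat -> T -> Cspace R m.+1) K :
  (forall k, measurable_fun setT (l k)) ->
  measurable_fun setT (fun t => Cscaled_min (l ^~ t) K).
Proof.
move=> ml; apply: measurable_fun_Cspace => // j.
have mev k : measurable_fun setT (fun t => l k t (point j) : R).
  apply: (@measurableT_comp _ _ _ _ _ _ (fun w : Cspace R m.+1 => w (point j) : R) _ (l k)).
    by apply: measurable_eval => //; exact: dense_point_in.
  exact: ml.
apply: (@measurable_funM _ _ _ setT (fun=> @root_scale R m K)
  (fun t => Crunmin (l ^~ t) K (point j))) => //.
elim: K => [|K ih]; first exact: mev.
exact: (measurable_minr ih (mev K.+1)).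
Qed.

End scaled_minimum.

Section survival_limit.
Context {R : realType} {m : nat}.
Hypothesis m_gt0 : (0 < m)%N.
Context d (T : measurableType d) (P : probability T R) (C : {RV P >-> 'rV[R]_m.+1}).
Hypothesis C_gt0 : forall t, orthant R m.+1 (C t).
Variables (rho : 'rV[R]_m.+1 -> R) (alpha gamma : R).
Hypothesis rhoC : has_density_on_orthant P C rho.
Hypothesis gamma_gt0 : 0 < gamma.
Hypothesis rho_h : asymptotically_homogeneous rho alpha (cst gamma).
Context d' (T' : measurableType d') (P' : probability T' R).
Variable l : nat -> {RV P' >-> Cspace R m.+1}.
Hypothesis l_indep : mutually_independent P' (fun k => l k : T' -> Cspace R m.+1).
Hypothesis l_copies : forall (k : nat) (B : set (Cspace R m.+1)), measurable B ->
  pushforward P' (l k) B = pushforward P (fun t => Clinear (C_gt0 t)) B.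
Implicit Types (p x : 'rV[R]_m.+1) (w : Cspace R m.+1) (a : nat -> R).
Local Notation point := (@dense_point R m).
Local Notation vol := (lebesgue_rV R m.+1).

(** The coefficients c for which the linear function <c, .> does not dominate a
    at the first N dense points. *)
Definition below (N : nat) a : set 'rV[R]_m.+1 :=
  \bigcup_(j in `I_N) halfspace (point j) (a j).

Lemma measurable_below N a : measurable (below N a).
Proof.
apply: bigcup_measurable => j _.
have -> : halfspace (point j) (a j) =
    orthant R m.+1 `&` (fun x => pairing x (point j)) @^-1` [set` `]-oo, a j[].
  by apply/seteqP; split=> x [ox h]; split=> //; move: h; rewrite /= in_itv/= pairingC.
apply: measurableI; first exact: measurable_orthant.
rewrite -[X in measurable X]setTI; apply: continuous_measurable_rV => //.
exact: continuous_pairingl.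
Qed.

Lemma below_orthant N a : below N a `<=` orthant R m.+1.
Proof. by move=> x [j _ []]. Qed.

Let scaled_min K t : Cspace R m.+1 := Cscaled_min (fun k => l k t) K.

Let mscaled_min K : measurable_fun setT (scaled_min K).
Proof. by apply: (@measurable_scaled_min R m m_gt0 _ _ (fun k => l k : T' -> _)). Qed.

Let Clinear_point t j : Clinear (C_gt0 t) (point j) = pairing (C t) (point j).
Proof.
rewrite (_ : Cfun _ = pairing (C t) \_ (csimplex R m.+1))// patchE mem_set//.
by apply: subset_closure; exact: dense_point_in.
Qed.

Let u N a K : R := fine (P (C @^-1` [set z | below N a (@root_scale R m K *: z)])).

(* The minimum dominates a iff every one of the K + 1 independent copies
   dominates a / root_scale K, that is iff no rescaled coefficient vector lies
   in below N a. *)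
Let event_probability N a K :
  P' (scaled_min K @^-1` dominates N a) = ((1 - u N a K) ^+ K.+1)%:E.
Proof.
pose B : set (Cspace R m.+1) := dominates N (fun j => a j / @root_scale R m K).
have mB : measurable B by exact: measurable_dominates.
have -> : scaled_min K @^-1` dominates N a =
    \bigcap_(k in [set` iota 0 K.+1]) (l k @^-1` B).
  apply/seteqP; split=> t /=.
    move=> /scaled_min_dominates h k kK; apply: h.
    have : k \in iota 0 K.+1 by exact: kK.
    by rewrite mem_iota add0n ltnS.
  move=> h; apply/scaled_min_dominates => k kK; apply: (h k).
  suff : k \in iota 0 K.+1 by exact.
  by rewrite mem_iota add0n ltnS.
rewrite (@l_indep (iota 0 K.+1) (fun=> B))//; last exact: iota_uniq.
have lB k : P' (l k @^-1` B) = (1 - u N a K)%:E.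
  have := l_copies k mB; rewrite /pushforward => ->.
  have s0 := @root_scale_gt0 R m K.
  have BE : (fun t => Clinear (C_gt0 t)) @^-1` B =
      ~` (C @^-1` [set z | below N a (@root_scale R m K *: z)]).
    apply/seteqP; split=> t /=.
      move=> h [j jN [_]]; have := h j jN.
      rewrite Clinear_point ler_pdivrMr// [pairing (point j) _]pairingC pairingZl mulrC => h1 h2.
      by have := le_lt_trans h1 h2; rewrite ltxx.
    move=> h j jN; rewrite Clinear_point ler_pdivrMr// leNgt; apply/negP => h1.
    apply: h; exists j => //; split.
      by move=> i; rewrite mxE mulr_gt0//; exact: C_gt0.
    by rewrite [pairing (point j) _]pairingC pairingZl mulrC.
  have mE : measurable (C @^-1` [set z | below N a (@root_scale R m K *: z)]).
    rewrite -[X in measurable X]setTI; apply: measurable_funPT => //.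
    by apply: measurable_scale_preimage; exact: measurable_below.
  by rewrite BE probability_setC// EFinB /u fineK// fin_num_measure.
rewrite (eq_bigr (fun=> (1 - u N a K)%:E)); last by move=> k _; exact: lB.
rewrite (_ : iota 0 K.+1 = index_iota 0 K.+1); last by rewrite /index_iota subn0.
by rewrite prodEFin prodr_const_nat subn0.
Qed.

Let event_cvg N a b : (forall x, below N a x -> `|x| <= b) ->
  P' (scaled_min K @^-1` dominates N a) @[K --> \oo] -->
    (expR (- (gamma * fine (vol (below N a)))))%:E.
Proof.
move=> ab; under eq_fun do rewrite event_probability.
apply: cvg_EFin; first by apply: nearW.
apply: (@cvg_pow_expR R (u N a)).
  move=> K; rewrite /u fine_ge0//=; apply: (@le_trans _ _ (fine (1%E : \bar R))) => //.
  apply: fine_le => //; last first.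
    apply: probability_le1; rewrite -[X in measurable X]setTI; apply: measurable_funPT => //.
    by apply: measurable_scale_preimage; exact: measurable_below.
  apply: fin_num_measure; rewrite -[X in measurable X]setTI; apply: measurable_funPT => //.
  by apply: measurable_scale_preimage; exact: measurable_below.
apply: (rescaled_probability_cvg m_gt0 rhoC gamma_gt0 rho_h _ _ ab).
  exact: measurable_below.
exact: below_orthant.
Qed.

Variable mu : probability (Cspace R m.+1) R.
Hypothesis mu_lim : weak_cvg
  (fun K => pushforward P' (fun t => Cscaled_min (l ^~ t) K)) mu.

Let soft_cvg N a e :
  (\int[pushforward P' (scaled_min K)]_w (soft_dominates N a e w)%:E)%E @[K --> \oo] -->
  (\int[mu]_w (soft_dominates N a e w)%:E)%E.
Proof.
apply: mu_lim; first exact: continuous_soft_dominates.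
exists 1 => w; rewrite ger0_norm ?soft_dominates_ge0//.
exact: soft_dominates_le1.
Qed.

(* the law of the scaled minimum, as a measure *)
Let law K : {measure set (Cspace R m.+1) -> \bar R} :=
  measure_function_pushforward__canonical__measure_function_Measure P' (mscaled_min K).

Lemma survival_lower N a b e : (forall x, below N a x -> `|x| <= b) -> 0 < e ->
  ((expR (- (gamma * fine (vol (below N a)))))%:E <= mu (dominates N (fun j => a j - e)%R))%E.
Proof.
move=> ab e0; have [_] := soft_dominates_integral m_gt0 mu N a e0; apply: le_trans.
apply: (lee_cvg_to (event_cvg ab) (@soft_cvg N a e)); apply: nearW => K.
by have [h _] := soft_dominates_integral m_gt0 (law K) N a e0.
Qed.

Lemma survival_upper N a b e : (forall x, below N (fun j => a j - e) x -> `|x| <= b) -> 0 < e ->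
  (mu (dominates N a) <= (expR (- (gamma * fine (vol (below N (fun j => a j - e)%R)))))%:E)%E.
Proof.
move=> ab e0; have [+ _] := soft_dominates_integral m_gt0 mu N a e0 => /le_trans; apply.
apply: (lee_cvg_to (@soft_cvg N a e) (event_cvg ab)); apply: nearW => K.
by have [_ h] := soft_dominates_integral m_gt0 (law K) N a e0.
Qed.

End survival_limit.

(** * Reduction to countably many evaluations *)

Section dense_comparison.
Context {R : realType} {m : nat}.
Hypothesis m_gt0 : (0 < m)%N.
Implicit Types (p x : 'rV[R]_m.+1) (w : Cspace R m.+1) (a : nat -> R).
Local Notation point := (@dense_point R m).

Lemma dense_point_csimplex p (d : R) : csimplex R m.+1 p -> 0 < d ->
  exists j, `|point j - p| < d.
Proof.
move=> cp d0; have d20 : 0 < d / 2 by rewrite divr_gt0.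
have [s [ss ps]] := cp _ (nbhsx_ballx p _ d20).
have [j js] := dense_point_approx m_gt0 ss d20; exists j.
rewrite (le_lt_trans (ler_distD s _ _))// [ltRHS]splitr ltrD//.
by rewrite distrC; move: ps; rewrite mx_norm_ball.
Qed.

Lemma Cspace_le_dense (psi w : Cspace R m.+1) :
  (forall j, psi (point j) <= w (point j)) ->
  forall p, csimplex R m.+1 p -> psi p <= w p.
Proof.
move=> h p cp; rewrite leNgt; apply/negP => wp.
have c0 : 0 < (psi p - w p) / 2 by rewrite divr_gt0// subr_gt0.
have [d d0 dP] := Cspace_continuous_at psi cp c0.
have [d' d'0 d'P] := Cspace_continuous_at w cp c0.
have dd0 : 0 < Num.min d d' by rewrite lt_min d0.
have [j] := dense_point_csimplex cp dd0; rewrite lt_min => /andP[jd jd'].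
have cj : csimplex R m.+1 (point j) by apply: subset_closure; exact: dense_point_in.
have := dP _ cj jd; have := d'P _ cj jd'; have := h j.
by rewrite !ltr_norml => ? /andP[? ?] /andP[? ?]; lra.
Qed.

Lemma nat_inv_lt (c : R) : 0 < c -> exists k, k.+1%:R^-1 < c.
Proof. by move=> c0; have [k] := ltr_add_invr c0; rewrite add0r => kc; exists k. Qed.

Lemma nat_inv_le k k' : (k <= k')%N -> k'.+1%:R^-1 <= k.+1%:R^-1 :> R.
Proof. by move=> kk; rewrite lef_pV2 ?posrE ?ltr0n// ler_nat. Qed.

(** Both sides are determined by the values on the dense sequence, by continuity
    on the closed simplex. *)
Lemma bigcap_dominates (psi : Cspace R m.+1) :
  \bigcap_N dominates N (fun j => psi (point j) - N.+1%:R^-1) =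
  [set w | forall p, csimplex R m.+1 p -> psi p <= w p].
Proof.
apply/seteqP; split=> w h.
  apply: Cspace_le_dense => j; rewrite leNgt; apply/negP => wj.
  have [k kc] := @nat_inv_lt (psi (point j) - w (point j)) ltac:(by rewrite subr_gt0).
  have := h (maxn j.+1 k) I j (leq_maxl _ _).
  have := @nat_inv_le k (maxn j.+1 k) (leq_maxr _ _).
  by move: (_^-1) kc (_^-1) => ? ? ?; lra.
move=> N _ j jN; apply: (@le_trans _ _ (psi (point j))).
  by rewrite gerBl invr_ge0.
by apply: h; apply: subset_closure; exact: dense_point_in.
Qed.

Lemma below_Rhat N (psi : Cspace R m.+1) (e : R) : 0 <= e ->
  below N (fun j => psi (point j) - e) `<=` Rhat psi.
Proof.
move=> e0 x [j _ [ox xj]]; exists (point j); first exact: dense_point_in.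
by split=> //; apply: (lt_le_trans xj); rewrite gerBl.
Qed.

(** If <p, x> < psi p, then the strict inequality persists at a nearby point of
    the dense sequence, with a margin. *)
Lemma bigcup_below (psi : Cspace R m.+1) :
  \bigcup_N below N (fun j => psi (point j) - N.+1%:R^-1) = Rhat psi.
Proof.
apply/seteqP; split=> [x [N _]|x [p sp [ox xp]]].
  by apply: below_Rhat; rewrite invr_ge0.
have c0 : 0 < (psi p - pairing p x) / 4 by rewrite divr_gt0// subr_gt0.
have cp : csimplex R m.+1 p by exact: subset_closure.
have [d d0 dP] := Cspace_continuous_at psi cp c0.
have [d' d'0 d'P] := continuous_at_dist (@continuous_pairingl R m.+1 x p) c0.
have dd0 : 0 < Num.min d d' by rewrite lt_min d0.
have [j] := dense_point_csimplex cp dd0; rewrite lt_min => /andP[jd jd'].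
have cj : csimplex R m.+1 (point j) by apply: subset_closure; exact: dense_point_in.
have [k kc] := nat_inv_lt c0.
exists (maxn j.+1 k) => //; exists j; first exact: leq_maxl.
split=> //; have := @nat_inv_le k (maxn j.+1 k) (leq_maxr _ _).
have := dP _ cj jd; have := d'P _ jd'; move: kc; rewrite !ltr_norml.
by move: (k.+1%:R^-1) ((maxn j.+1 k).+1%:R^-1) => ? ? ? /andP[? ?] /andP[? ?] ?; lra.
Qed.

End dense_comparison.

(** * The survival probability *)

Section survival_formula.
Context {R : realType} {m : nat}.
Hypothesis m_gt0 : (0 < m)%N.
Context d (T : measurableType d) (P : probability T R) (C : {RV P >-> 'rV[R]_m.+1}).
Hypothesis C_gt0 : forall t, orthant R m.+1 (C t).
Variables (rho : 'rV[R]_m.+1 -> R) (alpha gamma : R).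
Hypothesis rhoC : has_density_on_orthant P C rho.
Hypothesis gamma_gt0 : 0 < gamma.
Hypothesis rho_h : asymptotically_homogeneous rho alpha (cst gamma).
Context d' (T' : measurableType d') (P' : probability T' R).
Variable l : nat -> {RV P' >-> Cspace R m.+1}.
Hypothesis l_indep : mutually_independent P' (fun k => l k : T' -> Cspace R m.+1).
Hypothesis l_copies : forall (k : nat) (B : set (Cspace R m.+1)), measurable B ->
  pushforward P' (l k) B = pushforward P (fun t => Clinear (C_gt0 t)) B.
Variable mu : probability (Cspace R m.+1) R.
Hypothesis mu_lim : weak_cvg
  (fun K => pushforward P' (fun t => Cscaled_min (l ^~ t) K)) mu.
Variables (psi : Cspace R m.+1) (b : R).
Hypothesis Rhat_le : forall x, Rhat psi x -> `|x| <= b.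
Local Notation vol := (lebesgue_rV R m.+1).
Local Notation point := (@dense_point R m).

(* the loss e in the smoothing of the event with index N *)
Let slack (N : nat) : R := N.+1%:R^-1.

Let slack_gt0 N : 0 < slack N.
Proof. by rewrite /slack invr_gt0 ltr0n. Qed.

Let mRhat : measurable (Rhat psi).
Proof. by apply: open_measurable_rV; exact: Rhat_open. Qed.

Let fin_sub (S : set 'rV[R]_m.+1) : measurable S -> S `<=` Rhat psi -> vol S \is a fin_num.
Proof.
move=> mS Ssub; apply: (@ball_volume_fin _ _ `|b|) => // x /Ssub/Rhat_le xb.
exact: le_trans xb (ler_norm _).
Qed.

Lemma survival_formula :
  survival mu psi = (expR (- (gamma * fine (vol (Rhat psi)))))%:E.
Proof.
have sub N : below N (fun j => psi (point j) - slack N) `<=` Rhat psi.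
  by apply: below_Rhat => //; exact/ltW.
apply/eqP; rewrite eq_le; apply/andP; split.
- have G_cvg : vol \o (fun N => below N (fun j => psi (point j) - slack N)) @ \oo -->
      vol (Rhat psi).
    rewrite -(bigcup_below m_gt0 psi); apply: nondecreasing_cvg_mu.
    + by move=> N; exact: measurable_below.
    + by rewrite (bigcup_below m_gt0 psi).
    + move=> N N' NN'; apply/subsetPset => x [j /= jN [ox xj]]; exists j.
        exact: leq_trans NN'.
      by split=> //; apply: (lt_le_trans xj); rewrite lerD2l lerN2; exact: nat_inv_le.
  have h : (expR (- (gamma * fine (vol (below N (fun j => psi (point j) - slack N))))))%:E @[N --> \oo]
      --> (expR (- (gamma * fine (vol (Rhat psi)))))%:E.
    apply: cvg_EFin; first exact: nearW.
    apply: (@continuous_cvg _ _ _ _ _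
      (fun N => - (gamma * fine (vol (below N (fun j => psi (point j) - slack N))))) (@expR R)).
      exact: continuous_expR.
    apply: cvgN; apply: cvgM; first exact: cvg_cst.
    by apply: fine_cvg; rewrite fineK//; exact: fin_sub.
  apply: cvge_ge h; apply: nearW => N.
  have := @survival_upper R m m_gt0 d T P C C_gt0 rho alpha gamma rhoC gamma_gt0 rho_h
    d' T' P' l l_indep l_copies mu mu_lim N (fun j => psi (point j)) b (slack N)
    (fun x h => Rhat_le (sub N x h)) (slack_gt0 N).
  apply: le_trans; apply: le_measure; rewrite ?inE.
  + rewrite -(bigcap_dominates m_gt0); apply: bigcap_measurable => // k _.
    exact: measurable_dominates.
  + exact: measurable_dominates.
  + by move=> w h' j _; apply: h'; apply: subset_closure; exact: dense_point_in.
- have A_cvg : mu \o (fun N => dominates N (fun j => psi (point j) - slack N)) @ \oo -->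
      survival mu psi.
    rewrite /survival -(bigcap_dominates m_gt0); apply: nonincreasing_cvg_mu.
    + by rewrite (le_lt_trans (probability_le1 _ _)) ?ltry//; exact: measurable_dominates.
    + by move=> N; exact: measurable_dominates.
    + by apply: bigcap_measurable => // k _; exact: measurable_dominates.
    + move=> N N' NN'; apply/subsetPset => w h j jN.
      have := h j (leq_trans jN NN'); apply: le_trans.
      by rewrite lerD2l lerN2; exact: nat_inv_le.
  apply: cvge_ge A_cvg; apply: nearW => N /=.
  have sub0 : below N (fun j => psi (point j)) `<=` Rhat psi.
    by move=> x [j _ hj]; exists (point j) => //; exact: dense_point_in.
  have := @survival_lower R m m_gt0 d T P C C_gt0 rho alpha gamma rhoC gamma_gt0 rho_h
    d' T' P' l l_indep l_copies mu mu_lim N (fun j => psi (point j)) b (slack N)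
    (fun x h => Rhat_le (sub0 x h)) (slack_gt0 N).
  apply: le_trans; rewrite lee_fin ler_expR lerN2 ler_pM2l//.
  apply: fine_le; rewrite ?fin_sub//; first exact: measurable_below.
  by apply: le_measure; rewrite ?inE//; exact: measurable_below.
Qed.

End survival_formula.

Theorem theorem4p7 (R : realType) (n : nat) (n_ge2 : (2 <= n)%N)
    (psi : Cspace R n)
    (psi_C2 : C2_on (chart_domain R n) (psi \o @chart R n))
    (psi_bd : forall p, (csimplex R n `\` simplex R n) p -> psi p = 0)
    (Rhat_bd : bounded_set (Rhat psi)) :
  lebesgue_rV R n (Rhat psi) =
    ((n%:R^-1)%:E * \int[lebesgue_rV R n.-1]_(q in chart_domain R n)
      (psi (@chart R n q) * \det (- hessian (psi \o @chart R n) q))%:E)%E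
  /\
  forall (d : measure_display) (T : measurableType d) (P : probability T R)
    (C : {RV P >-> 'rV[R]_n}) (C_gt0 : forall t, orthant R n (C t))
    (rho : 'rV[R]_n -> R) (rhoC : has_density_on_orthant P C rho)
    (alpha gamma : R) (gamma_gt0 : 0 < gamma)
    (rho_h : asymptotically_homogeneous rho alpha (cst gamma))
    (d' : measure_display) (T' : measurableType d') (P' : probability T' R)
    (l : nat -> {RV P' >-> Cspace R n})
    (l_indep : mutually_independent P' (fun k => l k : T' -> Cspace R n))
    (l_copies : forall (k : nat) (B : set (Cspace R n)), measurable B ->
      pushforward P' (l k) B =
      pushforward P (fun t => Clinear (C_gt0 t)) B)
    (mu : probability (Cspace R n) R)
    (mu_lim : weak_cvg
      (fun K => pushforward P' (fun t => Cscaled_min (l ^~ t) K)) mu),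
  alpha = 0 /\
  survival mu psi =
    expeR (- ((gamma / n%:R)%:E * \int[lebesgue_rV R n.-1]_(q in chart_domain R n)
      (psi (@chart R n q) * \det (- hessian (psi \o @chart R n) q))%:E))%E.
Proof.
case: n n_ge2 psi psi_C2 psi_bd Rhat_bd => // m m_gt0 psi psi_C2 psi_bd Rhat_bd.
have [b b0 Rhat_le] : exists2 b, 0 < b & forall x, Rhat psi x -> `|x| <= b.
  have [M [_ MP]] := Rhat_bd; exists (`|M| + 1); first by rewrite ltr_wpDl.
  by apply: MP; rewrite (le_lt_trans (ler_norm M))// ltrDl.
have volE := Rhat_volume m_gt0 psi_bd psi_C2 b0 Rhat_le; split; first exact: volE.
move=> d T P C C_gt0 rho rhoC alpha gamma gamma_gt0 rho_h d' T' P' l l_indep l_copies mu mu_lim.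
split; first exact: (homogeneity_degree0 gamma_gt0 rho_h).
rewrite (survival_formula m_gt0 rhoC gamma_gt0 rho_h l_indep l_copies mu_lim Rhat_le).
have volF : lebesgue_rV R m.+1 (Rhat psi) \is a fin_num.
  apply: (@ball_volume_fin _ _ b) => //; first exact: ltW.
  by apply: open_measurable_rV; exact: Rhat_open.
have -> : ((gamma / m.+1%:R)%:E * \int[lebesgue_rV R m]_(q in chart_domain R m.+1)
    (psi (@chart R m.+1 q) * \det (- hessian (psi \o @chart R m.+1) q))%:E =
    gamma%:E * lebesgue_rV R m.+1 (Rhat psi))%E.
  by rewrite EFinM -muleA; congr (_ * _)%E; exact/esym/volE.
by rewrite -(fineK volF) -EFinM -EFinN.
Qed.
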